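(* Fix $a>0$ and $\beta_1\in(0,1)$, and put $\rho^*:=\rho^*_{\mathrm{2-side}}(a,\beta_1)$, where $$\rho^*_{\mathrm{2-side}}(a,\beta)^2:=\begin{cases} p^{(a-(1-2\beta))/2} & a\le 1-2\beta,\\ (a-(1-2\beta))\log p & 1-2\beta<a\le 1-4\beta/3,\\ 2(\sqrt{1-a}-\sqrt{1-a-\beta})^2\log p & 1-4\beta/3<a\le 1-\beta,\\ p^{a-(1-\beta)} & a>1-\beta.\end{cases}$$ Let $\beta\in(0,1)$ and let $n=n_p$, $s=s_p$ satisfy $\log\log\log n\sim a\log p$ and $s\sim p^{1-\beta}$ as $p\to\infty$. (1) (Lower bound) If $\beta>\beta_1$, then $\mathcal R_{\mathrm{2-side}}(p,n,\rho^*,s)\not\to0$. (2) (Upper bound) If $\beta<\beta_1$, then $\mathcal R_{\mathrm{2-side}}(p,n,\rho^*,s)\to0$.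
   Context: Observation model: $X=\theta+E\in\mathbb R^{p\times n}$, $E$ with i.i.d. $N(0,1)$ entries. Null class $\Theta_0(p,n)=\{\theta:\text{each row of }\theta\text{ is constant}\}$. Two-sided alternative class $\Theta_1^{\mathrm{2-side}}(p,n,\rho,s)$: the set of $\theta$ for which there exist $t^*\in[n-1]$, reals $\mu_{j1},\mu_{j2}$ ($j\in[p]$) and $S\subseteq[p]$ with $|S|\ge s$ such that $\theta_{ji}=\mu_{j1}$ for $i\le t^*$, $\theta_{ji}=\mu_{j2}$ for $i>t^*$, and $\sqrt{t^*(n-t^* )/n}\,|\mu_{j1}-\mu_{j2}|\ge\rho$ for all $j\in S$. $\mathcal R_{\mathrm{2-side}}(p,n,\rho,s)=\inf_\psi\big[\sup_{\theta\in\Theta_0}\mathbb E_\theta\psi(X)+\sup_{\theta\in\Theta_1^{\mathrm{2-side}}(p,n,\rho,s)}\mathbb E_\theta(1-\psi(X))\big]$ over measurable tests $\psi:\mathbb R^{p\times n}\to\{0,1\}$. $a_p\sim b_p$ means $a_p/b_p\to1$. *)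

(* Defs.v *)
From HB Require Import structures.
From mathcomp Require Import all_boot all_order all_algebra.
From mathcomp Require Import all_classical all_reals all_analysis.
Set Implicit Arguments. Unset Strict Implicit. Unset Printing Implicit Defensive.
Import Order.TTheory GRing.Theory Num.Theory.
Import numFieldNormedType.Exports.
Local Open Scope classical_set_scope.
Local Open Scope ring_scope.

Section changepoint.
Variable R : realType.

(** Observation space R^{p x n}, encoded as p rows, each an n-tuple of reals,
    with the product (coordinate) sigma-algebra of mathcomp-analysis
    (= Borel sigma-algebra of R^{p n}). *)
Definition obs (p n : nat) := p.-tuple (n.-tuple R).

Definition obs_of_mx (p n : nat) (M : 'M[R]_(p, n)) : obs p n :=
  [tuple [tuple M j i | i < n] | j < p].

(** Iterated integral against the standard Gaussian N(0,1) in each of the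
    coordinates listed in [s]; by Tonelli this is the integral w.r.t. the
    product Gaussian measure for nonnegative measurable integrands. *)
Fixpoint gauss_iter (I : eqType) (s : seq I) (F : (I -> R) -> \bar R)
    (e : I -> R) {struct s} : \bar R :=
  match s with
  | [::] => F e
  | k :: s' => (\int[normal_prob (0:R) 1]_t
                  gauss_iter s' F (fun k' => if k' == k then t else e k'))%E
  end.

Definition gauss_expect (p n : nat) (theta : 'M[R]_(p, n))
    (f : obs p n -> R) : \bar R :=
  gauss_iter (enum {: 'I_p * 'I_n})
    (fun e => (f (obs_of_mx (theta + \matrix_(j, i) e (j, i))))%:E)
    (fun _ => 0).

Definition is_test (p n : nat) (psi : obs p n -> bool) : Prop :=
  measurable_fun [set: obs p n] psi.

Definition Theta0 (p n : nat) : set 'M[R]_(p, n) :=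
  [set theta | forall (j : 'I_p) (i i' : 'I_n), theta j i = theta j i'].

(** Two-sided alternative class (time indices are 0-based: column i
    corresponds to time i+1, so "time <= t*" is "i < t*"). *)
Definition Theta1_2side (p n : nat) (rho : R) (s : nat) : set 'M[R]_(p, n) :=
  [set theta | exists (t : nat) (mu1 mu2 : 'I_p -> R) (S : {set 'I_p}),
     [/\ (1 <= t <= n.-1)%N, (s <= #|S|)%N,
         (forall (j : 'I_p) (i : 'I_n),
            theta j i = if (i < t)%N then mu1 j else mu2 j) &
         (forall j, j \in S ->
            Num.sqrt ((t%:R * (n - t)%:R) / n%:R) * `|mu1 j - mu2 j| >= rho)]].

Definition risk_2side (p n : nat) (rho : R) (s : nat) : \bar R :=
  ereal_inf [set (ereal_sup [set @gauss_expect p n theta (fun x => ((psi x)%:R : R)%R)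
                             | theta in @Theta0 p n]
                  + ereal_sup [set @gauss_expect p n theta (fun x => (1 - (psi x)%:R : R)%R)
                               | theta in @Theta1_2side p n rho s])%E
            | psi in @is_test p n].

Definition rho_star_sq (a beta : R) (p : nat) : R :=
  if a <= 1 - 2 * beta then (p%:R) `^ ((a - (1 - 2 * beta)) / 2)
  else if a <= 1 - 4 * beta / 3 then (a - (1 - 2 * beta)) * ln p%:R
  else if a <= 1 - beta then
    2 * (Num.sqrt (1 - a) - Num.sqrt (1 - a - beta)) ^+ 2 * ln p%:R
  else (p%:R) `^ (a - (1 - beta)).

Definition rho_star (a beta : R) (p : nat) : R := Num.sqrt (rho_star_sq a beta p).

End changepoint.

(* Main.v *)
(** Lower bound.  Draw the change point uniformly from the M = log_B n powers of B = p^d below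
    n, and place one row of energy rho^2 with random position and sign in each of s blocks of
    p/s rows.  CUSUM contrasts at distinct scales are nearly orthogonal, so the likelihood
    ratio L of the mixture is an average of M almost uncorrelated ratios L_k.  By subadditivity
    of x^g, the (1 + g)-moment of L stays bounded once that of each L_k is at most M^g.  Since
    log M = p^(a + o(1)), it suffices that s (p/s)^(-g) exp(g (1 + g) rho^2 / 2), which bounds
    the log of the moment of L_k, is at most p^(a - kappa).  In the sparse regime
    rho^2 = 2 r log p the best g is (beta1 / r - 1) / 2; in the other regimes g = 1, with a cosh
    computation when rho <= 1.  A bounded (1 + g)-moment, g > 0, keeps the testing risk away
    from 0.

    Upper bound.  Summing over the rows a bounded score of the CUSUM gives, for each change
    point, a sum of independent variables in [0, 1] with exponential tails.  It suffices to scan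
    a grid of O(log n) change points equispaced in log-odds: the union bound costs
    log log n = p^(a + o(1)), while for beta < beta1 the Chernoff exponents are at least
    p^(a + delta).  The score is 1 - exp(- y^2 / 2) when rho <= 1, the indicator of
    |y| > sqrt (2 q log p) with q = 4 r or 1 - a when rho^2 = 2 r log p, and the indicator of
    |y| > rho / 2 for polynomially large rho. *)
Require Import Defs.
From HB Require Import structures.
From mathcomp Require Import all_boot all_order all_algebra.
From mathcomp Require Import all_classical all_reals all_analysis.
From mathcomp Require Import measurable_realfun lebesgue_measure lebesgue_integral.
From mathcomp Require Import ring lra.
Set Implicit Arguments. Unset Strict Implicit. Unset Printing Implicit Defensive.
Import Order.TTheory GRing.Theory Num.Theory.
Import numFieldNormedType.Exports.
Local Open Scope classical_set_scope.
Local Open Scope ring_scope.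

(** * Gaussian integrals *)

(** At order 2 the exponent 1 - 2 beta1 + 2 r would exceed a in the sparse regime, hence the
    fractional order g. A fractional power of a mixture cannot be expanded, so x^g is bounded by
    subadditivity around the true component and by its tangent at 1 on the rest; what remains is
    linear in exponentials and integrates exactly. The random sign makes distinct choices within a
    block nonpositively correlated, and for small rho it turns e^(rho^2) - 1 into cosh(rho^2) - 1,
    of order rho^4.

    For the test, a score with values in [0, 1] and mean q has moment generating function at most
    exp((e^l - 1) q), so one tail bound serves all regimes and only means have to be estimated. The
    level q = 4 r maximises 1 - 2 beta - 2 (sqrt q - sqrt r)^2 + q, the exponent of the squared
    signal over the null count p^(1 - q); it is admissible while the signal p^(1 - beta - (sqrt q -
    sqrt r)^2) itself reaches p^a, after which q = 1 - a takes over.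

    In every regime the governing exponent equals a exactly at beta = beta1, so a strict inequality
    leaves a power of p, which absorbs all constants. *)

Section OneDim.
Context {R : realType}.
Notation mu := (@lebesgue_measure R).
Local Open Scope ereal_scope.
Import HBNNSimple.

(** The hypothesis is the identity on indicators; linearity extends it to simple functions and
    monotone convergence to [f]. *)
Lemma ge0_integral_density d (T : measurableType d) (m nu : {measure set T -> \bar R})
    (w : T -> R) (f : T -> \bar R) :
  measurable_fun setT w -> (forall x, 0 <= w x)%R ->
  (forall A, measurable A -> nu A = \int[m]_(x in A) (w x)%:E) ->
  measurable_fun setT f -> (forall x, 0 <= f x) ->
  \int[nu]_x f x = \int[m]_x (f x * (w x)%:E).
Proof.
move=> mw w0 nuE mf f0.
pose f_ := nnsfun_approx measurableT mf.
have f_cvg x : (f_ k x)%:E @[k --> \oo] --> f x.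
  by apply: cvg_nnsfun_approx => //.
transitivity (limn (fun k => \int[nu]_x (f_ k x)%:E)).
  rewrite -monotone_convergence//.
  - by apply: eq_integral => x _; apply/esym/cvg_lim.
  - by move=> k; exact/measurable_EFinP/measurable_funP.
  - by move=> k y _; rewrite lee_fin.
  - by move=> y _ a b ab; rewrite lee_fin; exact/lefP/nd_nnsfun_approx.
transitivity (limn (fun k => \int[m]_x ((f_ k x)%:E * (w x)%:E))).
  congr (limn _); apply/funext => k.
  under eq_integral do rewrite fimfunE -fsumEFin//.
  rewrite ge0_integral_fsum//; last 2 first.
  - by move=> y; exact/measurable_EFinP/measurable_funM.
  - by move=> y x _; rewrite nnfun_muleindic_ge0.
  under [RHS]eq_integral => x _.
    rewrite fimfunE -fsumEFin// ge0_mule_fsuml; last first.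
      by move=> y; rewrite nnfun_muleindic_ge0.
    over.
  rewrite /= ge0_integral_fsum//; last 2 first.
  - move=> y; apply/measurable_EFinP/measurable_funM => //.
    exact: measurable_funM.
  - by move=> y x _; apply: mule_ge0; [exact: nnfun_muleindic_ge0|rewrite lee_fin].
  apply: eq_fsbigr => r rf.
  rewrite integralZl_indic_nnsfun// integral_indic//= setIT nuE//.
  have r0 : (0 <= r)%R.
    by move: rf; rewrite inE => -[x _ <-].
  under [RHS]eq_integral do rewrite EFinM -muleA.
  rewrite ge0_integralZl//=; last 2 first.
  - exact/measurable_EFinP/measurable_funM.
  - by move=> x _; rewrite lee_fin mulr_ge0.
  congr (_ * _).
  rewrite [in LHS]integral_mkcond; apply: eq_integral => x _.
  by rewrite patchE indicE; case: ifP => _; rewrite ?mul1e ?mul0e.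
rewrite -monotone_convergence//.
- apply: eq_integral => x _; apply/cvg_lim => //.
  exact: cvgeZr.
- by move=> k; exact/measurable_EFinP/measurable_funM.
- by move=> k x _; rewrite mule_ge0// lee_fin.
- move=> x _ a b ab; apply: lee_wpmul2r; rewrite ?lee_fin//.
  exact/lefP/nd_nnsfun_approx.
Qed.

Lemma integral_normal_prob_pdf (c s : R) (f : R -> \bar R) :
  measurable_fun setT f -> (forall x, 0 <= f x) ->
  \int[normal_prob c s]_x f x = \int[mu]_x (f x * (normal_pdf c s x)%:E).
Proof.
move=> mf f0.
apply: (@ge0_integral_density _ _ mu (normal_prob c s) (normal_pdf c s)) => //.
- exact: measurable_normal_pdf.
- by move=> x; rewrite normal_pdf_ge0.
Qed.

Lemma ge0_integral_lebesgue_shift (c : R) (f : R -> \bar R) :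
  measurable_fun setT f -> (forall x, 0 <= f x) ->
  \int[mu]_x f (c + x)%R = \int[mu]_x f x.
Proof.
move=> mf f0.
have mc : measurable_fun setT (fun x : measurableTypeR R => (c + x)%R : measurableTypeR R) by exact: measurable_funD.
rewrite -(@ge0_integral_pushforward _ _ _ _ _ _ mc mu setT f)//.
apply: eq_measure_integral => //= A mA _.
apply/esym/lebesgue_measure_unique => //= _ [[a b]] _ <-.
rewrite /pushforward (_ : _ @^-1` _ = `](a - c)%R, (b - c)%R]%classic).
  rewrite !lebesgue_measure_itv/= !lte_fin ltrD2r; case: ifP => // _.
  by rewrite -!EFinB; congr EFin; ring.
by apply/seteqP; split => x /=; rewrite !in_itv/= ltrBlDl lerBrDl.
Qed.

Lemma ge0_integral_lebesgue_scale (c : R) (f : R -> \bar R) : (0 < c)%R ->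
  measurable_fun setT f -> (forall x, 0 <= f x) ->
  \int[mu]_x f (c * x)%R = c^-1%:E * \int[mu]_x f x.
Proof.
move=> c0 mf f0.
have mc : measurable_fun setT (fun x : measurableTypeR R => (c * x)%R : measurableTypeR R) by exact: measurable_funM.
rewrite -(@ge0_integral_pushforward _ _ _ _ _ _ mc mu setT f)//.
have cV0 : (0 <= c)%R by exact: ltW.
pose nu :=
  (pushforward mu (fun x : measurableTypeR R => (c * x)%R : measurableTypeR R)
   : {measure set (measurableTypeR R) -> \bar R}).
(* Multiplied by [c], the pushforward agrees with Lebesgue measure on half-open intervals, hence
   everywhere. *)
transitivity (c^-1%:E * \int[mscale (NngNum cV0) (nu mc)]_x f x).
  rewrite ge0_integral_mscale//= muleA -EFinM mulVf ?gt_eqF// mul1e//.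
congr (_ * _); apply: eq_measure_integral => //= A mA _.
apply/esym/lebesgue_measure_unique => //= _ [[a b]] _ <-.
rewrite /mscale/= /pushforward (_ : _ @^-1` _ = `](a / c)%R, (b / c)%R]%classic).
  rewrite !lebesgue_measure_itv/= !lte_fin ltr_pM2r ?invr_gt0//; case: ifP => // _.
    rewrite -!EFinB -EFinM; congr EFin; field; exact: lt0r_neq0.
  by rewrite mule0.
by apply/seteqP; split => x /=; rewrite !in_itv/= ltr_pdivrMr// ler_pdivlMr// mulrC.
Qed.
End OneDim.

(** * Shifts, reflections and convolutions of the standard Gaussian *)

Section OneDimGauss.
Context {R : realType}.
Notation mu := (@lebesgue_measure R).
Notation N01 := (normal_prob (0 : R) 1).
Local Open Scope ereal_scope.

Lemma normal_pdf_shift (c x : R) :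
  (normal_pdf 0 1 (x - c) = normal_pdf 0 1 x * expR (c * x - c ^+ 2 / 2))%R.
Proof.
rewrite !normal_pdfE ?oner_eq0// /normal_fun -mulrA -expRD; congr (_ * expR _)%R.
by field.
Qed.

Lemma normal_pdfN (x : R) : (normal_pdf 0 1 (- x) = normal_pdf 0 1 x)%R.
Proof.
rewrite !normal_pdfE ?oner_eq0// /normal_fun; congr (_ * expR _)%R.
by field.
Qed.

Lemma measurable_normal_pdfE (c s : R) :
  measurable_fun [set: R] (fun x => (normal_pdf c s x)%:E).
Proof. by apply/measurable_EFinP; exact: measurable_normal_pdf. Qed.

Lemma integral_gauss_cst (x : \bar R) : \int[N01]_t x = x.
Proof.
by rewrite integral_cst// [X in _ * X]probability_setT mule1.
Qed.

(** Cameron-Martin formula in dimension one: translating Lebesgue measure moves the shift into the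
    density. *)
Lemma integral_gaussD (c : R) (f : R -> \bar R) :
  measurable_fun setT f -> (forall x, 0 <= f x) ->
  \int[N01]_x f (c + x)%R = \int[N01]_x (f x * (expR (c * x - c ^+ 2 / 2))%:E).
Proof.
move=> mf f0.
rewrite !integral_normal_prob_pdf//; last 3 first.
- apply: emeasurable_funM => //; apply/measurable_EFinP.
  apply: measurableT_comp => //; apply: measurable_funB => //.
- by move=> x; rewrite mule_ge0// lee_fin expR_ge0.
- by apply: (measurableT_comp mf); exact: measurable_funD.
pose g u := f u * (normal_pdf 0 1 (u - c))%:E.
transitivity (\int[mu]_x g (c + x)%R).
  by apply: eq_integral => x _; rewrite /g; congr (_ * (normal_pdf 0 1 _)%:E); ring.
rewrite ge0_integral_lebesgue_shift; last 2 first.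
- apply: emeasurable_funM => //; apply/measurable_EFinP.
  apply: (measurableT_comp (measurable_normal_pdf 0 1)).
  exact: measurable_funB.
- by move=> x; rewrite mule_ge0// lee_fin normal_pdf_ge0.
by apply: eq_integral => x _; rewrite /g normal_pdf_shift -muleA -EFinM [X in _ = _ * X%:E]mulrC.
Qed.

Lemma integral_gaussN (f : R -> \bar R) :
  measurable_fun setT f -> (forall x, 0 <= f x) ->
  \int[N01]_x f (- x)%R = \int[N01]_x f x.
Proof.
move=> mf f0.
rewrite !integral_normal_prob_pdf//; last first.
  by apply: (measurableT_comp mf); exact: oppr_measurable.
have mN : measurable_fun setT (fun x : measurableTypeR R => (- x)%R : measurableTypeR R).
  exact: oppr_measurable.
transitivity (\int[mu]_x ((fun u => f u * (normal_pdf 0 1 u)%:E) \o (fun x : measurableTypeR R => (- x)%R : measurableTypeR R)) x).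
  by apply: eq_integral => x _ /=; rewrite normal_pdfN.
rewrite -(@ge0_integral_pushforward _ _ _ _ _ _ mN mu setT)//.
- by apply: eq_measure_integral => //= A mA _; exact: lebesgue_measureN.
- by apply: emeasurable_funM => //; exact: measurable_normal_pdfE.
- by move=> x _; rewrite mule_ge0// lee_fin normal_pdf_ge0.
Qed.

Lemma normal_pdf_affine (m s u : R) : (0 < s)%R ->
  (normal_pdf 0 1 ((u - m) / s) = s * normal_pdf m s u)%R.
Proof.
move=> s0; have sn0 : (s != 0)%R by rewrite gt_eqF.
rewrite !normal_pdfE ?oner_eq0// /normal_fun mulrA; congr (_ * expR _)%R.
  rewrite /normal_peak expr1n mul1r -mulrnAr sqrtrM ?sqr_ge0// sqrtr_sqr gtr0_norm//.
  rewrite invfM mulrA divff// mul1r//.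
by field.
Qed.

Lemma integral_gauss_affine (m s : R) (f : R -> \bar R) : (0 < s)%R ->
  measurable_fun setT f -> (forall x, 0 <= f x) ->
  \int[N01]_x f (m + s * x)%R = \int[normal_prob m s]_x f x.
Proof.
move=> s0 mf f0; have sn0 : (s != 0)%R by rewrite gt_eqF.
have mm : measurable_fun setT (fun x => f (m + x)%R).
  by apply: (measurableT_comp mf); exact: measurable_funD.
have mms : measurable_fun setT (fun x => f (m + s * x)%R).
  apply: (measurableT_comp mf); apply: measurable_funD => //.
rewrite (integral_normal_prob_pdf _ _ mms (fun=> f0 _)) (integral_normal_prob_pdf _ _ mf f0).
pose g u := f (m + u)%R * (normal_pdf 0 1 (u / s))%:E.
transitivity (\int[mu]_x g (s * x)%R).
  by apply: eq_integral => x _; rewrite /g; congr (_ * (normal_pdf 0 1 _)%:E); field.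
have mp : measurable_fun setT (fun x : R => normal_pdf 0 1 (x / s)).
  apply: (measurableT_comp (measurable_normal_pdf 0 1)).
  exact: measurable_funM.
rewrite ge0_integral_lebesgue_scale//; last 2 first.
- by apply: emeasurable_funM => //; exact/measurable_EFinP.
- by move=> x; rewrite mule_ge0// lee_fin normal_pdf_ge0.
pose h u := f u * (normal_pdf 0 1 ((u - m) / s))%:E.
have -> : \int[mu]_x g x = \int[mu]_x h (m + x)%R.
  apply: eq_integral => x _.
  by rewrite /g /h;  congr (_ * (normal_pdf 0 1 _)%:E); field.
have mp' : measurable_fun setT (fun x : R => normal_pdf 0 1 ((x - m) / s)).
  apply: (measurableT_comp (measurable_normal_pdf 0 1)).
  by apply: measurable_funM => //; exact: measurable_funB.
rewrite ge0_integral_lebesgue_shift//; last 2 first.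
- by apply: emeasurable_funM => //; exact/measurable_EFinP.
- by move=> x; rewrite mule_ge0// lee_fin normal_pdf_ge0.
rewrite -ge0_integralZl//=; last 3 first.
- by apply: emeasurable_funM => //; exact/measurable_EFinP.
- by move=> x _; rewrite mule_ge0// lee_fin normal_pdf_ge0.
- by rewrite lee_fin invr_ge0 ltW.
apply: eq_integral => x _.
by rewrite /h normal_pdf_affine// muleCA -EFinM mulKf.
Qed.

(** Bayes factorisation of the joint density of T ~ N(0,1) and U = a T + b Z: conditional of U times
    law of T on the left, law of U times conditional of T on the right. *)
Lemma normal_pdf_conv (a b t u : R) : (0 < b)%R ->
  let S := Num.sqrt (a ^+ 2 + b ^+ 2) in
  (normal_pdf (a * t) b u * normal_pdf 0 1 t =
   normal_pdf 0 S u * normal_pdf (a * u / S ^+ 2) (b / S) t)%R.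
Proof.
move=> b0 S; have bn0 : (b != 0)%R by rewrite gt_eqF.
have ab0 : (0 < a ^+ 2 + b ^+ 2)%R by rewrite ltr_wpDl ?sqr_ge0// exprn_gt0.
have S0 : (0 < S)%R by rewrite sqrtr_gt0.
have Sn0 : (S != 0)%R by rewrite gt_eqF.
have S2 : (S ^+ 2 = a ^+ 2 + b ^+ 2)%R by rewrite sqr_sqrtr// ltW.
have bSn0 : (b / S != 0)%R by rewrite mulf_neq0// invr_eq0.
rewrite !normal_pdfE ?oner_eq0//.
have pk s : (0 < s)%R -> normal_peak s = (s^-1 * (Num.sqrt (pi *+ 2))^-1)%R.
  move=> s0; rewrite /normal_peak -mulrnAr sqrtrM ?sqr_ge0// sqrtr_sqr gtr0_norm//.
  by rewrite invfM.
rewrite !pk ?divr_gt0// /normal_fun.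
rewrite [LHS]mulrACA [RHS]mulrACA -!expRD; congr (_ * expR _)%R.
  by rewrite invf_div invr1; field; rewrite bn0 Sn0 /= sqrtr_eq0 -ltNge mulrn_wgt0// pi_gt0.
rewrite exprMn exprVn S2; field.
by rewrite bn0 gt_eqF.
Qed.

Lemma integral_gauss_conv (a b : R) (f : R -> \bar R) :
  measurable_fun setT f -> (forall x, 0 <= f x) ->
  \int[N01]_t \int[N01]_z f (a * t + b * z)%R =
  \int[N01]_z f (Num.sqrt (a ^+ 2 + b ^+ 2) * z)%R.
Proof.
wlog b0 : b / (0 <= b)%R.
  move=> H mf f0; have [b0|b0] := leP 0%R b; first exact: H.
  have := H (- b)%R; rewrite oppr_ge0 (ltW b0) sqrrN => /(_ isT mf f0) <-.
  apply: eq_integral => t _.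
  rewrite -integral_gaussN//; last first.
    apply: (measurableT_comp mf); exact: measurable_funD.
  by apply: eq_integral => z _; rewrite mulrN mulNr.
(* At [b = 0] the conditional law has no density, so this case is settled by symmetry alone. *)
move=> mf f0; move: b0; rewrite le_eqVlt => /orP[/eqP <-|b0].
  under eq_integral => t _.
    under eq_integral do rewrite mul0r addr0.
    rewrite integral_gauss_cst; over.
  rewrite expr0n addr0 sqrtr_sqr.
  have [a0|a0] := leP 0%R a; first by rewrite ger0_norm.
  rewrite -integral_gaussN//; last first.
    by apply: (measurableT_comp mf); exact: measurable_funM.
  by apply: eq_integral => z _; rewrite ltr0_norm// mulrNN.
set S := Num.sqrt _.
have ab0 : (0 < a ^+ 2 + b ^+ 2)%R by rewrite ltr_wpDl ?sqr_ge0// exprn_gt0.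
have S0 : (0 < S)%R by rewrite sqrtr_gt0.
transitivity (\int[N01]_t \int[mu]_u (f u * (normal_pdf (a * t) b u)%:E)).
  by apply: eq_integral => t _; rewrite integral_gauss_affine// integral_normal_prob_pdf.
have mpdf : measurable_fun [set: R * R] (fun tu => normal_pdf (a * tu.1) b tu.2).
  suff -> : (fun tu : R * R => normal_pdf (a * tu.1) b tu.2) =
      (fun tu : R * R => normal_pdf 0 1 ((tu.2 - a * tu.1) / b) / b)%R.
    apply: measurable_funM => //.
    apply: (measurableT_comp (measurable_normal_pdf 0 1)).
    apply: measurable_funM => //; apply: measurable_funB => //.
    exact: measurable_funM.
  by apply/funext => tu; rewrite normal_pdf_affine// [RHS]mulrC mulKf// gt_eqF.
pose g (tu : R * R) := f tu.2 * (normal_pdf (a * tu.1) b tu.2)%:E.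
have mg : measurable_fun setT g.
  apply: emeasurable_funM; last exact/measurable_EFinP.
  exact: measurableT_comp.
have g0 x : 0 <= g x by rewrite /g mule_ge0// lee_fin normal_pdf_ge0.
(* Once the integrals are exchanged, the conditional density of [t] given [u] integrates to 1 and
   only the law of [u] remains. *)
transitivity (\int[mu]_u \int[N01]_t g (t, u)).
  exact: (fubini_tonelli (m1 := N01) (m2 := mu) g).
transitivity (\int[mu]_u (f u * (normal_pdf 0 S u)%:E)); last first.
  rewrite -(integral_normal_prob_pdf 0 S mf f0) -(integral_gauss_affine 0 S0 mf f0).
  by apply: eq_integral => z _; rewrite add0r.
apply: eq_integral => u _; rewrite /g/=.
rewrite integral_normal_prob_pdf; last 2 first.
- exact: (measurableT_comp mg (pair2_measurable u)).
- by move=> t; rewrite mule_ge0// lee_fin normal_pdf_ge0.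
under eq_integral => t _ do rewrite -muleA -EFinM normal_pdf_conv// EFinM muleA.
rewrite ge0_integralZl//=; last 3 first.
- exact: measurable_normal_pdfE.
- by move=> x _; rewrite lee_fin normal_pdf_ge0.
- by rewrite mule_ge0// lee_fin normal_pdf_ge0.
by rewrite integral_normal_pdf mule1.
Qed.

End OneDimGauss.

(** * Iterated Gaussian integrals over finitely many coordinates *)

Section GaussIter.
Context {R : realType} (I : eqType).
Notation N01 := (normal_prob (0 : R) 1).
Local Open Scope ereal_scope.
Implicit Types (F G : (I -> R) -> \bar R) (e : I -> R) (s : seq I).

Definition upd e (k : I) (t : R) : I -> R := fun k' => if k' == k then t else e k'.

(* [I -> R] carries no sigma-algebra, so measurability is tested along measurable families. *)
Definition cyl_measurable F : Prop :=
  forall d (T : measurableType d) (e : T -> I -> R),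
    (forall k, measurable_fun [set: T] (e ^~ k)) ->
    measurable_fun [set: T] (F \o e).

Lemma gauss_iter_cons k s F e :
  gauss_iter (k :: s) F e = \int[N01]_t gauss_iter s F (upd e k t).
Proof. by []. Qed.

Lemma gauss_iter_ge0 s F e : (forall e, 0 <= F e) -> 0 <= gauss_iter s F e.
Proof.
move=> F0; elim: s e => [|k s IH] e; first exact: F0.
by rewrite gauss_iter_cons; apply: integral_ge0 => t _; exact: IH.
Qed.

Lemma cyl_measurable_gauss_iter s F : cyl_measurable F -> (forall e, 0 <= F e) ->
  cyl_measurable (gauss_iter s F).
Proof.
move=> mF F0; elim: s => [|k s IH] //= d T e me.
pose h (xt : T * R) := gauss_iter s F (upd (e xt.1) k xt.2).
have mh : measurable_fun setT h.
  apply: (IH _ _ (fun xt : T * R => upd (e xt.1) k xt.2)) => k'.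
  rewrite /upd; case: (k' == k); first exact: measurable_snd.
  exact: (measurableT_comp (me k') measurable_fst).
exact: (measurable_fun_fubini_tonelli_F (m2 := N01) h mh
  (fun x => gauss_iter_ge0 s _ F0)).
Qed.

Lemma measurable_gauss_iter_upd s F e k : cyl_measurable F -> (forall e, 0 <= F e) ->
  measurable_fun [set: R] (fun t => gauss_iter s F (upd e k t)).
Proof.
move=> mF F0; apply: (cyl_measurable_gauss_iter s mF F0 (e := upd e k)) => k'.
by rewrite /upd; case: (k' == k).
Qed.

Lemma le_gauss_iter s F G e : cyl_measurable F -> cyl_measurable G ->
  (forall e, 0 <= F e) -> (forall e, F e <= G e) ->
  gauss_iter s F e <= gauss_iter s G e.
Proof.
move=> mF mG F0 FG; have G0 e' : 0 <= G e' by exact: le_trans (F0 e') (FG e').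
elim: s e => [|k s IH] e; first exact: FG.
rewrite !gauss_iter_cons; apply: ge0_le_integral => //.
- by move=> t _; exact: gauss_iter_ge0.
- exact: measurable_gauss_iter_upd.
- exact: measurable_gauss_iter_upd.
Qed.

(** Serves to compare iterated integrals with different starting points: integrands are only
    evaluated where the coordinates in [s] are common and the others keep their initial values. *)
Lemma gauss_iter_cong s F G e e' :
  (forall a b, {in s, a =1 b} -> (forall k, k \notin s -> a k = e k) ->
     (forall k, k \notin s -> b k = e' k) -> F a = G b) ->
  gauss_iter s F e = gauss_iter s G e'.
Proof.
elim: s e e' => [|k s IH] e e' FG; first exact: FG.
rewrite !gauss_iter_cons; apply: eq_integral => t _; apply: IH => a b ab ae be.
have abk : a k = b k.
  have [ks|ks] := boolP (k \in s); first exact: ab.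
  by rewrite ae// be// /upd eqxx.
apply: FG.
- by move=> j; rewrite inE => /orP[/eqP ->|/ab].
- by move=> j; rewrite inE negb_or => /andP[jk js]; rewrite ae// /upd (negbTE jk).
- by move=> j; rewrite inE negb_or => /andP[jk js]; rewrite be// /upd (negbTE jk).
Qed.

Lemma eq_gauss_iter s F G e : F =1 G -> gauss_iter s F e = gauss_iter s G e.
Proof. by move=> /funext ->. Qed.

Lemma gauss_iter_cst s (x : \bar R) e : gauss_iter s (fun=> x) e = x.
Proof.
elim: s e => [|k s IH] e //; rewrite gauss_iter_cons.
by under eq_integral do rewrite IH; rewrite integral_gauss_cst.
Qed.

Lemma gauss_iterD s F G e : cyl_measurable F -> cyl_measurable G ->
  (forall e, 0 <= F e) -> (forall e, 0 <= G e) ->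
  gauss_iter s (F \+ G) e = gauss_iter s F e + gauss_iter s G e.
Proof.
move=> mF mG F0 G0; elim: s e => [|k s IH] e //.
rewrite !gauss_iter_cons -ge0_integralD//.
- by apply: eq_integral => t _; rewrite IH.
- by move=> t _; exact: gauss_iter_ge0.
- exact: measurable_gauss_iter_upd.
- by move=> t _; exact: gauss_iter_ge0.
- exact: measurable_gauss_iter_upd.
Qed.

Lemma gauss_iterZ s F (c : \bar R) e : cyl_measurable F -> (forall e, 0 <= F e) -> 0 <= c ->
  gauss_iter s (fun e => c * F e) e = c * gauss_iter s F e.
Proof.
move=> mF F0 c0; elim: s e => [|k s IH] e //.
rewrite !gauss_iter_cons -ge0_integralZl//.
- by apply: eq_integral => t _; rewrite IH.
- exact: measurable_gauss_iter_upd.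
- by move=> t _; exact: gauss_iter_ge0.
Qed.

Lemma cyl_measurable_sum (J : Type) (r : seq J) (P : pred J) (F : J -> (I -> R) -> \bar R) :
  (forall j, cyl_measurable (F j)) ->
  cyl_measurable (fun e => \sum_(j <- r | P j) F j e).
Proof.
move=> mF d T e me.
have -> : (fun e => \sum_(j <- r | P j) F j e) \o e =
    (fun x => \sum_(j <- r) if P j then F j (e x) else 0).
  by apply/funext => x /=; rewrite big_mkcond.
by apply: emeasurable_sum => j; case: (P j) => //; exact: mF.
Qed.

Lemma gauss_iter_sum (J : Type) (r : seq J) (P : pred J) (F : J -> (I -> R) -> \bar R) s e :
  (forall j, cyl_measurable (F j)) -> (forall j e, 0 <= F j e) ->
  gauss_iter s (fun e => \sum_(j <- r | P j) F j e) e =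
  \sum_(j <- r | P j) gauss_iter s (F j) e.
Proof.
move=> mF F0; elim: r => [|j r IH].
  by under eq_gauss_iter do rewrite big_nil; rewrite gauss_iter_cst big_nil.
rewrite big_cons -IH; case: ifPn => Pj.
  rewrite -gauss_iterD//.
  - by apply: eq_gauss_iter => e'; rewrite big_cons Pj.
  - exact: cyl_measurable_sum.
  - by move=> e'; apply: sume_ge0.
by apply: eq_gauss_iter => e'; rewrite big_cons (negbTE Pj).
Qed.

(** Cameron-Martin one coordinate at a time; shifts outside [s] stay in the argument so that the
    induction can go through. A repeated coordinate would be weighted twice although it is shifted
    once, hence [uniq s]. *)
Lemma gauss_iter_shift s F (h : I -> R) e : uniq s -> cyl_measurable F -> (forall e, 0 <= F e) ->
  gauss_iter s (fun e' => F (fun k => h k + e' k)%R) e =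
  gauss_iter s (fun e' => F (fun k => (if k \in s then 0 else h k) + e' k)%R *
    (expR (\sum_(k <- s) (h k * e' k - h k ^+ 2 / 2)))%:E) e.
Proof.
move=> + mF F0; elim: s e => [|k s IH] e.
  by move=> _ /=; rewrite big_nil expR0 mule1.
rewrite cons_uniq => /andP[ks us]; rewrite !gauss_iter_cons.
pose G e' := F (fun k' => (if k' \in k :: s then 0 else h k') + e' k')%R *
    (expR (\sum_(k <- s) (h k * e' k - h k ^+ 2 / 2)))%:E.
have mG : cyl_measurable G.
  move=> d T e' me'; apply: emeasurable_funM.
    apply: (mF _ _ (fun x k' => (if k' \in k :: s then 0 else h k') + e' x k')%R) => k'.
    exact: measurable_funD.
  apply/measurable_EFinP; apply: measurableT_comp => //.
  apply: measurable_sum => j; apply: measurable_funB => //.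
  exact: measurable_funM.
have G0 e' : 0 <= G e' by rewrite /G mule_ge0// lee_fin expR_ge0.
pose H u := gauss_iter s G (upd e k u).
transitivity (\int[N01]_t H (h k + t)%R).
  apply: eq_integral => t _; rewrite IH//; apply: gauss_iter_cong => a b ab ae be.
  rewrite /G; congr (_ * (expR _)%:E); last first.
    by rewrite big_seq [RHS]big_seq; apply: eq_bigr => j js; rewrite ab.
  congr F; apply/funext => j; rewrite inE.
  have [->|jk] /= := eqVneq j k.
    by rewrite (negbTE ks) ae// be// /upd eqxx add0r.
  have [js|js] := boolP (j \in s); first by rewrite ab.
  by rewrite ae// be// /upd (negbTE jk).
rewrite integral_gaussD; last 2 first.
- exact: measurable_gauss_iter_upd.
- by move=> x; exact: gauss_iter_ge0.
- apply: eq_integral => t _; rewrite /H muleC -(gauss_iterZ _ _ mG G0) ?lee_fin ?expR_ge0//.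
  apply: gauss_iter_cong => a b ab ae be.
  have -> : b = a.
    apply/funext => j; have [js|js] := boolP (j \in s); first by rewrite ab.
    by rewrite ae// be.
  by rewrite /G muleCA big_cons ae// {1}/upd eqxx -EFinM -expRD.
Qed.

End GaussIter.

(** * Linear contrasts of independent rows *)

Section GaussProd.
Context {R : realType}.
Notation N01 := (normal_prob (0 : R) 1).
Local Open Scope ereal_scope.

Lemma prode_ge0 (J : Type) (r : seq J) (P : pred J) (f : J -> \bar R) :
  (forall j, 0 <= f j) -> 0 <= \prod_(j <- r | P j) f j.
Proof. by move=> f0; elim/big_ind : _ => // x y; exact: mule_ge0. Qed.

Lemma lee_prode (J : Type) (r : seq J) (P : pred J) (f g : J -> \bar R) :
  (forall j, 0 <= f j) -> (forall j, f j <= g j) ->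
  \prod_(j <- r | P j) f j <= \prod_(j <- r | P j) g j.
Proof.
move=> f0 fg.
suff : 0 <= \prod_(j <- r | P j) f j <= \prod_(j <- r | P j) g j by case/andP.
elim/big_ind2 : _ => [|x1 x2 y1 y2 /andP[x0 xx] /andP[y0 yy]|j _].
- by rewrite lexx lee01.
- by rewrite mule_ge0// lee_pmul.
- by rewrite f0 fg.
Qed.

Context (J K : finType) (c : K -> R) (h : J -> R -> \bar R).
Hypothesis mh : forall j, measurable_fun setT (h j).
Hypothesis h0 : forall j x, 0 <= h j x.

Let var (s : seq (J * K)) j : R := (\sum_(k | (j, k) \in s) c k ^+ 2)%R.
Let mean (s : seq (J * K)) (e : J * K -> R) j : R :=
  (\sum_(k | (j, k) \notin s) c k * e (j, k))%R.

Lemma gauss_iter_rows (s : seq (J * K)) e : uniq s ->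
  gauss_iter s (fun e' => \prod_j h j (\sum_k c k * e' (j, k))%R) e =
  \prod_j \int[N01]_z h j (mean s e j + Num.sqrt (var s j) * z)%R.
Proof.
elim: s e => [|[j0 k0] s IH] e.
  move=> _ /=; apply: eq_bigr => j _.
  have -> : var [::] j = 0%R by rewrite /var big_pred0.
  rewrite sqrtr0 -[LHS]integral_gauss_cst.
  by apply: eq_integral => z _; rewrite mul0r addr0.
rewrite cons_uniq => /andP[ks us]; rewrite gauss_iter_cons.
under eq_integral do rewrite IH//.
have mean0 t : mean s (upd e (j0, k0) t) j0 = (mean ((j0, k0) :: s) e j0 + c k0 * t)%R.
  rewrite /mean (bigD1 k0)//= addrC; congr (_ + _)%R; last by rewrite /upd eqxx.
  apply: eq_big => [k|k /andP[_ kk0]].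
    by rewrite inE negb_or xpair_eqE eqxx /= andbC.
  by rewrite /upd xpair_eqE eqxx /= (negbTE kk0).
have var0 : var ((j0, k0) :: s) j0 = (c k0 ^+ 2 + var s j0)%R.
  rewrite /var (bigD1 k0)/= ?mem_head//; congr (_ + _)%R; apply: eq_bigl => k.
  rewrite inE xpair_eqE eqxx /=; have [->|] := eqVneq k k0; last by rewrite andbT.
  by rewrite (negbTE ks) andbF.
have meanj t j : j != j0 -> mean s (upd e (j0, k0) t) j = mean ((j0, k0) :: s) e j.
  move=> jj0; apply: eq_big => [k|k _].
    by rewrite inE xpair_eqE (negbTE jj0).
  by rewrite /upd xpair_eqE (negbTE jj0).
have varj j : j != j0 -> var ((j0, k0) :: s) j = var s j.
  by move=> jj0; apply: eq_bigl => k; rewrite inE xpair_eqE (negbTE jj0).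
rewrite [RHS](bigD1 j0)//=.
have m1 (a b : R) j : measurable_fun setT (fun z => h j (a + b * z)%R).
  apply: (measurableT_comp (mh j)); exact: measurable_funD.
transitivity (\int[N01]_t ((\int[N01]_z h j0 (mean ((j0, k0) :: s) e j0 + (c k0 * t + Num.sqrt (var s j0) * z))%R) *
   \prod_(j | j != j0) \int[N01]_z h j (mean ((j0, k0) :: s) e j + Num.sqrt (var ((j0, k0) :: s) j) * z)%R)).
  apply: eq_integral => t _.
  rewrite [LHS](bigD1 j0).
  2: by [].
  rewrite [X in _ * X = _]/=.
  rewrite (_ : \int[N01]_z h j0 (mean s (upd e (j0, k0) t) j0 + Num.sqrt (var s j0) * z)%R =
     \int[N01]_z h j0 (mean ((j0, k0) :: s) e j0 + (c k0 * t + Num.sqrt (var s j0) * z))%R); last first.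
    by apply: eq_integral => z _; rewrite mean0 addrA.
  congr (_ * _).
  apply: eq_bigr => j jj0; apply: eq_integral => z _; by rewrite meanj// varj.
rewrite ge0_integralZr//; last 3 first.
- apply: (measurable_fun_fubini_tonelli_F (m2 := N01)
    (fun tz : R * R => h j0 (mean ((j0, k0) :: s) e j0 + (c k0 * tz.1 + Num.sqrt (var s j0) * tz.2))%R)) => //.
  apply: (measurableT_comp (mh j0)); apply: measurable_funD => //.
  by apply: measurable_funD => //; apply: measurable_funM.
- by move=> t _; apply: integral_ge0.
- by apply: prode_ge0 => j; apply: integral_ge0.
congr (_ * _).
have v0 : (0 <= var s j0)%R by apply: sumr_ge0 => k _; rewrite sqr_ge0.
pose f u := h j0 (mean ((j0, k0) :: s) e j0 + u)%R.
have := @integral_gauss_conv R (c k0) (Num.sqrt (var s j0)) f.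
rewrite sqr_sqrtr// -var0; apply => [|u]; last exact: h0.
by apply: (measurableT_comp (mh j0)); exact: measurable_funD.
Qed.

End GaussProd.

(** * Expectations over the observation matrix *)

Section GaussExpect.
Context {R : realType} (p n : nat).
Notation N01 := (normal_prob (0 : R) 1).
Notation obs := (obs R p n).
Implicit Types (f g : obs -> R) (theta v : 'M[R]_(p, n)).
Local Open Scope ereal_scope.

Definition mx_of_obs (x : obs) : 'M[R]_(p, n) := \matrix_(j, i) tnth (tnth x j) i.

(** Frobenius inner product, summed over pairs to match the coordinates integrated by
    [gauss_expect]. *)
Definition mxdot (A B : 'M[R]_(p, n)) : R := (\sum_(k : 'I_p * 'I_n) A k.1 k.2 * B k.1 k.2)%R.

Lemma mx_of_obsK (M : 'M[R]_(p, n)) : mx_of_obs (obs_of_mx M) = M.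
Proof. by apply/matrixP => j i; rewrite mxE !tnth_mktuple. Qed.

Lemma measurable_entry j i : measurable_fun [set: obs] (fun x => mx_of_obs x j i).
Proof.
rewrite (_ : (fun _ => _) = (fun y => tnth y i) \o (fun x : obs => tnth x j)); last first.
  by apply/funext => x; rewrite mxE.
apply: measurableT_comp; first exact: measurable_tnth.
exact: measurable_tnth.
Qed.

Lemma cyl_measurable_obs theta f : measurable_fun setT f ->
  cyl_measurable (fun e => (f (obs_of_mx (theta + \matrix_(j, i) e (j, i))))%:E).
Proof.
move=> mf d T e me; apply/measurable_EFinP; apply: (measurableT_comp mf).
apply/measurable_fun_tnthP => j; apply/measurable_fun_tnthP => i.
rewrite (_ : _ \o _ = (fun x => theta j i + e x (j, i))%R); last first.
  by apply/funext => x /=; rewrite !tnth_mktuple !mxE.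
exact: measurable_funD.
Qed.

Lemma gauss_expect_ge0 theta f : (forall x, 0 <= f x)%R -> 0 <= gauss_expect theta f.
Proof. by move=> f0; apply: gauss_iter_ge0 => e; rewrite lee_fin. Qed.

Lemma le_gauss_expect theta f g : measurable_fun setT f -> measurable_fun setT g ->
  (forall x, 0 <= f x)%R -> (forall x, f x <= g x)%R ->
  gauss_expect theta f <= gauss_expect theta g.
Proof.
move=> mf mg f0 fg; apply: le_gauss_iter.
- exact: cyl_measurable_obs.
- exact: cyl_measurable_obs.
- by move=> e; rewrite lee_fin.
- by move=> e; rewrite lee_fin.
Qed.

Lemma gauss_expect_cst theta (a : R) : gauss_expect theta (fun=> a) = a%:E.
Proof. exact: gauss_iter_cst. Qed.

Lemma gauss_expectD theta f g : measurable_fun setT f -> measurable_fun setT g ->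
  (forall x, 0 <= f x)%R -> (forall x, 0 <= g x)%R ->
  gauss_expect theta (fun x => f x + g x)%R = gauss_expect theta f + gauss_expect theta g.
Proof.
move=> mf mg f0 g0; rewrite /gauss_expect -gauss_iterD.
- by [].
- exact: cyl_measurable_obs.
- exact: cyl_measurable_obs.
- by move=> e; rewrite lee_fin.
- by move=> e; rewrite lee_fin.
Qed.

Lemma gauss_expectZ theta f (a : R) : measurable_fun setT f -> (forall x, 0 <= f x)%R ->
  (0 <= a)%R ->
  gauss_expect theta (fun x => a * f x)%R = a%:E * gauss_expect theta f.
Proof.
move=> mf f0 a0; rewrite /gauss_expect -gauss_iterZ ?lee_fin//.
- exact: cyl_measurable_obs.
- by move=> e; rewrite lee_fin.
Qed.

Lemma gauss_expect_sum theta (J : Type) (r : seq J) (P : pred J) (f : J -> obs -> R) :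
  (forall j, measurable_fun setT (f j)) -> (forall j x, 0 <= f j x)%R ->
  gauss_expect theta (fun x => \sum_(j <- r | P j) f j x)%R =
  \sum_(j <- r | P j) gauss_expect theta (f j).
Proof.
move=> mf f0; rewrite /gauss_expect -gauss_iter_sum.
- by apply: eq_gauss_iter => e; rewrite sumEFin.
- by move=> j; exact: cyl_measurable_obs.
- by move=> j e; rewrite lee_fin.
Qed.

(** Density of the law of the observation with mean [theta] with respect to the law with mean 0. *)
Definition lratio theta (x : obs) : R :=
  expR (mxdot theta (mx_of_obs x) - mxdot theta theta / 2).

Lemma measurable_mxdot v : measurable_fun setT (fun x : obs => mxdot v (mx_of_obs x)).
Proof.
apply: measurable_sum => k; apply: measurable_funM => //; exact: measurable_entry.
Qed.

Lemma measurable_expR_mxdot v : measurable_fun setT (fun x : obs => expR (mxdot v (mx_of_obs x))).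
Proof. by apply: measurableT_comp => //; exact: measurable_mxdot. Qed.

Lemma measurable_lratio v : measurable_fun setT (lratio v).
Proof.
by apply: measurableT_comp => //; apply: measurable_funB => //; exact: measurable_mxdot.
Qed.

Lemma gauss_expect_lratio theta f : measurable_fun setT f -> (forall x, 0 <= f x)%R ->
  gauss_expect theta f = gauss_expect 0 (fun x => f x * lratio theta x)%R.
Proof.
move=> mf f0; rewrite /gauss_expect.
pose F e := (f (obs_of_mx (\matrix_(j, i) e (j, i))))%:E.
pose h (k : 'I_p * 'I_n) := theta k.1 k.2.
have mF : cyl_measurable F.
  have := cyl_measurable_obs 0 mf; congr cyl_measurable.
  by apply/funext => e; rewrite add0r.
transitivity (gauss_iter (enum {: 'I_p * 'I_n}) (fun e => F (fun k => h k + e k)%R) (fun=> 0%R)).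
  apply: eq_gauss_iter => e; rewrite /F; congr (f (obs_of_mx _))%:E.
  by apply/matrixP => j i; rewrite !mxE.
rewrite gauss_iter_shift ?enum_uniq//; last by move=> e; rewrite lee_fin.
apply: eq_gauss_iter => e; rewrite /F EFinM add0r; congr ((f (obs_of_mx _))%:E * (expR _)%:E).
  by apply/matrixP => j i; rewrite !mxE mem_enum add0r.
rewrite big_enum /= /mxdot mx_of_obsK mulr_suml -sumrB; apply: eq_bigr => -[j i] _ /=.
by rewrite mxE expr2.
Qed.

Lemma mxdotDl A B C : mxdot (A + B) C = (mxdot A C + mxdot B C)%R.
Proof.
by rewrite /mxdot -big_split; apply: eq_bigr => k _; rewrite mxE mulrDl.
Qed.

Lemma mxdotZl a A B : mxdot (a *: A) B = (a * mxdot A B)%R.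
Proof. by rewrite /mxdot mulr_sumr; apply: eq_bigr => k _; rewrite mxE mulrA. Qed.

Lemma mxdotC A B : mxdot A B = mxdot B A.
Proof. by apply: eq_bigr => k _; rewrite mulrC. Qed.

(** Rearranges the fact that the likelihood ratio has total mass 1. *)
Lemma gauss_expect_mgf v :
  gauss_expect 0 (fun x => expR (mxdot v (mx_of_obs x))) = (expR (mxdot v v / 2))%:E.
Proof.
have := @gauss_expect_lratio v (fun=> 1%R) (measurable_cst _) (fun=> ler01).
rewrite gauss_expect_cst => /(congr1 (fun y => (expR (mxdot v v / 2))%:E * y)).
rewrite mule1 => ->; rewrite -gauss_expectZ ?expR_ge0//.
- congr gauss_expect; apply/funext => x; rewrite mul1r /lratio -expRD; congr expR; ring.
- by apply: measurable_funM => //; exact: measurable_lratio.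
- by move=> x; rewrite mul1r expR_ge0.
Qed.

(** The unit norm of [c] makes every projected row a standard Gaussian around its projected mean. *)
Lemma gauss_expect_rows theta (c : 'I_n -> R) (h : 'I_p -> R -> R) :
  (\sum_i c i ^+ 2 = 1)%R ->
  (forall j, measurable_fun setT (h j)) -> (forall j x, 0 <= h j x)%R ->
  gauss_expect theta (fun x => \prod_j h j (\sum_i c i * mx_of_obs x j i))%R =
  \prod_j \int[N01]_z (h j (\sum_i c i * theta j i + z)%R)%:E.
Proof.
move=> c1 mh h0; rewrite /gauss_expect.
pose h' j u := (h j (\sum_i c i * theta j i + u)%R)%:E.
transitivity (gauss_iter (enum {: 'I_p * 'I_n})
   (fun e => \prod_j h' j (\sum_i c i * e (j, i))%R) (fun=> 0%R)).
  apply: eq_gauss_iter => e; rewrite -prodEFin; apply: eq_bigr => j _.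
  rewrite /h' mx_of_obsK -big_split; congr (h j _)%:E; apply: eq_bigr => i _.
  by rewrite !mxE mulrDr.
have mh' j : measurable_fun setT (h' j).
  by apply/measurable_EFinP; apply: (measurableT_comp (mh j)); exact: measurable_funD.
have h'0 j x : 0 <= h' j x by rewrite lee_fin.
rewrite (gauss_iter_rows c mh' h'0) ?enum_uniq//.
apply: eq_bigr => j _; apply: eq_integral => z _.
rewrite big_pred0 => [|i]; last by rewrite mem_enum.
rewrite (_ : (\sum_(k < n | _) _ = 1)%R) ?sqrtr1 ?mul1r ?add0r//.
by rewrite -[RHS]c1; apply: eq_bigl => i; rewrite mem_enum.
Qed.

End GaussExpect.

(** * CUSUM contrasts *)

Section Cusum.
Context {R : realType}.
Implicit Types (n t : nat).

Definition cusum_scale n t : R := Num.sqrt ((t%:R * (n - t)%:R) / n%:R).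

(** The centred indicator of the times before the change, normalised to a unit vector when
    [0 < t < n]. *)
Definition cusum n t (i : nat) : R := ((i < t)%:R - t%:R / n%:R) / cusum_scale n t.

Lemma sum_ind_lt n t : (t <= n)%N -> \sum_(i < n) (i < t)%:R = t%:R :> R.
Proof.
move=> tn; rewrite -natr_sum; congr (_%:R).
rewrite -(big_mkord xpredT (fun i => (i < t) : nat)) (big_cat_nat (leq0n t) tn)/=.
rewrite big_nat [X in (_ + X)%N]big_nat [X in (_ + X)%N]big1 => [|i /andP[ti _]]; last by rewrite ltnNge ti.
rewrite addn0 (eq_bigr (fun=> 1%N)) => [|i /andP[_ ->]//].
by rewrite -big_nat sum_nat_const_nat muln1 subn0.
Qed.

Context (n : nat).

Lemma cusum_scale_gt0 t : (0 < t < n)%N -> 0 < cusum_scale n t.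
Proof.
move=> /andP[t0 tn]; rewrite sqrtr_gt0 divr_gt0 ?mulr_gt0 ?ltr0n ?subn_gt0//.
exact: leq_ltn_trans tn.
Qed.

Lemma cusum_sum t : (0 < t < n)%N -> \sum_(i < n) cusum n t i = 0.
Proof.
move=> /andP[t0 tn]; rewrite -mulr_suml sumrB sum_ind_lt 1?ltnW//.
rewrite sumr_const card_ord -[X in _ - X]mulr_natr divfK ?subrr ?mul0r//.
by rewrite pnatr_eq0 -lt0n; exact: leq_ltn_trans tn.
Qed.

Lemma cusum_gram t t' : (0 < t)%N -> (t <= t')%N -> (t' < n)%N ->
  \sum_(i < n) cusum n t i * cusum n t' i =
  (t%:R * (n - t')%:R / n%:R) / (cusum_scale n t * cusum_scale n t').
Proof.
move=> t0 tt' t'n.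
have n0 : n%:R != 0 :> R by rewrite pnatr_eq0 -lt0n; exact: leq_ltn_trans t'n.
have s0 : cusum_scale n t != 0.
  by rewrite gt_eqF// cusum_scale_gt0// t0 (leq_ltn_trans tt').
have s'0 : cusum_scale n t' != 0.
  by rewrite gt_eqF// cusum_scale_gt0// t'n (leq_trans t0).
transitivity (\sum_(i < n) ((i < t)%:R - t%:R / n%:R * (i < t')%:R - t'%:R / n%:R * (i < t)%:R
   + t%:R * t'%:R / n%:R ^+ 2) / (cusum_scale n t * cusum_scale n t')).
  apply: eq_bigr => i _; rewrite /cusum.
  have -> : (i < t)%:R = (i < t)%:R * (i < t')%:R :> R.
    case: ltnP => [it|_]; last by rewrite mul0r.
    by rewrite (leq_trans it tt') mul1r.
  case: ltnP => it; first (rewrite (leq_trans it tt')/=; field; by rewrite s0 s'0 n0).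
  by rewrite /=; field; rewrite s0 s'0 n0.
rewrite -mulr_suml; congr (_ / _).
rewrite big_split sumrB sumrB /= -!mulr_sumr !sum_ind_lt ?(ltnW t'n)//; last first.
  exact: leq_trans tt' (ltnW t'n).
by rewrite sumr_const card_ord -[_ *+ n]mulr_natr natrB 1?ltnW//; field.
Qed.

(** The squared correlation is the ratio of the odds t / (n - t). Well separated change points are
    therefore nearly orthogonal, and close log-odds nearly parallel. *)
Lemma cusum_gram_sq t t' : (0 < t)%N -> (t <= t')%N -> (t' < n)%N ->
  (\sum_(i < n) cusum n t i * cusum n t' i) ^+ 2 =
  (t%:R * (n - t')%:R) / (t'%:R * (n - t)%:R).
Proof.
move=> t0 tt' t'n; rewrite cusum_gram//.
rewrite expr_div_n [(_ * cusum_scale _ _) ^+ 2]exprMn !sqr_sqrtr ?divr_ge0 ?mulr_ge0//.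
have nz k : (0 < k)%N -> k%:R != 0 :> R by rewrite pnatr_eq0 -lt0n.
have := (nz _ t0, nz _ (leq_trans t0 tt'), nz n (leq_ltn_trans (leq0n _) t'n)).
have : (0 < n - t)%N by rewrite subn_gt0 (leq_ltn_trans tt').
have : (0 < n - t')%N by rewrite subn_gt0.
move=> /nz h1 /nz h2 [[h3 h4] h5]; field.
by rewrite h1 h2 h3 h4 h5.
Qed.

Lemma cusum_gram_ge0 t t' : (0 < t)%N -> (t <= t')%N -> (t' < n)%N ->
  0 <= \sum_(i < n) cusum n t i * cusum n t' i.
Proof.
by move=> t0 tt' t'n; rewrite cusum_gram// divr_ge0 ?mulr_ge0 ?sqrtr_ge0 ?divr_ge0.
Qed.

Lemma cusum_norm t : (0 < t < n)%N -> \sum_(i < n) cusum n t i ^+ 2 = 1.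
Proof.
move=> /andP[t0 tn]; transitivity (\sum_(i < n) cusum n t i * cusum n t i) => //.
have := cusum_gram_ge0 t0 (leqnn t) tn; have := cusum_gram_sq t0 (leqnn t) tn.
rewrite divff ?mulf_neq0 ?pnatr_eq0 -?lt0n ?subn_gt0//.
move=> /eqP; rewrite sqrf_eq1 => /orP[/eqP ->//|/eqP ->].
by rewrite oppr_ge0 ler10.
Qed.

(** The constant part is invisible to centred contrasts; the coefficient of [cusum] is, in absolute
    value, the quantity that the alternative bounds below by rho. *)
Lemma step_cusum t (m1 m2 : R) (i : nat) : (0 < t < n)%N ->
  (if (i < t)%N then m1 else m2) =
  (m2 + (m1 - m2) * (t%:R / n%:R)) + (m1 - m2) * cusum_scale n t * cusum n t i.
Proof.
move=> tn; have s0 : cusum_scale n t != 0 by rewrite gt_eqF ?cusum_scale_gt0.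
have n0 : n%:R != 0 :> R.
  by rewrite pnatr_eq0 -lt0n; case/andP: tn => _; exact: leq_ltn_trans.
by rewrite /cusum; case: ifP => _ /=; field; rewrite s0 n0.
Qed.

End Cusum.

(** * Mixtures and the lower bound *)

Section LowerGeneric.
Context {R : realType} (p n : nat).
Notation obs := (obs R p n).
Notation E0 := (@gauss_expect R p n 0).
Implicit Types (theta v : 'M[R]_(p, n)).

(** Young's inequality for x^g and 1 with exponents 1/g and 1/(1 - g); it trades a fractional power
    for an affine function, whose expectation is explicit. *)
Lemma powR_tangent (g x : R) : 0 < g <= 1 -> 0 <= x -> x `^ g <= 1 - g + g * x.
Proof.
move=> /andP[g0 g1]; rewrite le_eqVlt => /orP[/eqP <-|x0].
  by rewrite powR0 ?gt_eqF// mulr0 addr0 subr_ge0.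
have [->|gn1] := eqVneq g 1; first by rewrite powRr1 ?(ltW x0)//; lra.
have gn : g < 1 by rewrite lt_neqAle gn1.
have xg : (x `^ g) `^ g^-1 = x by rewrite -powRrM mulfV ?gt_eqF// powRr1// ltW.
have := @conjugate_powR R (x `^ g) 1 g^-1 (1 - g)^-1.
rewrite powR_ge0 ler01 !invr_gt0 g0 subr_gt0 gn !invrK xg powR1 mulr1.
by move=> /(_ isT isT isT isT (subrKC _ _)) H; apply: (le_trans H); lra.
Qed.

(** The fractions x / (x + y) and y / (x + y) add up to 1, and each is at most its own g-th
    power. *)
Lemma powR_subadd (g x y : R) : 0 < g <= 1 -> 0 <= x -> 0 <= y ->
  (x + y) `^ g <= x `^ g + y `^ g.
Proof.
move=> /andP[g0 g1] x0 y0.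
have [->|xn0] := eqVneq x 0; first by rewrite add0r ler_wpDl// powR_ge0.
have xp : 0 < x by rewrite lt_neqAle eq_sym xn0.
have s0 : 0 < x + y by rewrite ltr_wpDr.
have H z : 0 <= z -> z <= x + y -> z / (x + y) * (x + y) `^ g <= z `^ g.
  move=> z0 zs.
  have -> : z `^ g = (z / (x + y)) `^ g * (x + y) `^ g.
    have s0w := ltW s0; by rewrite -powRM ?divr_ge0// divfK ?gt_eqF.
  rewrite ler_wpM2r ?powR_ge0//.
  have [->|zn0] := eqVneq z 0; first by rewrite mul0r powR_ge0.
  have zp : 0 < z by rewrite lt_neqAle eq_sym zn0.
  apply: ger1_powR => //.
  by rewrite divr_gt0//= ler_pdivrMr// mul1r.
have -> : (x + y) `^ g = x / (x + y) * (x + y) `^ g + y / (x + y) * (x + y) `^ g.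
  by rewrite -mulrDl -mulrDl divff ?gt_eqF// mul1r.
by apply: lerD; apply: H => //; [rewrite lerDl|rewrite lerDr].
Qed.

Lemma measurable_powRE (f : obs -> R) (g : R) : measurable_fun setT f ->
  measurable_fun setT (fun x => f x `^ g).
Proof. by move=> mf; apply: (measurableT_comp (measurable_powR g) mf). Qed.

Lemma big_option1 (A : finType) (F : option A -> R) :
  \sum_z F z = F None + \sum_a F (Some a).
Proof.
rewrite (bigD1 None)//=; congr (_ + _).
rewrite (reindex_omap Some id) /=; last by case.
by apply: eq_bigl => a; rewrite eqxx.
Qed.

Lemma gauss_expect_lratio1 theta : E0 (lratio theta) = 1%E.
Proof.
rewrite -(gauss_expect_cst theta 1) (@gauss_expect_lratio R p n theta (fun=> 1)) //.
by congr gauss_expect; apply/funext => x; rewrite mul1r.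
Qed.

Lemma mxdotDr (A B C : 'M[R]_(p, n)) : mxdot C (A + B) = mxdot C A + mxdot C B.
Proof. by rewrite mxdotC mxdotDl !(mxdotC _ C). Qed.

Lemma mxdotZr a (A B : 'M[R]_(p, n)) : mxdot A (a *: B) = a * mxdot A B.
Proof. by rewrite mxdotC mxdotZl mxdotC. Qed.

Lemma mxdot_suml (J : Type) (r : seq J) (P : pred J) (A : J -> 'M[R]_(p, n)) B :
  mxdot (\sum_(j <- r | P j) A j) B = \sum_(j <- r | P j) mxdot (A j) B.
Proof.
elim/big_rec2 : _ => [|j x y _ <-]; last by rewrite mxdotDl.
by rewrite /mxdot big1// => k _; rewrite mxE mul0r.
Qed.

Lemma gauss_expect_lratio2 theta theta' :
  E0 (fun x => lratio theta x * lratio theta' x) = (expR (mxdot theta theta'))%:E.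
Proof.
have -> : (fun x => lratio theta x * lratio theta' x) =
    (fun x => expR (- (mxdot theta theta + mxdot theta' theta') / 2) *
      expR (mxdot (theta + theta') (mx_of_obs x))).
  by apply/funext => x; rewrite /lratio -!expRD mxdotDl; congr expR; field.
rewrite gauss_expectZ ?expR_ge0//; last exact: measurable_expR_mxdot.
rewrite gauss_expect_mgf -EFinM -expRD; congr (expR _)%:E.
by rewrite mxdotDl !mxdotDr (mxdotC theta' theta); field.
Qed.

(** Orthogonality of the blocks plays the part of independence: after expanding over choice
    functions, the squared norm of each total direction splits into blocks, and the expansion is
    folded back. *)
Lemma gauss_expect_prod_mgf (B Z : finType) (c : B -> Z -> R) (v : B -> Z -> 'M[R]_(p, n)) :
  (forall b z, 0 <= c b z) ->
  (forall b b' z z', b != b' -> mxdot (v b z) (v b' z') = 0) ->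
  E0 (fun x => \prod_b \sum_z c b z * expR (mxdot (v b z) (mx_of_obs x))) =
  (\prod_b \sum_z c b z * expR (mxdot (v b z) (v b z) / 2))%:E.
Proof.
move=> c0 vo.
have -> : (fun x => \prod_b \sum_z c b z * expR (mxdot (v b z) (mx_of_obs x))) =
   (fun x => \sum_(zt : {ffun B -> Z}) (\prod_b c b (zt b)) * expR (mxdot (\sum_b v b (zt b)) (mx_of_obs x))).
  apply/funext => x; rewrite bigA_distr_bigA; apply: eq_bigr => zt _.
  by rewrite big_split /= mxdot_suml expR_sum.
rewrite gauss_expect_sum; last 2 first.
- by move=> zt; apply: measurable_funM => //; exact: measurable_expR_mxdot.
- by move=> zt x; rewrite mulr_ge0 ?expR_ge0// prodr_ge0.
rewrite bigA_distr_bigA -sumEFin; apply: eq_bigr => zt _.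
rewrite gauss_expectZ ?prodr_ge0//; last exact: measurable_expR_mxdot.
rewrite gauss_expect_mgf -EFinM big_split /= -expR_sum; congr ((_ * expR _)%:E).
rewrite mxdot_suml mulr_suml; apply: eq_bigr => b _; congr (_ / _).
rewrite mxdotC mxdot_suml (bigD1 b)//= big1 ?addr0// => b' bb'.
by rewrite vo.
Qed.

(** * Moments of the mixture at a single change point *)

Section OneScale.
Context (B A : finType) (D : B -> A -> 'M[R]_(p, n)) (tau : R).
Hypothesis A0 : (0 < #|A|)%N.
Hypothesis Do : forall b b' a a', b != b' -> mxdot (D b a) (D b' a') = 0.
Hypothesis Dtau : forall b a, mxdot (D b a) (D b a) = tau.

Definition block_sum (f : {ffun B -> A}) : 'M[R]_(p, n) := \sum_b D b (f b).

Definition mixture (x : obs) : R :=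
  (#|{ffun B -> A}|%:R)^-1 * \sum_f lratio (block_sum f) x.

Lemma mxdot_block_sum f f' :
  mxdot (block_sum f) (block_sum f') = \sum_b mxdot (D b (f b)) (D b (f' b)).
Proof.
rewrite mxdot_suml; apply: eq_bigr => b _.
by rewrite mxdotC mxdot_suml (bigD1 b)//= mxdotC big1 ?addr0// => b' bb'; rewrite Do.
Qed.

Lemma lratio_block_sum f x : lratio (block_sum f) x = \prod_b lratio (D b (f b)) x.
Proof.
rewrite /lratio -expR_sum mxdot_block_sum mxdot_suml mulr_suml -sumrB.
by congr expR.
Qed.

Lemma mixtureE x : mixture x = \prod_b ((#|A|%:R)^-1 * \sum_a lratio (D b a) x).
Proof.
rewrite big_split /= bigA_distr_bigA /mixture; congr (_ * _); last first.
  by apply: eq_bigr => f _; rewrite lratio_block_sum.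
by rewrite card_ffun natrX prodr_const exprVn.
Qed.

Lemma mixture_ge0 x : 0 <= mixture x.
Proof. by rewrite mulr_ge0 ?invr_ge0// sumr_ge0// => f _; rewrite expR_ge0. Qed.

Lemma measurable_mixture : measurable_fun setT mixture.
Proof.
apply: measurable_funM => //; apply: measurable_sum => f; exact: measurable_lratio.
Qed.

Lemma mixture_second_moment f :
  E0 (fun x => lratio (block_sum f) x * mixture x) =
  (\prod_b ((#|A|%:R)^-1 * \sum_a expR (mxdot (D b (f b)) (D b a))))%:E.
Proof.
have -> : (fun x => lratio (block_sum f) x * mixture x) =
    (fun x => (#|{ffun B -> A}|%:R)^-1 * \sum_f' lratio (block_sum f) x * lratio (block_sum f') x).
  by apply/funext => x; rewrite mulrCA mulr_sumr.
have mf f' : measurable_fun setT (fun x => lratio (block_sum f) x * lratio (block_sum f') x).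
  by apply: measurable_funM; exact: measurable_lratio.
rewrite gauss_expectZ ?invr_ge0//; last 2 first.
- exact: measurable_sum.
- by move=> x; rewrite sumr_ge0// => f' _; rewrite mulr_ge0 ?expR_ge0.
rewrite gauss_expect_sum//; last by move=> f' x; rewrite mulr_ge0 ?expR_ge0.
rewrite (eq_bigr _ (fun f1 _ => gauss_expect_lratio2 (block_sum f) (block_sum f1))).
rewrite sumEFin -EFinM; congr EFin.
rewrite big_split /= bigA_distr_bigA prodr_const exprVn -natrX -card_ffun; congr (_ * _).
by apply: eq_bigr => f' _; rewrite -expR_sum mxdot_block_sum.
Qed.

(** The factor [lratio (block_sum f)] puts the expectation under the alternative [f]. In each block
    the mixture is l / N, from the true choice, plus a rest r, and its g-th power is at most N^(-g)
    l^g + 1 - g + g r. Under the alternative r has mean at most 1 thanks to nonpositive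
    correlations, so only a moment of the single ratio l is left besides 1. *)
Lemma mixture_moment f (g : R) : 0 < g <= 1 ->
  (forall b a a', a != a' -> mxdot (D b a) (D b a') <= 0) ->
  (E0 (fun x => lratio (block_sum f) x * mixture x `^ g)%R <=
   ((1 + #|A|%:R `^ (- g) * expR (g * (1 + g) * tau / 2)) ^+ #|B|)%:E)%E.
Proof.
move=> g01 Dneg; have /andP[g0 g1] := g01.
pose N : R := #|A|%:R.
have N0 : 0 < N by rewrite ltr0n.
have Ni : 0 <= N^-1 by rewrite invr_ge0 ltW.
(* Terms of the pointwise bound: [None] carries l^(1 + g), [Some None] carries l, [Some (Some a)]
   carries l times the ratio at [a]. The exponentials of tau are the normalisations of these ratios,
   and the weight vanishes at [f b], which [None] already covers. *)
pose c (b : B) (z : option (option A)) : R := match z with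
  | None => N `^ (- g) * expR (- (1 + g) * tau / 2)
  | Some None => (1 - g) * expR (- tau / 2)
  | Some (Some a) => if a == f b then 0 else g / N * expR (- tau) end.
pose v (b : B) (z : option (option A)) : 'M[R]_(p, n) := match z with
  | None => (1 + g) *: D b (f b)
  | Some None => D b (f b)
  | Some (Some a) => D b (f b) + D b a end.
have c0 b z : 0 <= c b z.
  have gB : 0 <= 1 - g by rewrite subr_ge0.
  case: z => [[a|]|] /=.
  - by case: ifP => // _; apply: mulr_ge0; [by apply: divr_ge0; exact: ltW|exact: expR_ge0].
  - by apply: mulr_ge0 => //; exact: expR_ge0.
  - by apply: mulr_ge0; [exact: powR_ge0|exact: expR_ge0].
have vo b b' z z' : b != b' -> mxdot (v b z) (v b' z') = 0.
  move=> bb'; case: z => [[a|]|]; case: z' => [[a'|]|];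
  by rewrite /v /= ?mxdotDl ?mxdotZl ?mxdotDr ?mxdotZr !(Do _ _ bb') ?mulr0 ?addr0 ?mulr0.
have sumZ (F : option (option A) -> R) :
    \sum_z F z = F None + (F (Some None) + \sum_a F (Some (Some a))).
  by rewrite big_option1; congr (_ + _); rewrite big_option1.
apply: (@le_trans _ _ (E0 (fun x => \prod_b \sum_z c b z * expR (mxdot (v b z) (mx_of_obs x))))).
  apply: le_gauss_expect.
  - apply: measurable_funM; first exact: measurable_lratio.
    by apply: measurable_powRE; exact: measurable_mixture.
  - apply: measurable_prod => b _; apply: measurable_sum => z.
    by apply: measurable_funM => //; exact: measurable_expR_mxdot.
  - by move=> x; rewrite mulr_ge0 ?expR_ge0 ?powR_ge0.
  move=> x; rewrite lratio_block_sum mixtureE.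
  have -> : (\prod_b (N^-1 * \sum_a lratio (D b a) x)) `^ g =
      \prod_b (N^-1 * \sum_a lratio (D b a) x) `^ g.
    have : 0 <= \prod_b (N^-1 * \sum_a lratio (D b a) x) /\
        (\prod_b (N^-1 * \sum_a lratio (D b a) x)) `^ g =
      \prod_b (N^-1 * \sum_a lratio (D b a) x) `^ g; last by case.
    elim/big_ind2 : _ => [|x1 x2 y1 y2 [x0 xx] [y0 yy]|b _].
    - by rewrite powR1.
    - by rewrite mulr_ge0// powRM// xx yy.
    - by rewrite mulr_ge0// sumr_ge0// => a _; rewrite expR_ge0.
  rewrite -big_split /=; apply: ler_prod => b _.
  apply/andP; split; first by apply: mulr_ge0; [exact: expR_ge0|exact: powR_ge0].
  rewrite (bigD1 (f b))//= mulrDr.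
  set r := N^-1 * \sum_(a | a != f b) lratio (D b a) x.
  have r0 : 0 <= r.
    by rewrite mulr_ge0// sumr_ge0// => a _; rewrite expR_ge0.
  set l := lratio (D b (f b)) x.
  have l0 : 0 < l by rewrite expR_gt0.
  apply: (@le_trans _ _ (l * (N `^ (- g) * l `^ g + (1 - g + g * r)))).
    apply: ler_wpM2l; first exact: ltW.
    apply: (le_trans (powR_subadd g01 _ r0)).
      by rewrite mulr_ge0// ltW.
    rewrite (powRM _ Ni (ltW l0)) -(powR_inv1 (ltW N0)) -powRrM mulN1r lerD2l.
    exact: powR_tangent.
  have lE : l = expR (mxdot (D b (f b)) (mx_of_obs x) - tau / 2) by rewrite /l /lratio Dtau.
  have e1 : c b None * expR (mxdot (v b None) (mx_of_obs x)) = l * (N `^ (- g) * l `^ g).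
    rewrite /= mulrCA -mulrA; congr (N `^ (- g) * _).
    by rewrite lE -expRM -!expRD mxdotZl; congr expR; field.
  have e2 : c b (Some None) * expR (mxdot (v b (Some None)) (mx_of_obs x)) = l * (1 - g).
    by rewrite /= lE [RHS]mulrC -mulrA -expRD; congr ((1 - g) * expR _); field.
  have e3 : \sum_a c b (Some (Some a)) * expR (mxdot (v b (Some (Some a))) (mx_of_obs x)) = l * (g * r).
    rewrite /r !mulrA mulr_sumr (bigD1 (f b))//= eqxx mul0r add0r; apply: eq_bigr => a af.
    transitivity (g / N * (l * lratio (D b a) x)); last by ring.
    rewrite (negbTE af) lE /lratio Dtau mxdotDl -[LHS]mulrA -!expRD.
    by congr (_ * expR _); field.
  by rewrite sumZ e1 e2 e3 -!mulrDr.
rewrite gauss_expect_prod_mgf// lee_fin.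
have -> : (1 + N `^ (- g) * expR (g * (1 + g) * tau / 2)) ^+ #|B| =
   \prod_(b : B) (1 + N `^ (- g) * expR (g * (1 + g) * tau / 2)) by rewrite prodr_const.
apply: ler_prod => b _; apply/andP; split.
  by rewrite sumr_ge0// => z _; rewrite mulr_ge0 ?expR_ge0.
rewrite sumZ [leLHS]addrC; apply: lerD; last first.
  rewrite /c /v mxdotZl mxdotZr Dtau -mulrA -expRD ler_wpM2l ?powR_ge0//.
  rewrite ler_expR le_eqVlt; apply/orP; left; apply/eqP; by field.
rewrite {1}/c {1}/v Dtau -mulrA -expRD mulNr addNr expR0 mulr1.
suff : \sum_a c b (Some (Some a)) * expR (mxdot (v b (Some (Some a))) (v b (Some (Some a))) / 2) <= g.
  by lra.
have -> : g = \sum_(a : A) g / N.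
  by rewrite sumr_const -[RHS]mulr_natr divfK ?gt_eqF.
apply: ler_sum => a _; rewrite /c /v; case: ifPn => [_|af].
  by rewrite mul0r divr_ge0// ltW.
rewrite -mulrA -expRD ler_piMr//; first by rewrite divr_ge0// ltW.
(* After cancellation of tau the exponent is the inner product of two distinct choices. *)
rewrite -[leRHS]expR0 ler_expR mxdotDl !mxdotDr !Dtau (mxdotC (D b a)).
have : mxdot (D b (f b)) (D b a) <= 0 by apply: Dneg; rewrite eq_sym.
lra.
Qed.

End OneScale.
End LowerGeneric.

(** * From a moment of the likelihood ratio to the testing risk *)

Section RiskLower.
Context {R : realType} (p n : nat).
Notation obs := (obs R p n).
Notation E0 := (@gauss_expect R p n 0).

Lemma measurable_test (psi : obs -> bool) : is_test psi ->
  measurable_fun setT (fun x => (psi x)%:R : R).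
Proof.
move=> mpsi; apply: (measurableT_comp (f := fun b : bool => b%:R : R)) => //.
Qed.

(** Pointwise, K^-1 L <= psi + (1 - psi) L + K^-1 K^(-g) L^(1 + g) for the averaged ratio L: the
    first two terms suffice when L <= K, the last one when L > K. Null expectations then compare E L
    = 1 with both errors and with the moment, an average of the bounds on [th t]. *)
Lemma risk_ge (s : nat) (rho : R) (T : finType) (th : T -> 'M[R]_(p, n)) (g Q K : R) :
  (0 < #|T|)%N -> (forall t, @Theta1_2side R p n rho s (th t)) ->
  0 < g -> 1 <= K ->
  (forall t, (E0 (fun x => lratio (th t) x *
     ((#|T|%:R)^-1 * \sum_t' lratio (th t') x) `^ g)%R <= Q%:E)%E) ->
  ((K^-1 - Q * K^-1 * K `^ (- g))%:E <= risk_2side p n rho s)%E.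
Proof.
move=> T0 thin g0 K1 HQ.
have Ni : 0 <= (#|T|%:R)^-1 :> R by rewrite invr_ge0.
have K0 : 0 < K by exact: lt_le_trans K1.
pose L x := (#|T|%:R)^-1 * \sum_t lratio (th t) x.
have L0 x : 0 <= L x by rewrite mulr_ge0// sumr_ge0// => t _; rewrite expR_ge0.
have mL : measurable_fun setT L.
  by apply: measurable_funM => //; apply: measurable_sum => t; exact: measurable_lratio.
have mLg : measurable_fun setT (fun x => L x * L x `^ g).
  by apply: measurable_funM => //; exact: measurable_powRE.
have Lg0 x : 0 <= L x * L x `^ g by rewrite mulr_ge0 ?powR_ge0.
have avg (f : obs -> R) : measurable_fun setT f -> (forall x, 0 <= f x) ->
    E0 (fun x => f x * L x) = ((#|T|%:R)^-1%:E * \sum_t E0 (fun x => (f x * lratio (th t) x)%R))%E.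
  move=> mf f0; rewrite -gauss_expect_sum; last 2 first.
  - by move=> t; apply: measurable_funM => //; exact: measurable_lratio.
  - by move=> t x; rewrite mulr_ge0 ?expR_ge0.
  rewrite -gauss_expectZ//.
  - by congr gauss_expect; apply/funext => x; rewrite /L mulrCA mulr_sumr.
  - apply: measurable_sum => t; apply: measurable_funM => //; exact: measurable_lratio.
  - by move=> x; rewrite sumr_ge0// => t _; rewrite mulr_ge0 ?expR_ge0.
have avg_le (F : T -> \bar R) (c : \bar R) : (forall t, (F t <= c)%E) -> (0 <= c)%E ->
    ((#|T|%:R)^-1%:E * \sum_t F t <= c)%E.
  case: c => [c| |]// Fc c0; last by rewrite leey.
  have H : (\sum_t F t <= (\sum_(t : T) c)%:E)%E by rewrite -sumEFin; exact: lee_sum.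
  apply: (le_trans (lee_wpmul2l _ H)) => //.
  by rewrite sumr_const -EFinM -[c *+ _]mulr_natl mulKf// pnatr_eq0 -lt0n.
apply: le_ereal_inf_tmp => _ [psi mpsi <-].
have mps := measurable_test mpsi.
set a0 := ereal_sup _; set a1 := ereal_sup _.
have ha0 : (E0 (fun x => (psi x)%:R) <= a0)%E.
  by apply: ereal_sup_ubound; exists 0 => // j i i'; rewrite !mxE.
have mps1 : measurable_fun setT (fun x => 1 - (psi x)%:R : R) by exact: measurable_funB.
have ps1 x : 0 <= 1 - (psi x)%:R :> R by case: (psi x); rewrite /= ?subrr ?subr0.
have psL x : 0 <= (1 - (psi x)%:R) * L x by exact: mulr_ge0.
have ha1 : (E0 (fun x => (1 - (psi x)%:R) * L x)%R <= a1)%E.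
  have ht t : (gauss_expect (th t) (fun x => 1 - (psi x)%:R)%R <= a1)%E.
    by apply: ereal_sup_ubound; exists (th t).
  rewrite avg//; apply: avg_le => [t|].
    by rewrite -gauss_expect_lratio.
  have /card_gt0P[t _] := T0.
  exact: le_trans (gauss_expect_ge0 _ ps1) (ht t).
have EL : E0 L = 1%E.
  have -> : L = (fun x => 1 * L x) by apply/funext => x; rewrite mul1r.
  rewrite avg//.
  under eq_bigr => t _.
    rewrite (_ : (fun x => _) = lratio (th t)); last by apply/funext => x; rewrite mul1r.
    rewrite gauss_expect_lratio1; over.
  rewrite sumEFin sumr_const -EFinM -[1 *+ _]mulr_natl mulr1 mulVf// pnatr_eq0 -lt0n//.
have ELg : (E0 (fun x => L x * L x `^ g)%R <= Q%:E)%E.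
  have -> : (fun x => L x * L x `^ g) = (fun x => L x `^ g * L x) by apply/funext => x; rewrite mulrC.
  rewrite avg//; [|exact: measurable_powRE|by move=> x; exact: powR_ge0].
  apply: avg_le => [t|]; last first.
    have /card_gt0P[t _] := T0; apply: le_trans (HQ t).
    by apply: gauss_expect_ge0 => x; rewrite mulr_ge0 ?expR_ge0 ?powR_ge0.
  rewrite (_ : (fun x => _) = (fun x => lratio (th t) x * L x `^ g)); first exact: HQ.
  by apply/funext => x; rewrite mulrC.
have Kg0 : 0 <= K^-1 * K `^ (- g) by rewrite mulr_ge0 ?powR_ge0// invr_ge0 ltW.
have key : (E0 (fun x => K^-1 * L x)%R <= E0 (fun x => (psi x)%:R + ((1 - (psi x)%:R) * L x +
    K^-1 * K `^ (- g) * (L x * L x `^ g)))%R)%E.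
  apply: le_gauss_expect.
  - exact: measurable_funM.
  - apply: measurable_funD => //; apply: measurable_funD; apply: measurable_funM => //.
  - by move=> x; rewrite mulr_ge0// invr_ge0 ltW.
  move=> x; have [LK|KL] := leP (L x) K.
    rewrite addrA; apply: ler_wpDr; first by rewrite mulr_ge0.
    case: (psi x) => /=; first by rewrite subrr mul0r addr0 mulrC ler_pdivrMr// mul1r.
    by rewrite subr0 mul1r add0r ler_piMl// invf_le1.
  rewrite addrA; apply: ler_wpDl; first by rewrite addr_ge0.
  rewrite -mulrA ler_wpM2l ?invr_ge0 ?(ltW K0)// mulrCA ler_peMr//.
  rewrite powRN mulrC ler_pdivlMr ?powR_gt0// mul1r.
  by apply: ge0_ler_powR; rewrite ?nnegrE ?(ltW g0) ?(ltW K0) ?(ltW KL).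
move: key; rewrite gauss_expectZ// ?invr_ge0 ?(ltW K0)// EL mule1.
rewrite gauss_expectD//; last 2 first.
- by apply: measurable_funD; apply: measurable_funM => //; exact: measurable_funM.
- by move=> x; rewrite addr_ge0// mulr_ge0.
rewrite gauss_expectD//; last 3 first.
- exact: measurable_funM.
- exact: measurable_funM.
- by move=> x; rewrite mulr_ge0.
rewrite gauss_expectZ// => key.
have key2 : (K^-1%:E <= a0 + (a1 + (K^-1 * K `^ (- g) * Q)%:E))%E.
  apply: (le_trans key); apply: leeD => //; apply: leeD => //.
  by rewrite [leRHS]EFinM; apply: lee_wpmul2l.
rewrite EFinB leeBlDr// -addeA.
by rewrite -[Q * _ * _]mulrA mulrC.
Qed.

End RiskLower.

(** * Mixing over nearly orthogonal change points *)

Section MultiScale.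
Context {R : realType} (p n : nat) (M : nat) (B A : finType).
Context (D : 'I_M -> B -> A -> 'M[R]_(p, n)).
Notation obs := (obs R p n).
Notation E0 := (@gauss_expect R p n 0).
Notation cfg := ({ffun B -> A}).
Let th (t : 'I_M * cfg) := block_sum (D t.1) t.2.

(** Only the scale of the truth needs a fractional moment. Subadditivity separates it with weight
    M^(-g), and the g-th power of the other scales is at most 1 + rest; the rest has expectation at
    most e, because cross inner products are at most 1. *)
Lemma multiscale_moment (g V : R) (t : 'I_M * cfg) : 0 < g <= 1 -> (0 < #|A|)%N ->
  (forall k f k' f', k != k' ->
     mxdot (block_sum (D k) f) (block_sum (D k') f') <= 1) ->
  (E0 (fun x => lratio (th t) x * mixture (D t.1) x `^ g)%R <= V%:E)%E ->
  (E0 (fun x => lratio (th t) x *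
     ((#|{: 'I_M * cfg}|%:R)^-1 * \sum_t' lratio (th t') x) `^ g)%R <=
   (M%:R `^ (- g) * V + (1 + expR 1))%:E)%E.
Proof.
case: t => k f /= g01 A0 cross HV; have /andP[g0 g1] := g01.
have M0 : 0 < M%:R :> R by rewrite ltr0n; exact: leq_ltn_trans (leq0n k) (ltn_ord k).
have Mi : 0 <= (M%:R)^-1 :> R by rewrite invr_ge0 ltW.
have cfg0 : 0 < #|{: cfg}|%:R :> R by rewrite ltr0n card_ffun expn_gt0 A0.
have Ci : 0 <= (#|{: cfg}|%:R)^-1 :> R by rewrite invr_ge0 ltW.
pose rest x := M%:R^-1 * (\sum_(k' | k' != k) mixture (D k') x).
have LE x : (#|{: 'I_M * cfg}|%:R)^-1 * \sum_t' lratio (th t') x =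
    M%:R^-1 * mixture (D k) x + rest x.
  rewrite card_prod card_ord natrM invfM -mulrA /rest -mulrDr; congr (_ * _).
  transitivity (\sum_k' mixture (D k') x); last by rewrite (bigD1 k).
  by rewrite mulr_sumr /mixture -(pair_bigA _ (fun k' f' => (#|{: cfg}|%:R)^-1 * lratio (th (k', f')) x)) /=;
    apply: eq_bigr => k' _; rewrite mulr_sumr.
have rest0 x : 0 <= rest x by rewrite mulr_ge0// sumr_ge0// => k' _; exact: mixture_ge0.
have mrest : measurable_fun setT rest.
  rewrite /rest; apply: measurable_funM => //.
  under eq_fun do rewrite big_mkcond; apply: measurable_sum => k'.
  by case: (k' != k) => //; exact: measurable_mixture.
have mmix : measurable_fun setT (mixture (D k)) by exact: measurable_mixture.
have mlr : measurable_fun setT (lratio (th (k, f))) by exact: measurable_lratio.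
have mmg : measurable_fun setT (fun x => mixture (D k) x `^ g) by exact: measurable_powRE.
pose F1 x := lratio (th (k, f)) x * mixture (D k) x `^ g.
have F10 x : 0 <= F1 x by rewrite mulr_ge0 ?expR_ge0 ?powR_ge0.
have mF1 : measurable_fun setT F1 by exact: measurable_funM.
pose F2 x := lratio (th (k, f)) x * rest x.
have F20 x : 0 <= F2 x by rewrite mulr_ge0 ?expR_ge0.
have mF2 : measurable_fun setT F2 by exact: measurable_funM.
have lr0 x : 0 <= lratio (th (k, f)) x by exact: expR_ge0.
have EF2 : (E0 F2 <= (expR 1)%:E)%E.
  have -> : F2 = (fun x => (M%:R^-1 * (#|{: cfg}|%:R)^-1) *
       \sum_(k' | k' != k) \sum_f' lratio (th (k, f)) x * lratio (th (k', f')) x).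
    apply/funext => x; rewrite /F2 /rest mulrCA -[RHS]mulrA; congr (_ * _).
    rewrite !mulr_sumr; apply: eq_bigr => k' _.
    by rewrite /mixture mulrCA mulr_sumr.
  have mll k' f' : measurable_fun setT (fun x => lratio (th (k, f)) x * lratio (th (k', f')) x).
    by apply: measurable_funM => //; exact: measurable_lratio.
  have ll0 k' f' x : 0 <= lratio (th (k, f)) x * lratio (th (k', f')) x.
    by rewrite mulr_ge0 ?expR_ge0.
  have mS k' : measurable_fun setT (fun x => \sum_f' lratio (th (k, f)) x * lratio (th (k', f')) x).
    exact: measurable_sum.
  have S0 k' x : 0 <= \sum_f' lratio (th (k, f)) x * lratio (th (k', f')) x.
    exact: sumr_ge0.
  rewrite gauss_expectZ ?mulr_ge0//; last 2 first.
  - under eq_fun do rewrite big_mkcond; apply: measurable_sum => k'.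
    by case: (k' != k).
  - by move=> x; exact: sumr_ge0.
  rewrite gauss_expect_sum//.
  have H : (\sum_(k' | k' != k) E0 (fun x => \sum_f' lratio (th (k, f)) x * lratio (th (k', f')) x)%R <=
      \sum_(k' < M) \sum_(f' : cfg) (expR 1)%:E)%E.
    rewrite big_mkcond; apply: lee_sum => k' _; case: ifPn => [kk'|_]; last first.
      by apply: sume_ge0 => f' _; rewrite lee_fin expR_ge0.
    rewrite gauss_expect_sum//; apply: lee_sum => f' _.
    rewrite gauss_expect_lratio2 lee_fin ler_expR; apply: cross.
    by rewrite eq_sym.
  have SE : (\sum_(k' < M) \sum_(f' : cfg) (expR 1)%:E)%E =
      (M%:R * (#|{: cfg}|%:R * expR 1))%:E :> \bar R.
    rewrite (eq_bigr (fun=> (#|{: cfg}|%:R * expR 1)%:E)) => [|k' _].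
      by rewrite sumEFin; congr EFin; rewrite sumr_const card_ord -[LHS]mulr_natl.
    by rewrite sumEFin; congr EFin; rewrite sumr_const -[LHS]mulr_natl.
  rewrite {}SE in H.
  apply: (le_trans (lee_wpmul2l _ H)); first by rewrite lee_fin mulr_ge0.
  rewrite -EFinM lee_fin le_eqVlt; apply/orP; left; apply/eqP.
  by rewrite mulrACA mulrA mulVf ?gt_eqF// mul1r mulrA mulVf ?gt_eqF// mul1r.
apply: (@le_trans _ _ (E0 (fun x => M%:R `^ (- g) * F1 x + (lratio (th (k, f)) x + F2 x)))).
  apply: le_gauss_expect.
  - apply: measurable_funM => //; apply: measurable_powRE.
    by under eq_fun do rewrite LE; apply: measurable_funD => //; apply: measurable_funM.
  - apply: measurable_funD; first exact: measurable_funM.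
    exact: measurable_funD.
  - by move=> x; rewrite mulr_ge0 ?expR_ge0 ?powR_ge0.
  move=> x; rewrite LE.
  have -> : M%:R `^ (- g) * F1 x + (lratio (th (k, f)) x + F2 x) =
    lratio (th (k, f)) x * (M%:R `^ (- g) * mixture (D k) x `^ g + (1 + rest x)).
    by rewrite /F1 /F2; ring.
  apply: ler_wpM2l => //.
  have mx0 : 0 <= mixture (D k) x by exact: mixture_ge0.
  apply: (le_trans (powR_subadd g01 _ (rest0 x))); first exact: mulr_ge0.
  rewrite powRM// -(powR_inv1 (ltW M0)) -powRrM mulN1r lerD2l.
  apply: (le_trans (powR_tangent g01 (rest0 x))).
  have : g * rest x <= rest x by rewrite ler_piMl.
  lra.
rewrite gauss_expectD; last 4 first.
- exact: measurable_funM.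
- exact: measurable_funD.
- by move=> x; rewrite mulr_ge0 ?powR_ge0.
- by move=> x; rewrite addr_ge0.
rewrite gauss_expectZ ?powR_ge0// gauss_expectD// gauss_expect_lratio1.
rewrite EFinD EFinD; apply: leeD; last exact: leeD.
by rewrite EFinM; apply: lee_wpmul2l => //; rewrite lee_fin powR_ge0.
Qed.

Lemma risk_ge_multiscale (s : nat) (rho g V : R) : 0 < g <= 1 -> (0 < #|A|)%N -> (0 < M)%N ->
  (forall t, @Theta1_2side R p n rho s (th t)) ->
  (forall k f k' f', k != k' ->
     mxdot (block_sum (D k) f) (block_sum (D k') f') <= 1) ->
  (forall t, (E0 (fun x => lratio (th t) x * mixture (D t.1) x `^ g)%R <= V%:E)%E) ->
  V <= M%:R `^ g ->
  ((12 `^ (- g^-1) / 2)%:E <= risk_2side p n rho s)%E.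
Proof.
move=> g01 A0 M0 thin cross HV VM; have /andP[g0 g1] := g01.
have T0 : (0 < #|{: 'I_M * cfg}|)%N.
  by rewrite card_prod card_ord card_ffun muln_gt0 M0 expn_gt0 A0.
(* The moment is at most 1 + (1 + e) <= 6, and this choice gives 6 K^(-g) = 1/2, so that half of
   K^-1 survives. *)
pose K : R := 12 `^ (g^-1).
have K1 : 1 <= K by rewrite -(powRr0 12) ler_powR ?invr_ge0 ?(ltW g0)//; lra.
have H := @risk_ge R p n s rho _ th g 6 K T0 thin g0 K1.
apply: le_trans (H _) => [|t].
  rewrite lee_fin powRN -/K powRN /K -powRrM mulVf ?gt_eqF// powRr1//.
  by rewrite -/K; lra.
apply: (le_trans (multiscale_moment g01 A0 cross (HV t))).
have e4 : expR 1 <= 4 :> R.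
  have h : expR (2^-1) <= 2 :> R.
    have := @expR_ge1Dx R (- 2^-1); rewrite expRN => e2.
    by rewrite -[leRHS]invrK -[leLHS]invrK lef_pV2 ?posrE ?invr_gt0 ?expR_gt0//; lra.
  have -> : 4 = 2 * 2 :> R by lra.
  rewrite [X in expR X](_ : 1 = 2^-1 + 2^-1 :> R); last by lra.
  rewrite expRD.
  by apply: ler_pM => //; exact: expR_ge0.
rewrite lee_fin.
have : M%:R `^ (- g) * V <= 1.
  by rewrite powRN mulrC ler_pdivrMr ?mul1r// powR_gt0// ltr0n.
lra.
Qed.

End MultiScale.

(** * Least favourable signals: one signed row per block *)

Section Signals.
Context {R : realType} (p n s m M : nat) (t : 'I_M -> nat) (rho : R).
Hypothesis t_bnd : forall k, (0 < t k < n)%N.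
Hypothesis smp : (s * m <= p)%N.
Hypothesis rho0 : 0 <= rho.

Lemma block_pos_subproof (b : 'I_s) (a : 'I_m) : (b * m + a < p)%N.
Proof.
apply: leq_trans smp; apply: (@leq_trans (b * m + m)%N).
  by rewrite ltn_add2l.
by rewrite -mulSnr leq_mul2r ltn_ord orbT.
Qed.

Definition block_pos b a : 'I_p := Ordinal (block_pos_subproof b a).

Lemma eq_block_pos b a b' a' : (block_pos b a == block_pos b' a') = (b == b') && (a == a').
Proof.
rewrite -val_eqE /=; apply/eqP/andP => [E|[/eqP -> /eqP ->]//].
have m0 : (0 < m)%N by exact: leq_ltn_trans (leq0n a) (ltn_ord a).
have := congr1 (divn^~ m) E; rewrite /= !divnMDl// !divn_small// !addn0 => bb'.
have := congr1 (modn^~ m) E; rewrite /= !modnMDl !modn_small// => aa'.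
by rewrite -!val_eqE /= bb' aa'.
Qed.

(* One signed active row in each of [s] disjoint blocks of [m] rows: the support has size
   exactly [s], and a uniform choice of [a] in each block makes the blocks independent. *)
Definition row_signal (k : 'I_M) (b : 'I_s) (a : 'I_m * bool) : 'M[R]_(p, n) :=
  \matrix_(j, i) ((j == block_pos b a.1)%:R * (-1) ^+ a.2 * (rho * cusum n (t k) i)).

Let gram k k' := \sum_(i < n) cusum n (t k) i * cusum n (t k') i : R.

Lemma mxdot_signal k k' b b' a a' :
  mxdot (row_signal k b a) (row_signal k' b' a') =
  ((b == b') && (a.1 == a'.1))%:R * (-1) ^+ (a.2 + a'.2) * rho ^+ 2 * gram k k'.
Proof.
rewrite /mxdot.
under eq_bigr do rewrite !mxE.
rewrite -(pair_bigA _ (fun (j : 'I_p) (i : 'I_n) => (j == block_pos b a.1)%:R * (-1) ^+ a.2 * (rho * cusum n (t k) i) *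
  ((j == block_pos b' a'.1)%:R * (-1) ^+ a'.2 * (rho * cusum n (t k') i)))) /=.
rewrite (bigD1 (block_pos b a.1)) //= [X in _ + X]big1 => [|j jp]; last first.
  by rewrite big1// => i _; rewrite (negbTE jp) !mul0r.
rewrite addr0 eqxx /gram mulr_sumr; apply: eq_bigr => i _.
rewrite eq_block_pos exprD (_ : true%:R = 1 :> R)//; ring.
Qed.

Lemma mxdot_signal_same k b a a' :
  mxdot (row_signal k b a) (row_signal k b a') =
  (a.1 == a'.1)%:R * (-1) ^+ (a.2 + a'.2) * rho ^+ 2.
Proof.
rewrite mxdot_signal eqxx /= (_ : gram k k = 1) ?mulr1// -(cusum_norm (t_bnd k)).
by apply: eq_bigr => i _; rewrite expr2.
Qed.

Lemma block_sum_signalE k f j i :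
  block_sum (row_signal k) f j i =
  (\sum_b (j == block_pos b (f b).1)%:R * (-1) ^+ (f b).2) * (rho * cusum n (t k) i).
Proof.
by rewrite /block_sum summxE mulr_suml; apply: eq_bigr => b _; rewrite mxE.
Qed.

Lemma block_sum_signal_alt k f : @Theta1_2side R p n rho s (block_sum (row_signal k) f).
Proof.
have /andP[t0 tn] := t_bnd k.
(* Coefficient of row [j]: a sign on the [s] selected rows and 0 elsewhere. *)
pose w j : R := \sum_b (j == block_pos b (f b).1)%:R * (-1) ^+ (f b).2.
have c0 := @cusum_scale_gt0 R n (t k) (t_bnd k).
exists (t k), (fun j => w j * rho * ((1 - (t k)%:R / n%:R) / cusum_scale n (t k))),
  (fun j => w j * rho * ((0 - (t k)%:R / n%:R) / cusum_scale n (t k))),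
  [set block_pos b (f b).1 | b : 'I_s].
split.
- by rewrite t0 -ltnS prednK// (leq_trans _ tn).
- rewrite card_imset ?card_ord// => b b' /eqP.
  by rewrite eq_block_pos => /andP[/eqP].
- move=> j i; rewrite block_sum_signalE -/(w j) /cusum.
  by case: (i < t k)%N; rewrite mulrA.
- move=> j /imsetP[b _ ->{j}].
  have wj : `|w (block_pos b (f b).1)| = 1.
    rewrite /w (bigD1 b)//= eqxx mul1r big1 ?addr0 ?normrX ?normrN1 ?expr1n// => b' bb'.
    by rewrite eq_block_pos eq_sym (negbTE bb') mul0r.
  rewrite -/(cusum_scale n (t k)) -mulrBr.
  have -> : (1 - (t k)%:R / n%:R) / cusum_scale n (t k) -
    (0 - (t k)%:R / n%:R) / cusum_scale n (t k) = (cusum_scale n (t k))^-1 :> R by ring.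
  rewrite !normrM wj mul1r (ger0_norm rho0) normfV (ger0_norm (ltW c0)).
  by rewrite mulrC divfK ?gt_eqF.
Qed.

Hypothesis cross : forall k k', k != k' -> s%:R * rho ^+ 2 * `|gram k k'| <= 1.

Lemma block_sum_signal_cross k f k' f' : k != k' ->
  mxdot (block_sum (row_signal k) f) (block_sum (row_signal k') f') <= 1.
Proof.
move=> kk'; apply: le_trans (cross kk').
rewrite mxdot_suml -mulrA -[s in leRHS](card_ord s) mulr_natl -sumr_const.
apply: ler_sum => b _.
rewrite mxdotC mxdot_suml (bigD1 b)//= big1 ?addr0 => [|b' bb']; last first.
  by rewrite mxdot_signal (negbTE bb') !mul0r.
rewrite mxdotC mxdot_signal.
apply: (le_trans (ler_norm _)); rewrite !normrM normrX normrN1 expr1n mulr1.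
rewrite (ger0_norm rho0) -mulrA ler_piMl//.
  by rewrite mulr_ge0// sqr_ge0.
by case: (_ && _); rewrite ?normr1 ?normr0.
Qed.

Hypotheses (m0 : (0 < m)%N) (M0 : (0 < M)%N).

Lemma card_signal : #|{: 'I_m * bool}| = (m * 2)%N.
Proof. by rewrite card_prod card_ord card_bool. Qed.

Lemma risk_ge_cusum (g : R) : 0 < g <= 1 ->
  (1 + (m * 2)%:R `^ (- g) * expR (g * (1 + g) * rho ^+ 2 / 2)) ^+ s <= M%:R `^ g ->
  ((12 `^ (- g^-1) / 2)%:E <= risk_2side p n rho s)%E.
Proof.
move=> g01 HV.
have A0 : (0 < #|{: 'I_m * bool}|)%N by rewrite card_signal muln_gt0 m0.
apply: (@risk_ge_multiscale R p n M _ _ row_signal s rho g _ g01 A0 M0 _ _ _ HV).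
- by move=> t'; exact: block_sum_signal_alt.
- by move=> *; exact: block_sum_signal_cross.
move=> [k f] /=.
have Do b b' a a' : b != b' -> mxdot (row_signal k b a) (row_signal k b' a') = 0.
  by move=> bb'; rewrite mxdot_signal (negbTE bb') !mul0r.
have Dt b a : mxdot (row_signal k b a) (row_signal k b a) = rho ^+ 2.
  by rewrite mxdot_signal_same eqxx mul1r -signr_odd oddD addbb mul1r.
have := mixture_moment A0 Do Dt f g01; rewrite card_ord card_signal; apply.
move=> b [a1 a2] [a1' a2'] aa'; rewrite mxdot_signal_same /=.
have [aE|] := eqVneq a1 a1'; last by rewrite !mul0r.
move: aa'; rewrite -pair_eqE /= aE eqxx /= mul1r => aa'.
(* Distinct choices on the same row differ by their sign. *)
suff -> : (-1) ^+ (a2 + a2') = -1 :> R by rewrite mulN1r oppr_le0 sqr_ge0.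
by case: a2 a2' aa' => -[].
Qed.

(** For g = 1 the moment is computed exactly. Of the 2 m choices in a block one equals the truth,
    one is its opposite and the others are orthogonal to it; the two signs cancel the term linear in
    rho^2, which [risk_ge_cusum] keeps. *)
Lemma risk_ge_cusum2 :
  (1 + ((expR (rho ^+ 2) + expR (- rho ^+ 2)) / 2 - 1) / m%:R) ^+ s <= M%:R ->
  ((12^-1 / 2)%:E <= risk_2side p n rho s)%E.
Proof.
move=> HV.
have A0 : (0 < #|{: 'I_m * bool}|)%N by rewrite card_signal muln_gt0 m0.
have g01 : 0 < (1 : R) <= 1 by rewrite ltr01 lexx.
have := @risk_ge_multiscale R p n M _ _ row_signal s rho 1
  ((1 + ((expR (rho ^+ 2) + expR (- rho ^+ 2)) / 2 - 1) / m%:R) ^+ s) g01 A0 M0.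
rewrite invr1 powR_inv1// powRr1//; apply => //.
- by move=> t'; exact: block_sum_signal_alt.
- by move=> *; exact: block_sum_signal_cross.
move=> [k f] /=.
have Do b b' a a' : b != b' -> mxdot (row_signal k b a) (row_signal k b' a') = 0.
  by move=> bb'; rewrite mxdot_signal (negbTE bb') !mul0r.
have -> : (fun x => lratio (block_sum (row_signal k) f) x * mixture (row_signal k) x `^ 1) =
    (fun x => lratio (block_sum (row_signal k) f) x * mixture (row_signal k) x).
  by apply/funext => x; rewrite powRr1// mixture_ge0.
rewrite mixture_second_moment// lee_fin -[s in _ ^+ s](card_ord s) -prodr_const.
apply: ler_prod => b _; apply/andP; split.
  by rewrite mulr_ge0 ?invr_ge0// sumr_ge0// => a _; rewrite expR_ge0.
have mn0 : m%:R != 0 :> R by rewrite pnatr_eq0 -lt0n.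
rewrite card_signal -(pair_bigA _ (fun (a1 : 'I_m) (a2 : bool) => expR (mxdot (row_signal k b (f b)) (row_signal k b (a1, a2))))) /=.
rewrite (bigD1 (f b).1)//= big_bool /= !mxdot_signal_same /= eqxx.
rewrite (eq_bigr (fun=> 2)) => [|a1 af]; last first.
  rewrite big_bool /= !mxdot_signal_same /= eq_sym (negbTE af) !mul0r expR0; lra.
rewrite sumr_const cardC1 card_ord -[2 *+ _]mulr_natr -subn1 natrB//.
rewrite le_eqVlt; apply/orP; left; apply/eqP.
by case: ((f b).2); rewrite !mul1r /= ?expr0 ?expr1 ?expr2 ?mulrNN ?mul1r ?mulN1r natrM; field.
Qed.

End Signals.

(** * Change points in geometric progression *)

Section Geometric.
Context {R : realType}.

(** Squaring exp(x/2) <= 1/(1 - x/2) reduces the claim to x^2 (1 - x) (5/4 - x/2) >= 0. Negative [x]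
    is covered, so the bound serves both tails. *)
Lemma expR_le_quad (x : R) : x <= 1 -> expR x <= 1 + x + 2 * x ^+ 2.
Proof.
move=> x1; have d0 : 0 < 1 - x / 2 by lra.
have e1 : expR (x / 2) <= (1 - x / 2)^-1.
  rewrite -[expR _]invrK -expRN lef_pV2 ?posrE ?expR_gt0//.
  by have := @expR_ge1Dx R (- (x / 2)); rewrite addrC.
have -> : expR x = expR (x / 2) ^+ 2 by rewrite expr2 -expRD; congr expR; field.
have e2 : expR (x / 2) ^+ 2 <= ((1 - x / 2)^-1) ^+ 2.
  by rewrite !expr2; apply: ler_pM => //; exact: expR_ge0.
apply: (le_trans e2); rewrite exprVn -[X in X <= _]mul1r ler_pdivrMr ?exprn_gt0//.
rewrite -subr_ge0.
have -> : (1 + x + 2 * x ^+ 2) * (1 - x / 2) ^+ 2 - 1 = x ^+ 2 * (1 - x) * (5 / 4 - x / 2) by field.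
by apply: mulr_ge0; [apply: mulr_ge0; [exact: sqr_ge0|lra]|lra].
Qed.

Context (p n s B : nat) (rho : R).
Hypotheses (s0 : (0 < s)%N) (sp : (s <= p)%N) (B1 : (1 < B)%N) (Bn : (B <= n)%N).
Hypotheses (rho0 : 0 <= rho) (HB : (s%:R * rho ^+ 2) ^+ 2 <= B%:R).

Let m := (p %/ s)%N.
Let M := trunc_log B n.
Let t (k : 'I_M) := (B ^ k)%N.

Lemma geometric_bnd k : (0 < t k < n)%N.
Proof.
rewrite expn_gt0 (ltn_trans _ B1)//=.
apply: (@leq_trans (B ^ M)); first by rewrite ltn_exp2l.
by apply: trunc_logP => //; exact: leq_trans (ltnW B1) Bn.
Qed.

(** Change points at least a factor [B] apart have squared correlation at most 1/B, and [HB] takes B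
    above the square of the total energy. *)
Lemma geometric_cross k k' : k != k' ->
  s%:R * rho ^+ 2 * `|\sum_(i < n) cusum n (t k) i * cusum n (t k') i| <= 1.
Proof.
wlog kk' : k k' / (k < k')%N.
  move=> H kk'; have := kk'; rewrite neq_ltn => /orP[|] lt; first exact: H.
  have := H _ _ lt; rewrite eq_sym kk' => /(_ isT).
  by under eq_bigr do rewrite mulrC.
move=> _; have /andP[t0 tn] := geometric_bnd k; have /andP[t'0 t'n] := geometric_bnd k'.
have tt' : (t k * B <= t k')%N by rewrite /t -expnSr leq_pexp2l// ltnW.
have tle : (t k <= t k')%N by apply: leq_trans tt'; rewrite leq_pmulr// ltnW.
rewrite -(@ler_pXn2r _ 2%N) ?nnegrE ?mulr_ge0 ?sqr_ge0// expr1n exprMn real_normK ?num_real//.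
rewrite cusum_gram_sq//.
apply: (@le_trans _ _ (B%:R * ((t k)%:R / (t k')%:R))).
  apply: ler_pM => //; rewrite ?sqr_ge0 ?divr_ge0 ?mulr_ge0//.
  rewrite ler_pdivrMr ?mulr_gt0 ?ltr0n ?subn_gt0//.
  rewrite [leRHS]mulrA divfK ?gt_eqF ?ltr0n// ler_wpM2l// ler_nat.
  exact: leq_sub2l.
by rewrite mulrA ler_pdivrMr ?ltr0n// mul1r -natrM ler_nat mulnC.
Qed.

Lemma scale_count_gt0 : (0 < M)%N.
Proof. by rewrite /M trunc_log_gt0 B1 prednK ?(ltnW B1). Qed.

Lemma expR_le_scales (g y : R) : 0 < g ->
  y <= g * (ln (ln n%:R) - ln (2 * ln B%:R)) -> expR y <= M%:R `^ g.
Proof.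
move=> g0 Hy; have M0 := scale_count_gt0.
have lB : 0 < ln B%:R :> R by rewrite ln_gt0// ltr1n.
have ln_n : 0 < ln n%:R :> R by rewrite ln_gt0// ltr1n (leq_trans B1).
have Mpos : 0 < M%:R :> R by rewrite ltr0n.
(* From n <= B^(M + 1) and M + 1 <= 2 M; rounding the number of scales costs the factor 2. *)
have nB : ln n%:R <= M%:R * (2 * ln B%:R) :> R.
  have h : (n <= B ^ M.+1)%N by rewrite ltnW// trunc_log_ltn.
  apply: (@le_trans _ _ (ln ((B ^ M.+1)%N%:R))).
    by rewrite ler_ln ?posrE ?ltr0n ?expn_gt0 ?(ltnW B1)// ?ler_nat// (leq_trans _ Bn)// ltnW.
  rewrite natrX lnXn ?ltr0n ?(ltnW B1)// -[ln _ *+ _]mulr_natl mulrA ler_wpM2r ?(ltW lB)//.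
  by rewrite -natrM ler_nat -addn1 mulnC mul2n -addnn leq_add2l.
apply: (@le_trans _ _ (expR (g * ln M%:R))); last first.
  by rewrite mulrC expRM lnK// posrE.
rewrite ler_expR; apply: (le_trans Hy); rewrite ler_wpM2l ?(ltW g0)//.
rewrite lerBlDr -lnM ?posrE ?mulr_gt0//.
by rewrite ler_ln// posrE ?mulr_gt0// mulr_gt0.
Qed.

Lemma block_count_gt0 : (0 < m)%N.
Proof. by rewrite divn_gt0. Qed.

Lemma block_count_fit : (s * m <= p)%N.
Proof. by rewrite mulnC leq_divM. Qed.

Lemma risk_ge_geometric (g y : R) : 0 < g <= 1 ->
  (1 + (m * 2)%:R `^ (- g) * expR (g * (1 + g) * rho ^+ 2 / 2)) ^+ s <= expR y ->
  y <= g * (ln (ln n%:R) - ln (2 * ln B%:R)) ->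
  ((12 `^ (- g^-1) / 2)%:E <= risk_2side p n rho s)%E.
Proof.
move=> g01 HV Hy; have /andP[g0 _] := g01.
apply: (risk_ge_cusum geometric_bnd block_count_fit rho0 geometric_cross block_count_gt0 scale_count_gt0 g01).
exact: le_trans HV (expR_le_scales g0 Hy).
Qed.

Lemma risk_ge_geometric2 (y : R) :
  (1 + ((expR (rho ^+ 2) + expR (- rho ^+ 2)) / 2 - 1) / m%:R) ^+ s <= expR y ->
  y <= ln (ln n%:R) - ln (2 * ln B%:R) ->
  ((12^-1 / 2)%:E <= risk_2side p n rho s)%E.
Proof.
move=> HV Hy.
apply: (risk_ge_cusum2 geometric_bnd block_count_fit rho0 geometric_cross block_count_gt0 scale_count_gt0).
have := @expR_le_scales 1 y ltr01; rewrite mul1r powRr1// => /(_ Hy).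
exact: le_trans HV.
Qed.

End Geometric.

(** * Scan tests and the upper bound *)

Section Chernoff.
Context {R : realType} (p n : nat) (g : R -> R).
Notation obs := (obs R p n).
Notation N01 := (normal_prob (0 : R) 1).
Hypothesis mg : measurable_fun setT g.
Hypothesis g01 : forall x, 0 <= g x <= 1.

Definition shifted_mean (m : R) : R := fine (\int[N01]_z (g (m + z)%R)%:E)%E.

Let mgs m : measurable_fun setT (fun z : R => g (m + z)).
Proof. by apply: (measurableT_comp mg); exact: measurable_funD. Qed.

Lemma shifted_meanE m : (\int[N01]_z (g (m + z)%R)%:E = (shifted_mean m)%:E)%E.
Proof.
rewrite fineK// ge0_fin_numE; last first.
  by apply: integral_ge0 => z _; rewrite lee_fin; case/andP: (g01 (m + z)).
apply: (@le_lt_trans _ _ 1%E); last exact: ltry.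
rewrite -(integral_gauss_cst (1%E : \bar R)); apply: ge0_le_integral => //.
- by move=> z _; rewrite lee_fin; case/andP: (g01 (m + z)).
- by apply/measurable_EFinP; exact: mgs.
- by move=> z _; rewrite lee_fin; case/andP: (g01 (m + z)).
Qed.

Definition scan_stat (t : nat) (x : obs) : R :=
  \sum_j g (\sum_(i < n) cusum n t i * mx_of_obs x j i).

Lemma measurable_scan_stat t : measurable_fun setT (scan_stat t).
Proof.
apply: measurable_sum => j; apply: (measurableT_comp mg); apply: measurable_sum => i.
by apply: measurable_funM => //; exact: measurable_entry.
Qed.

(** The chord of the convex exponential, obtained from [powR_tangent] with base e^l and exponent
    [y]. *)
Lemma expR_interp (l y : R) : 0 <= y <= 1 -> expR (l * y) <= 1 + (expR l - 1) * y.
Proof using.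
move=> /andP[y0 y1]; rewrite expRM.
move: y0; rewrite le_eqVlt => /orP[/eqP <-|y0]; first by rewrite powRr0 mulr0 addr0.
have y01 : 0 < y <= 1 by rewrite y0.
by apply: (le_trans (powR_tangent y01 (expR_ge0 l))); lra.
Qed.

(** Rows are independent; the chord bound and 1 + x <= e^x give each of them the moment generating
    function of a Poisson variable with the same mean. Either sign of [l] is allowed, so both tails
    follow from the means alone. *)
Lemma gauss_expect_scan_stat theta t (l : R) : (0 < t < n)%N ->
  (gauss_expect theta (fun x => expR (l * scan_stat t x))%R <=
   (expR ((expR l - 1) * \sum_j shifted_mean (\sum_(i < n) cusum n t i * theta j i)))%R%:E)%E.
Proof.
move=> tn.
have -> : (fun x => expR (l * scan_stat t x)) =
   (fun x => \prod_j expR (l * g (\sum_(i < n) cusum n t i * mx_of_obs x j i))).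
  by apply/funext => x; rewrite -expR_sum mulr_sumr.
have mh : measurable_fun setT (fun u : R => expR (l * g u)).
  by apply: measurableT_comp => //; exact: measurable_funM.
rewrite (gauss_expect_rows theta (c := fun i => cusum n t i) (h := fun j u => expR (l * g u))
  (cusum_norm tn) (fun=> mh) (fun _ _ => expR_ge0 _)).
rewrite mulr_sumr expR_sum -prodEFin; apply: lee_prode => j.
  by apply: integral_ge0 => z _; rewrite lee_fin expR_ge0.
set m := \sum_(i < n) _.
have m1B : measurable_fun setT (fun z : R => 1 - g (m + z)).
  by apply: measurable_funB => //; exact: mgs.
have c1 : 0 < expR l by exact: expR_gt0.
have q0 : 0 <= shifted_mean m.
  by rewrite fine_ge0//; apply: integral_ge0 => z _; rewrite lee_fin; case/andP: (g01 (m + z)).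
(* The chord is split into two nonnegative terms, since [expR l - 1] is negative for [l < 0]. *)
apply: (@le_trans _ _ (\int[N01]_z ((1 - g (m + z)) + expR l * g (m + z))%R%:E)%E).
  apply: ge0_le_integral.
  - exact: measurableT.
  - by move=> z _; rewrite lee_fin expR_ge0.
  - apply/measurable_EFinP; apply: (measurableT_comp mh); exact: measurable_funD.
  - apply/measurable_EFinP; apply: measurable_funD; first exact: m1B.
    by apply: measurable_funM => //; exact: mgs.
  - move=> z _; rewrite lee_fin; apply: (le_trans (expR_interp l (g01 (m + z)))); lra.
under eq_integral do rewrite EFinD EFinM.
rewrite ge0_integralD//; last 4 first.
- by move=> z _; rewrite lee_fin subr_ge0; case/andP: (g01 (m + z)).
- by apply/measurable_EFinP; exact: m1B.
- by move=> z _; rewrite mule_ge0// lee_fin ?(ltW c1)//; case/andP: (g01 (m + z)).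
- by apply: emeasurable_funM => //; apply/measurable_EFinP; exact: mgs.
rewrite ge0_integralZl; [|exact: measurableT|by apply/measurable_EFinP; exact: mgs
  |by move=> z _; rewrite lee_fin; case/andP: (g01 (m + z))|by rewrite lee_fin ltW].
rewrite shifted_meanE.
have -> : (\int[N01]_z (1 - g (m + z))%R%:E = (1 - shifted_mean m)%R%:E)%E.
  have : (\int[N01]_z (1 - g (m + z) + g (m + z))%R%:E = 1)%E.
    by rewrite -[RHS](integral_gauss_cst (R := R)); apply: eq_integral => z _; rewrite subrK.
  under eq_integral do rewrite EFinD.
  rewrite ge0_integralD//; last 4 first.
  - by move=> z _; rewrite lee_fin subr_ge0; case/andP: (g01 (m + z)).
  - by apply/measurable_EFinP; exact: m1B.
  - by move=> z _; rewrite lee_fin; case/andP: (g01 (m + z)).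
  - by apply/measurable_EFinP; exact: mgs.
  move=> H; rewrite shifted_meanE in H.
  by move: H => /(congr1 (fun y => y - (shifted_mean m)%:E)%E); rewrite addeK// => ->; rewrite EFinB.
rewrite -EFinM -EFinD lee_fin.
apply: (@le_trans _ _ (1 + (expR l - 1) * shifted_mean m)); first lra.
exact: expR_ge1Dx.
Qed.

End Chernoff.

(** * Errors of the scan test *)

Section RiskUpper.
Context {R : realType} (p n : nat) (g : R -> R).
Notation obs := (obs R p n).
Hypothesis mg : measurable_fun setT g.
Hypothesis g01 : forall x, 0 <= g x <= 1.
Notation q := (shifted_mean g).

Lemma sum_cusum_step t t' (m1 m2 : R) : (0 < t < n)%N -> (0 < t' < n)%N ->
  \sum_(i < n) cusum n t i * (if (i < t')%N then m1 else m2) =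
  (m1 - m2) * cusum_scale n t' * \sum_(i < n) cusum n t i * cusum n t' i.
Proof.
move=> tn t'n; under eq_bigr => i _ do rewrite (step_cusum _ _ i t'n) mulrDr.
rewrite big_split /= -mulr_suml cusum_sum// mul0r add0r mulr_sumr.
by apply: eq_bigr => i _; rewrite mulrCA.
Qed.

(** The test rejects when a scanned statistic reaches [x0]. Contrasts annihilate the constant rows
    of the null, so all means are q 0 and a union bound over [ts] applies. Under the alternative a
    single grid point correlated with the true change suffices; the condition on all [q m] handles
    rows outside [S], which may jump by any amount. *)
Lemma risk_le (s : nat) (rho kap om l1 l2 : R) (ts : seq nat) :
  (forall t, t \in ts -> (0 < t < n)%N) ->
  (forall t', (0 < t' < n)%N ->
    exists2 t, t \in ts & kap <= \sum_(i < n) cusum n t i * cusum n t' i) ->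
  0 <= kap -> 0 <= rho -> 0 <= om -> 0 <= l1 -> 0 <= l2 ->
  (forall m, q 0 <= q m) -> (forall m, kap * rho <= `|m| -> q 0 + om <= q m) ->
  forall x0 : R,
  (risk_2side p n rho s <=
   ((size ts)%:R * expR (- (l1 * x0) + (expR l1 - 1) * (p%:R * q 0)) +
    expR (l2 * x0 + (expR (- l2) - 1) * (p%:R * q 0 + s%:R * om)))%:E)%E.
Proof.
move=> tsn cover kap0 rho0 om0 l10 l20 qmin qom x0.
pose T t := @scan_stat R p n g t.
have mT t : measurable_fun setT (T t) by exact: measurable_scan_stat.
pose psi x := has (fun t => x0 <= T t x) ts.
have mpsi : is_test psi.
  rewrite /is_test /psi; elim: ts {tsn cover psi} => [|t ts IH] /=; first exact: measurable_cst.
  by apply: measurable_or => //; apply: measurable_fun_ler => //; exact: measurable_cst.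
have mps := measurable_test mpsi.
have mexp (l c : R) t : measurable_fun setT (fun x => expR (l * T t x) * c).
  by apply: measurable_funM => //; apply: measurableT_comp => //; exact: measurable_funM.
apply: ge_ereal_inf.
eexists; first by exists psi; [exact: mpsi|reflexivity].
rewrite EFinD; apply: leeD; apply: ge_ereal_sup => _ [theta th <-].
- apply: (@le_trans _ _ (gauss_expect theta (fun x => \sum_(t <- ts) expR (- (l1 * x0)) * expR (l1 * T t x)))).
    apply: le_gauss_expect => //.
    + apply: measurable_sum => t; apply: measurable_funM => //; apply: measurableT_comp => //.
      exact: measurable_funM.
    + move=> x; rewrite /psi; case: hasP => [[t tts ht]|_] /=; last first.
        by apply: sumr_ge0 => t _; rewrite mulr_ge0 ?expR_ge0.
      rewrite (big_rem t)//= -[1]addr0; apply: lerD; last first.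
        by apply: sumr_ge0 => t' _; rewrite mulr_ge0 ?expR_ge0.
      by rewrite -expRD -expR0 ler_expR addrC subr_ge0 ler_wpM2l.
  rewrite gauss_expect_sum; last 2 first.
  - move=> t; apply: measurable_funM => //; apply: measurableT_comp => //.
    exact: measurable_funM.
  - by move=> t x; rewrite mulr_ge0 ?expR_ge0.
  apply: (@le_trans _ _ (\sum_(t <- ts) (expR (- (l1 * x0) + (expR l1 - 1) * (p%:R * q 0)))%:E)%E).
    rewrite big_seq [leRHS]big_seq; apply: lee_sum => t tts.
    rewrite gauss_expectZ ?expR_ge0//; last first.
    - by apply: measurableT_comp => //; exact: measurable_funM.
    rewrite expRD EFinM; apply: lee_wpmul2l; first by rewrite lee_fin expR_ge0.
    have := gauss_expect_scan_stat mg g01 theta l1 (tsn _ tts).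
    rewrite (eq_bigr (fun=> q 0)) => [|j _].
      by rewrite sumr_const card_ord -[q 0 *+ p]mulr_natl.
    have n0 : (0 < n)%N by case/andP: (tsn _ tts) => _; exact: leq_ltn_trans.
    rewrite (eq_bigr (fun i : 'I_n => cusum n t i * theta j (Ordinal n0))) => [|i _].
      by rewrite -mulr_suml cusum_sum ?mul0r// tsn.
    by congr (_ * _); exact: th.
  by rewrite sumEFin lee_fin big_const_seq count_predT iter_addr_0 -[X in X <= _]mulr_natl.
- case: th => t' [mu1 [mu2 [S [t'n sS thE thS]]]].
  have t'n' : (0 < t' < n)%N.
    by case/andP: t'n => t0 tn; rewrite t0; move: t0 tn; case: (n) => [|k]//= t0; case: t' {thE thS} t0.
  have [t tts corr] := cover t' t'n'.
  apply: (@le_trans _ _ (gauss_expect theta (fun x => expR (l2 * x0) * expR ((- l2) * T t x)))).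
    apply: le_gauss_expect => //.
    + exact: measurable_funB.
    + apply: measurable_funM => //; apply: measurableT_comp => //.
      exact: measurable_funM.
    + by move=> x; case: (psi x); rewrite /= ?subrr ?subr0.
    + move=> x; case E : (psi x); first by rewrite subrr mulr_ge0 ?expR_ge0.
      rewrite subr0 -expRD -expR0 ler_expR mulNr subr_ge0 ler_wpM2l//.
      by move: E => /negbT /hasPn /(_ _ tts); rewrite -ltNge => /ltW.
  rewrite gauss_expectZ ?expR_ge0//; last first.
  - by apply: measurableT_comp => //; exact: measurable_funM.
  rewrite expRD EFinM; apply: lee_wpmul2l; first by rewrite lee_fin expR_ge0.
  apply: (le_trans (gauss_expect_scan_stat mg g01 theta (- l2) (tsn _ tts))).
  rewrite lee_fin ler_expR ler_wnM2l//.
    by rewrite subr_le0 -[leRHS]expR0 ler_expR oppr_le0.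
  have qj j : q 0 + (j \in S)%:R * om <= q (\sum_(i < n) cusum n t i * theta j i).
    case: (boolP (j \in S)) => jS /=; last by rewrite mul0r addr0.
    rewrite mul1r; apply: qom.
    under eq_bigr do rewrite thE.
    rewrite (sum_cusum_step _ _ (tsn _ tts) t'n').
    have gr0 : 0 <= \sum_(i < n) cusum n t i * cusum n t' i :> R by exact: (le_trans kap0 corr).
    have c0 := @cusum_scale_gt0 R n t' t'n'.
    rewrite !normrM (ger0_norm gr0) (ger0_norm (ltW c0)) mulrC; apply: ler_pM => //.
    by rewrite mulrC; exact: thS.
  apply: le_trans (ler_sum _ (fun j _ => qj j)).
  rewrite big_split /= sumr_const card_ord -[q 0 *+ p]mulr_natl lerD2l -mulr_suml.
  rewrite ler_wpM2r// -natr_sum ler_nat; apply: (leq_trans sS).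
  by rewrite -sum1_card big_mkcond; apply: leq_sum => j _; case: (j \in S).
Qed.

End RiskUpper.

(** * Gaussian means of the scores *)

Section ThresholdMean.
Context {R : realType}.
Notation N01 := (normal_prob (0 : R) 1).
Notation mu := (@lebesgue_measure R).

Lemma integral_gauss_realZ (f : R -> R) (c : R) : measurable_fun setT f ->
  (forall z, 0 <= f z) -> 0 <= c ->
  (\int[N01]_z (c * f z)%R%:E = c%:E * \int[N01]_z (f z)%:E)%E.
Proof.
move=> mf f0 c0; rewrite -ge0_integralZl.
- by apply: eq_integral => z _; rewrite EFinM.
- exact: measurableT.
- by apply/measurable_EFinP.
- by move=> z _; rewrite lee_fin.
- by rewrite lee_fin.
Qed.

Lemma integral_gauss_realD (f1 f2 : R -> R) :
  measurable_fun setT f1 -> measurable_fun setT f2 ->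
  (forall z, 0 <= f1 z) -> (forall z, 0 <= f2 z) ->
  (\int[N01]_z (f1 z + f2 z)%R%:E = \int[N01]_z (f1 z)%:E + \int[N01]_z (f2 z)%:E)%E.
Proof.
move=> m1 m2 f10 f20; rewrite -ge0_integralD.
- by apply: eq_integral => z _; rewrite EFinD.
- exact: measurableT.
- by move=> z _; rewrite lee_fin.
- by apply/measurable_EFinP.
- by move=> z _; rewrite lee_fin.
- by apply/measurable_EFinP.
Qed.

Lemma le_integral_gauss_real (f1 f2 : R -> R) :
  measurable_fun setT f1 -> measurable_fun setT f2 ->
  (forall z, 0 <= f1 z) -> (forall z, f1 z <= f2 z) ->
  (\int[N01]_z (f1 z)%:E <= \int[N01]_z (f2 z)%:E)%E.
Proof.
move=> m1 m2 f10 f12; apply: ge0_le_integral.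
- exact: measurableT.
- by move=> z _; rewrite lee_fin.
- by apply/measurable_EFinP.
- by apply/measurable_EFinP.
- by move=> z _; rewrite lee_fin.
Qed.

(** Monotonicity of cosh: for 0 <= a <= b the difference is (e^b - e^a) (1 - e^(-(a + b))). *)
Lemma expR_sym_le (u v : R) : `|u| <= `|v| -> expR u + expR (- u) <= expR v + expR (- v).
Proof.
have sym (w : R) : expR w + expR (- w) = expR `|w| + expR (- `|w|).
  by have [w0|w0] := leP 0 w; [rewrite ger0_norm|rewrite ltr0_norm// opprK addrC].
move=> uv; rewrite (sym u) (sym v); move: uv (normr_ge0 u).
move: `|u| `|v| => a b ab a0; rewrite -subr_ge0.
have -> : expR b + expR (- b) - (expR a + expR (- a)) = (expR b - expR a) * (1 - expR (- (a + b))).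
  rewrite mulrBr mulr1 mulrBl -!expRD.
  have -> : b + - (a + b) = - a by ring.
  have -> : a + - (a + b) = - b by ring.
  ring.
by apply: mulr_ge0; rewrite subr_ge0 ?ler_expR// -[leRHS]expR0 ler_expR; lra.
Qed.

Lemma integral_gauss_tilt (m : R) : (\int[N01]_z (expR (m * z - m ^+ 2 / 2))%:E = 1)%E.
Proof.
rewrite -[RHS](integral_gauss_cst (1%E : \bar R)) (integral_gaussD m (f := fun=> 1%E))//.
by apply: eq_integral => z _; rewrite mul1e.
Qed.

Section Threshold.
Context (tau : R).
Hypothesis tau0 : 0 <= tau.

Definition exceed (y : R) : R := (tau < `|y|)%R%:R.

Lemma measurable_exceed : measurable_fun setT exceed.
Proof.
apply: (measurableT_comp (f := fun b : bool => b%:R : R)) => //.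
by apply: measurable_fun_ltr => //; exact: measurableT_comp.
Qed.

Lemma exceed01 y : 0 <= exceed y <= 1.
Proof. by rewrite /exceed; case: (_ < _); rewrite /= ?lexx ?ler01. Qed.

Notation q := (shifted_mean exceed).

Lemma exceed_meanE m : (\int[N01]_z (exceed (m + z)%R)%:E = (q m)%:E)%E.
Proof. exact: (shifted_meanE measurable_exceed exceed01). Qed.

Lemma exceedN y : exceed (- y) = exceed y.
Proof. by rewrite /exceed normrN. Qed.

Let me m : measurable_fun setT (fun z : R => exceed (m + z)).
Proof. by apply: (measurableT_comp measurable_exceed); exact: measurable_funD. Qed.

Lemma exceed_meanN m : q (- m) = q m.
Proof.
apply/EFin_inj; rewrite -!exceed_meanE -(integral_gaussN (f := fun z => (exceed (- m + z))%:E)).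
- by apply: eq_integral => z _; rewrite -opprD exceedN.
- by apply/measurable_EFinP; exact: me.
- by move=> z; rewrite lee_fin; case/andP: (exceed01 (- m + z)).
Qed.

(** The indicator lies below e^(-tau^2 / 2) times the sum of the exponential tilts at tau and -tau,
    each of integral 1. *)
Lemma exceed_mean_null : q 0 <= 2 * expR (- tau ^+ 2 / 2).
Proof.
rewrite -lee_fin -exceed_meanE.
have mt (c : R) : measurable_fun setT (fun z : R => expR (c * z - c ^+ 2 / 2)).
  by apply: measurableT_comp => //; apply: measurable_funB.
have mtt : measurable_fun setT
    (fun z : R => expR (tau * z - tau ^+ 2 / 2) + expR ((- tau) * z - (- tau) ^+ 2 / 2)).
  by apply: measurable_funD; exact: mt.
have -> : ((2 * expR (- tau ^+ 2 / 2))%:E = \int[N01]_z (expR (- tau ^+ 2 / 2) *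
   (expR (tau * z - tau ^+ 2 / 2) + expR ((- tau) * z - (- tau) ^+ 2 / 2)))%R%:E)%E.
  rewrite (integral_gauss_realZ mtt (fun z => addr_ge0 (expR_ge0 _) (expR_ge0 _)) (expR_ge0 _)).
  rewrite (integral_gauss_realD (mt _) (mt _) (fun=> expR_ge0 _) (fun=> expR_ge0 _)).
  by rewrite !integral_gauss_tilt -EFinD -EFinM; congr EFin; rewrite mulrC.
apply: le_integral_gauss_real.
- exact: me.
- exact: measurable_funM.
- by move=> z; case/andP: (exceed01 (0 + z)).
move=> z; rewrite add0r /exceed.
set E1 := expR (tau * z - _); set E2 := expR (- tau * z - _).
have E10 : 0 < E1 by exact: expR_gt0.
have E20 : 0 < E2 by exact: expR_gt0.
case: ltP => hz /=; last by rewrite mulr_ge0 ?expR_ge0// addr_ge0 ?ltW.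
have [z0|z0] := leP 0 z.
  apply: (@le_trans _ _ (expR (- tau ^+ 2 / 2) * E1)); last by rewrite ler_wpM2l ?expR_ge0// lerDl ltW.
  rewrite -expRD -[leLHS]expR0 ler_expR.
  have : tau * tau <= tau * z by rewrite ler_wpM2l// -(ger0_norm z0) ltW.
  by rewrite -expr2; lra.
apply: (@le_trans _ _ (expR (- tau ^+ 2 / 2) * E2)); last by rewrite ler_wpM2l ?expR_ge0// lerDr ltW.
rewrite -expRD -[leLHS]expR0 ler_expR sqrrN.
have : tau * tau <= tau * (- z) by rewrite ler_wpM2l// -(ltr0_norm z0) ltW.
by rewrite -expr2; lra.
Qed.

(* The density [h] of |m + Z| with respect to |Z| is increasing and has mean 1, so it cannot
   decrease the mass of a tail. *)
Lemma exceed_mean_ge m : q 0 <= q m.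
Proof.
pose h z := (expR (m * z - m ^+ 2 / 2) + expR ((- m) * z - (- m) ^+ 2 / 2)) / 2.
have h0 z : 0 <= h z by rewrite divr_ge0// addr_ge0 ?expR_ge0.
have mt (c : R) : measurable_fun setT (fun z : R => expR (c * z - c ^+ 2 / 2)).
  by apply: measurableT_comp => //; apply: measurable_funB.
have mh : measurable_fun setT h.
  by apply: measurable_funM => //; apply: measurable_funD; exact: mt.
have hE z : h z = expR (- m ^+ 2 / 2) * (expR (m * z) + expR (- (m * z))) / 2.
  by rewrite /h mulrDr -!expRD sqrrN mulNr; congr ((expR _ + expR _) / 2); ring.
have hmono (z w : R) : `|z| <= `|w| -> h z <= h w.
  move=> zw; rewrite !hE ler_wpM2r// ler_wpM2l ?expR_ge0//.
  by apply: expR_sym_le; rewrite !normrM ler_wpM2l.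
have half (f1 f2 : R -> R) : measurable_fun setT f1 -> measurable_fun setT f2 ->
    (forall z, 0 <= f1 z) -> (forall z, 0 <= f2 z) ->
    (\int[N01]_z ((f1 z + f2 z) / 2)%R%:E = 2^-1%:E * (\int[N01]_z (f1 z)%:E + \int[N01]_z (f2 z)%:E))%E.
  move=> mf1 mf2 f10 f20; rewrite -integral_gauss_realD// -integral_gauss_realZ//.
  - by apply: eq_integral => z _; rewrite mulrC.
  - exact: measurable_funD.
  - by move=> z; rewrite addr_ge0.
have Ih : (\int[N01]_z (h z)%:E = 1)%E.
  rewrite (half _ _ (mt _) (mt _) (fun=> expR_ge0 _) (fun=> expR_ge0 _)).
  by rewrite !integral_gauss_tilt -EFinD -EFinM; congr EFin; lra.
have mex := measurable_exceed.
have ex0 z : 0 <= exceed z by case/andP: (exceed01 z).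
have ex1 z : 0 <= 1 - exceed z by rewrite subr_ge0; case/andP: (exceed01 z).
have tilt (c : R) : (\int[N01]_z (exceed z * expR (c * z - c ^+ 2 / 2))%R%:E = (q c)%:E)%E.
  rewrite -exceed_meanE (integral_gaussD c (f := fun z => (exceed z)%:E))//.
  - exact/measurable_EFinP.
have mte (c : R) : measurable_fun setT (fun z : R => exceed z * expR (c * z - c ^+ 2 / 2)).
  by apply: measurable_funM => //; exact: mt.
have Iq : (\int[N01]_z (exceed z * h z)%R%:E = (q m)%:E)%E.
  transitivity (\int[N01]_z ((exceed z * expR (m * z - m ^+ 2 / 2) + exceed z * expR ((- m) * z - (- m) ^+ 2 / 2)) / 2)%R%:E)%E.
    by apply: eq_integral => z _; rewrite /h mulrA mulrDr.
  rewrite (half _ _ (mte _) (mte _) (fun=> mulr_ge0 (ex0 _) (expR_ge0 _)) (fun=> mulr_ge0 (ex0 _) (expR_ge0 _))).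
  by rewrite !tilt exceed_meanN -EFinD -EFinM; congr EFin; lra.
have I0 : (\int[N01]_z (exceed z)%:E = (q 0)%:E)%E.
  by rewrite -exceed_meanE; apply: eq_integral => z _; rewrite add0r.
have meh : measurable_fun setT (fun z => exceed z * h z) by exact: measurable_funM.
have m1e : measurable_fun setT (fun z => 1 - exceed z) by exact: measurable_funB.
have m1eh : measurable_fun setT (fun z => (1 - exceed z) * h z) by exact: measurable_funM.
(* If h(tau) >= 1 then h is at least 1 on the tail; otherwise it is at most 1 on the complement, and
   equal total masses transfer this to the tail. *)
have [hh|hh] := leP 1 (h tau).
  rewrite -lee_fin -I0 -Iq; apply: le_integral_gauss_real => // z.
  rewrite /exceed; case: ltP => hz; rewrite /= ?mul0r// mul1r.
  by apply: (le_trans hh); apply: hmono; rewrite (ger0_norm tau0) ltW.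
have sum1 (f : R -> R) : measurable_fun setT f -> (forall z, 0 <= f z) ->
   (\int[N01]_z (exceed z * f z)%R%:E + \int[N01]_z ((1 - exceed z) * f z)%R%:E = \int[N01]_z (f z)%:E)%E.
  move=> mf f0; rewrite -integral_gauss_realD; last 4 first.
  - exact: measurable_funM.
  - exact: measurable_funM.
  - by move=> z; rewrite mulr_ge0.
  - by move=> z; rewrite mulr_ge0.
  by apply: eq_integral => z _; congr EFin; ring.
have S1 := sum1 _ mh h0; rewrite Iq Ih in S1.
have S2 := sum1 (fun=> 1) (measurable_cst _) (fun=> ler01).
rewrite integral_gauss_cst in S2.
have le12 : (\int[N01]_z ((1 - exceed z) * h z)%R%:E <= \int[N01]_z ((1 - exceed z) * 1)%R%:E)%E.
  apply: le_integral_gauss_real => //.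
  - exact: measurable_funM.
  - by move=> z; rewrite mulr_ge0.
  move=> z; rewrite /exceed; case: ltP => hz; rewrite /= ?subrr ?mul0r// subr0 !mul1r.
  by apply: (le_trans _ (ltW hh)); apply: hmono; rewrite (ger0_norm tau0).
have I1 : (\int[N01]_z (exceed z * 1)%R%:E = (q 0)%:E)%E.
  by rewrite -I0; apply: eq_integral => z _; rewrite mulr1.
rewrite I1 in S2.
move: S1 S2 le12; set A := (\int[N01]_z ((1 - exceed z) * h z)%R%:E)%E.
set B := (\int[N01]_z ((1 - exceed z) * 1)%R%:E)%E.
case: A => [A| |]//; case: B => [B| |]//.
by rewrite -!EFinD => -[S1] [S2]; rewrite lee_fin; lra.
Qed.

(** For m >= 0, noise beyond [x] takes the row over the threshold. The unit interval after [x] alone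
    carries this mass, the density there being smallest at x + 1. *)
Lemma exceed_mean_tail (m r x : R) : r <= `|m| -> 0 <= x -> tau - r <= x ->
  normal_peak 1 * expR (- (x + 1) ^+ 2 / 2) <= q m.
Proof.
wlog m0 : m / 0 <= m.
  move=> H; have [m0|m0] := leP 0 m; first exact: H.
  by move=> *; rewrite -exceed_meanN; apply: H; rewrite ?oppr_ge0 ?normrN// ltW.
rewrite (ger0_norm m0) => rm x0 xr.
rewrite -lee_fin -exceed_meanE.
pose I := `]x, (x + 1)]%classic.
have mI : measurable (I : set R) by exact: measurable_itv.
apply: (@le_trans _ _ (\int[mu]_z ((normal_peak 1 * expR (- (x + 1) ^+ 2 / 2))%:E * (\1_I z)%:E))%E).
  rewrite ge0_integralZl; [|exact: measurableT|by apply/measurable_EFinP; exact: measurable_indic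
    |by move=> z _; rewrite lee_fin|by rewrite lee_fin mulr_ge0 ?normal_peak_ge0 ?expR_ge0].
  rewrite integral_indic//= setIT; rewrite /I lebesgue_measure_itv/= lte_fin ltrDl ltr01.
  by rewrite -EFinB (_ : x + 1 - x = 1) ?mule1//; ring.
rewrite integral_normal_prob_pdf; last 2 first.
- by apply/measurable_EFinP; exact: me.
- by move=> z; rewrite lee_fin; case/andP: (exceed01 (m + z)).
apply: ge0_le_integral.
- exact: measurableT.
- by move=> z _; rewrite mule_ge0// lee_fin// mulr_ge0 ?normal_peak_ge0 ?expR_ge0.
- apply: emeasurable_funM => //; apply/measurable_EFinP; exact: measurable_indic.
- apply: emeasurable_funM; first by apply/measurable_EFinP; exact: me.
  exact: measurable_normal_pdfE.
move=> z _; rewrite -!EFinM lee_fin indicE.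
have [|_] := boolP (z \in I); last first.
  by rewrite mulr0 mulr_ge0 ?normal_pdf_ge0//; case/andP: (exceed01 (m + z)).
rewrite inE /I /= in_itv/= => /andP[xz zx].
have z0 : 0 < z by exact: le_lt_trans xz.
have -> : exceed (m + z) = 1.
  rewrite /exceed (_ : (tau < `|m + z|)%R)// gtr0_norm; last by rewrite ltr_wpDl.
  lra.
rewrite mulr1 mul1r normal_pdfE ?oner_eq0// ler_wpM2l ?normal_peak_ge0//.
rewrite /normal_fun subr0 expr1n ler_expR !mulNr lerN2 ler_pM2r//.
by rewrite ler_pXn2r// ?nnegrE ?(ltW z0)// addr_ge0.
Qed.

End Threshold.

(** A bounded substitute for the quadratic score: equivalent to y^2 / 2 near 0, and with Gaussian
    means in closed form. *)
Definition bump_score (y : R) : R := 1 - expR (- y ^+ 2 / 2).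

Lemma measurable_bump_score : measurable_fun setT bump_score.
Proof.
apply: measurable_funB => //; apply: measurableT_comp => //; apply: measurable_funM => //.
by apply: measurableT_comp => //; exact: measurable_funX.
Qed.

Lemma bump_score01 y : 0 <= bump_score y <= 1.
Proof.
rewrite /bump_score subr_ge0 gerBl expR_ge0 andbT -[leRHS]expR0 ler_expR mulNr.
by rewrite oppr_le0 divr_ge0 ?sqr_ge0.
Qed.

Lemma bump_score_mean m :
  shifted_mean bump_score m = 1 - expR (- m ^+ 2 / 4) / Num.sqrt 2.
Proof.
apply/EFin_inj; rewrite -(shifted_meanE measurable_bump_score bump_score01).
have s20 : 0 < Num.sqrt 2 :> R by rewrite sqrtr_gt0.
have s2n : Num.sqrt 2 != 0 :> R by rewrite gt_eqF.
have me : measurable_fun setT (fun z : R => expR (- (m + z) ^+ 2 / 2)).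
  apply: measurableT_comp => //; apply: measurable_funM => //.
  by apply: measurableT_comp => //; apply: measurable_funX => //; exact: measurable_funD.
have IE : (\int[N01]_z (expR (- (m + z) ^+ 2 / 2))%:E = (expR (- m ^+ 2 / 4) / Num.sqrt 2)%:E)%E.
  rewrite integral_normal_prob_pdf; [|exact/measurable_EFinP|by move=> z; rewrite lee_fin expR_ge0].
  (* Completing the square: (m + z)^2 / 2 + z^2 / 2 = (z + m / 2)^2 + m^2 / 4. *)
  transitivity (\int[mu]_z ((expR (- m ^+ 2 / 4) / Num.sqrt 2)%:E * (normal_pdf (- m / 2) ((Num.sqrt 2)^-1) z)%:E))%E.
    apply: eq_integral => z _; rewrite -!EFinM; congr EFin.
    rewrite !normal_pdfE ?oner_eq0// ?invr_eq0// /normal_fun.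
    have -> : normal_peak (Num.sqrt 2)^-1 = Num.sqrt 2 * normal_peak 1 :> R.
      rewrite /normal_peak expr1n mul1r -mulrnAr sqrtrM ?sqr_ge0// sqrtr_sqr.
      by rewrite ger0_norm ?invr_ge0 ?(ltW s20)// invfM invrK.
    rewrite exprVn sqr_sqrtr//.
    rewrite [RHS](_ : _ = normal_peak 1 * (expR (- m ^+ 2 / 4) * expR (- (z - - m / 2) ^+ 2 / (2^-1 *+ 2)))); last by field.
    by rewrite [LHS]mulrCA -!expRD; congr (_ * expR _); field.
  rewrite ge0_integralZl; [|exact: measurableT|exact: measurable_normal_pdfE
    |by move=> z _; rewrite lee_fin normal_pdf_ge0|by rewrite lee_fin divr_ge0 ?expR_ge0 ?(ltW s20)].
  by rewrite integral_normal_pdf mule1.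
have : (\int[N01]_z (bump_score (m + z) + expR (- (m + z) ^+ 2 / 2))%R%:E = 1)%E.
  by rewrite -[RHS](integral_gauss_cst (R := R)); apply: eq_integral => z _; rewrite subrK.
have mb : measurable_fun setT (fun z : R => bump_score (m + z)).
  by apply: (measurableT_comp measurable_bump_score); exact: measurable_funD.
have b0 z : 0 <= bump_score (m + z) by case/andP: (bump_score01 (m + z)).
rewrite (integral_gauss_realD mb me b0 (fun=> expR_ge0 _)).
by rewrite IE => /(congr1 (fun y => y - (expR (- m ^+ 2 / 4) / Num.sqrt 2)%:E)%E); rewrite addeK// => ->; rewrite EFinB.
Qed.

End ThresholdMean.

(** * A grid of change points in log-odds *)

Section Grid.
Context {R : realType}.

(** By [cusum_gram_sq] the squared correlation is the exponential of minus the distance between the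
    log-odds. *)
Lemma cusum_gram_ge (n : nat) (eta : R) t t' : (0 < t < n)%N -> (0 < t' < n)%N ->
  `|(ln t%:R - ln (n - t)%:R) - (ln t'%:R - ln (n - t')%:R)| <= eta ->
  expR (- eta / 2) <= \sum_(i < n) cusum n t i * cusum n t' i :> R.
Proof.
wlog tt' : t t' / (t <= t')%N.
  move=> H tn t'n; have [tt'|t't] := leqP t t'; first exact: H.
  rewrite distrC => h; have := H _ _ (ltnW t't) t'n tn h.
  by under eq_bigr do rewrite mulrC.
move=> /andP[t0 tn] /andP[t'0 t'n] h.
rewrite -(@ler_pXn2r _ 2%N) ?nnegrE ?expR_ge0 ?cusum_gram_ge0// cusum_gram_sq//.
have r0 k : (0 < k)%N -> 0 < k%:R :> R by rewrite ltr0n.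
have x1 := r0 _ t0; have x2 := r0 _ t'0.
have x3 : 0 < (n - t)%:R :> R by apply: r0; rewrite subn_gt0.
have x4 : 0 < (n - t')%:R :> R by apply: r0; rewrite subn_gt0.
have -> : t%:R * (n - t')%:R / (t'%:R * (n - t)%:R) =
   expR ((ln t%:R - ln (n - t)%:R) - (ln t'%:R - ln (n - t')%:R)) :> R.
  rewrite !expRB !lnK ?posrE//; field.
  by rewrite !gt_eqF.
rewrite expr2 -expRD ler_expR; move: h; rewrite ler_norml => /andP[h _]; lra.
Qed.

(* Two change points are compared through the odds t / (n - t), whose logarithm lies in
   [- ln n, ln n]; one representative is kept for each cell of width eta. *)
Lemma cusum_grid (n : nat) (eta : R) : (1 < n)%N -> 0 < eta ->
  exists ts : seq nat, [/\ (forall t, t \in ts -> (0 < t < n)%N),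
    (size ts)%:R <= 2 * ln n%:R / eta + 1 :> R &
    forall t', (0 < t' < n)%N -> exists2 t, t \in ts &
      expR (- eta / 2) <= \sum_(i < n) cusum n t i * cusum n t' i :> R].
Proof.
move=> n1 eta0; have n0 : (0 < n)%N by exact: ltnW.
pose L t : R := ln t%:R - ln (n - t)%:R.
pose kap t := Num.truncn ((L t + ln n%:R) / eta).
pose K := Num.truncn (2 * ln n%:R / eta).
pose cell k := [seq t <- iota 1 n.-1 | kap t == k].
have cellP t k : (t \in cell k) = [&& kap t == k, 0 < t & t < n]%N.
  by rewrite mem_filter mem_iota add1n prednK.
have lnb t : (0 < t < n)%N -> (0 <= ln t%:R :> R) && (ln t%:R <= ln n%:R :> R).
  move=> /andP[t0 tn]; rewrite ln_ge0 ?ler1n// ler_ln ?posrE ?ltr0n// ler_nat.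
  exact: ltnW.
have Lb t : (0 < t < n)%N -> 0 <= L t + ln n%:R <= 2 * ln n%:R.
  move=> tn; have /andP[t0 tn'] := tn.
  have /lnb/andP[h1 h2] : (0 < n - t < n)%N by rewrite subn_gt0 tn' ltn_subrL t0 n0.
  have /andP[h3 h4] := lnb _ tn.
  by rewrite /L; apply/andP; split; lra.
have kapK t : (0 < t < n)%N -> (kap t <= K)%N.
  move=> /Lb /andP[h1 h2]; by apply: le_truncn; rewrite ler_pM2r ?invr_gt0.
have headP k : cell k != [::] -> head 0%N (cell k) \in cell k.
  by case: (cell k) => //= x l _; rewrite mem_head.
(* Empty cells are filtered out, so the default value of [head] never enters the grid. *)
exists [seq head 0%N (cell k) | k <- iota 0 K.+1 & cell k != [::]]; split.
- move=> t /mapP[k]; rewrite mem_filter => /andP[ck _] ->.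
  by have := headP _ ck; rewrite cellP => /and3P[_ -> ->].
- rewrite size_map; apply: (@le_trans _ _ K.+1%:R).
    rewrite ler_nat; apply: (leq_trans (size_subseq (filter_subseq _ _))).
    by rewrite size_iota.
  by rewrite -addn1 natrD lerD2r truncn_le divr_ge0 ?(ltW eta0)// mulr_ge0// ln_ge0// ler1n.
- move=> t' t'n; have /andP[t'0 t'n'] := t'n.
  have t'c : t' \in cell (kap t') by rewrite cellP eqxx t'0 t'n'.
  have ck : cell (kap t') != [::] by case: (cell (kap t')) t'c.
  exists (head 0%N (cell (kap t'))).
    apply/mapP; exists (kap t') => //; rewrite mem_filter ck mem_iota leq0n add0n ltnS.
    exact: kapK.
  move: (headP _ ck); rewrite cellP; move: (head _ _) => t /and3P[/eqP kk t0 tn].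
  have tn' : (0 < t < n)%N by rewrite t0 tn.
  have /andP[h1 h2] := Lb _ tn'; have /andP[h3 h4] := Lb _ t'n.
  have y0 : 0 <= (L t + ln n%:R) / eta by rewrite divr_ge0// ltW.
  have y'0 : 0 <= (L t' + ln n%:R) / eta by rewrite divr_ge0// ltW.
  have /andP[a1 a2] := truncn_itv y0; have /andP[a3 a4] := truncn_itv y'0.
  rewrite -/(kap t) kk in a1 a2; rewrite -/(kap t') -addn1 natrD in a3 a4.
  rewrite -addn1 natrD in a2.
  have eL u : L u = (L u + ln n%:R) / eta * eta - ln n%:R by rewrite divfK ?gt_eqF// addrK.
  apply: cusum_gram_ge => //.
  rewrite -/(L t) -/(L t') (eL t) (eL t') opprB addrA subrK -mulrBl normrM (gtr0_norm eta0).
  rewrite ler_piMl ?(ltW eta0)// ler_norml; apply/andP; split; lra.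
Qed.

End Grid.

(** * Asymptotics *)

Section NearTools.
Context {R : realType}.
Implicit Types (x y C d : R).

Lemma powR_mul (P x y : R) : 0 < P -> P `^ x * P `^ y = P `^ (x + y).
Proof. by move=> P0; rewrite powRD// (gt_eqF P0) implybT. Qed.

Lemma powR_expR (P x : R) : 0 < P -> P `^ x = expR (x * ln P).
Proof. by move=> P0; rewrite /powR gt_eqF. Qed.

Lemma near_natr_ge C : \forall p \near \oo, C <= p%:R.
Proof.
near=> p; apply: (le_trans (ltW (truncnS_gt C))).
rewrite ler_nat; near: p; exact: nbhs_infty_ge.
Unshelve. all: by end_near. Qed.

Lemma near_ln_ge C : \forall p \near \oo, C <= ln p%:R.
Proof.
near=> p; have h : expR C <= p%:R by near: p; exact: near_natr_ge.
by rewrite -[C]expRK ler_ln ?posrE ?expR_gt0// (lt_le_trans (expR_gt0 C) h).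
Unshelve. all: by end_near. Qed.

(** The device that absorbs constants: any gap between exponents beats any [C]. *)
Lemma near_powR_le x y C : x < y -> \forall p \near \oo, C * p%:R `^ x <= p%:R `^ y.
Proof.
move=> xy; have yx : 0 < y - x by rewrite subr_gt0.
near=> p.
have p1 : 1 <= p%:R :> R by near: p; exact: near_natr_ge.
have p0 : 0 < p%:R :> R by exact: lt_le_trans p1.
have h : `|C| + 1 <= expR ((y - x) * ln p%:R).
  have C1 : 0 < `|C| + 1 by rewrite ltr_wpDl.
  rewrite -[leLHS]lnK ?posrE// ler_expR mulrC -ler_pdivrMr//.
  near: p; exact: near_ln_ge.
rewrite [leRHS](_ : _ = p%:R `^ (y - x) * p%:R `^ x); last by rewrite powR_mul// subrK.
rewrite ler_wpM2r ?powR_ge0// powR_expR//.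
by apply: le_trans h; apply: (le_trans (ler_norm C)); rewrite lerDl.
Unshelve. all: by end_near. Qed.

Lemma near_ln_le_powR d C : 0 < d -> \forall p \near \oo, C * ln p%:R <= p%:R `^ d.
Proof.
move=> d0; near=> p.
have p1 : 1 <= p%:R :> R by near: p; exact: near_natr_ge.
have p0 : 0 < p%:R :> R by exact: lt_le_trans p1.
have l0 : 0 <= ln p%:R :> R by exact: ln_ge0.
have h : 2 * `|C| / d ^+ 2 <= ln p%:R by near: p; exact: near_ln_ge.
rewrite powR_expR//; apply: (@le_trans _ _ ((d * ln p%:R) ^+ 2 / 2)).
  rewrite exprMn [X in _ <= X](_ : _ = (d ^+ 2 * ln p%:R / 2) * ln p%:R); last by ring.
  rewrite ler_wpM2r//; apply: (le_trans (ler_norm C)).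
  rewrite ler_pdivlMr// -ler_pdivrMl ?exprn_gt0//.
  apply: le_trans h; rewrite le_eqVlt; apply/orP; left; apply/eqP.
  by field; rewrite gt_eqF.
have := @expR_ge1Dxn R (d * ln p%:R) 1; rewrite mulr_ge0 ?(ltW d0)// => /(_ isT).
by move=> H; apply: le_trans H; rewrite lerDr.
Unshelve. all: by end_near. Qed.

Lemma near_ratio_powR (u : nat -> R) (c d : R) :
  (fun p : nat => u p / p%:R `^ c) @ \oo --> (1 : R) ->
  \forall p \near \oo, p%:R `^ c / 2 <= u p <= 2 * p%:R `^ c.
Proof.
move=> /cvgrPdist_le /(_ (2^-1)) H; near=> p.
have p1 : 1 <= p%:R :> R by near: p; exact: near_natr_ge.
have p0 : 0 < p%:R :> R by exact: lt_le_trans p1.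
have pc : 0 < p%:R `^ c :> R by exact: powR_gt0.
have : `|1 - u p / p%:R `^ c| <= 2^-1 by near: p; apply: H; lra.
rewrite ler_norml => /andP[h1 h2].
have e : u p = u p / p%:R `^ c * p%:R `^ c by rewrite divfK// gt_eqF.
rewrite e; apply/andP; split.
  by rewrite mulrC ler_wpM2r ?(ltW pc)//; lra.
by rewrite ler_wpM2r ?(ltW pc)//; lra.
Unshelve. all: by end_near. Qed.

Lemma near_loglog (n : nat -> nat) (a d : R) : 0 < a -> 0 < d ->
  (fun p : nat => ln (ln (ln (n p)%:R)) / (a * ln p%:R)) @ \oo --> (1 : R) ->
  \forall p \near \oo, [/\ (1 < n p)%N, p%:R `^ (a - d) <= ln (ln (n p)%:R) &
     ln (ln (n p)%:R) <= p%:R `^ (a + d)].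
Proof.
move=> a0 d0 /cvgrPdist_le H.
(* Relative error allowed on ln ln ln n: [d / a] keeps the exponent within [d], and 1/2 keeps the
   triple logarithm positive. As [ln] vanishes on nonpositive reals, positivity forces ln ln n > 0
   and then n > 1. *)
pose e := Num.min (d / a) (2^-1).
have e0 : 0 < e by rewrite lt_min divr_gt0//=; lra.
near=> p.
have l1 : 1 <= ln p%:R :> R by near: p; exact: near_ln_ge.
have p1 : 1 <= p%:R :> R by near: p; exact: near_natr_ge.
have p0 : 0 < p%:R :> R by exact: lt_le_trans p1.
have al0 : 0 < a * ln p%:R by rewrite mulr_gt0//; exact: lt_le_trans l1.
have : `|1 - ln (ln (ln (n p)%:R)) / (a * ln p%:R)| <= e by near: p; exact: H.
set x := ln (ln (n p)%:R).
rewrite ler_norml => /andP[h1 h2].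
have ed : e * a <= d by rewrite -ler_pdivlMr// ge_min lexx.
have eh : e <= 2^-1 by rewrite ge_min lexx orbT.
have lx : ln x = ln x / (a * ln p%:R) * (a * ln p%:R) by rewrite divfK// gt_eqF.
have lx0 : 0 < ln x by rewrite lx mulr_gt0//; lra.
have x0 : 0 < x.
  by rewrite ltNge; apply/negP => x0; move: lx0; rewrite ln0// ltxx.
have n1 : (1 < n p)%N.
  rewrite ltnNge; apply/negP => n1; move: x0; rewrite /x.
  suff -> : ln (n p)%:R = 0 :> R by rewrite ln0// ltxx.
  by move: n1; case: (n p) => [|[|k]]// _; [rewrite ln0|rewrite ln1].
have eal : e * (a * ln p%:R) <= d * ln p%:R.
  by rewrite mulrA ler_wpM2r// (le_trans _ l1).
have lxl : ln x <= (1 + e) * (a * ln p%:R) by rewrite lx ler_wpM2r ?(ltW al0)//; lra.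
have lxg : (1 - e) * (a * ln p%:R) <= ln x by rewrite lx ler_wpM2r ?(ltW al0)//; lra.
have ex : x = expR (ln x) by rewrite lnK.
by split => //; rewrite powR_expR// ex ler_expR; lra.
Unshelve. all: by end_near. Qed.

End NearTools.

(** * The lower bound along the asymptotic sequences *)

Section LowerAsymptotics.
Context {R : realType} (a beta : R) (n s : nat -> nat) (rho : nat -> R).
Hypothesis a0 : 0 < a.
Hypothesis beta01 : 0 < beta < 1.
Hypothesis hn : (fun p : nat => ln (ln (ln (n p)%:R)) / (a * ln p%:R)) @ \oo --> (1 : R).
Hypothesis hs : (fun p : nat => (s p)%:R / p%:R `^ (1 - beta)) @ \oo --> (1 : R).

Lemma near_s : \forall p \near \oo, [/\ (0 < s p)%N, (s p <= p)%N,
  p%:R `^ (1 - beta) / 2 <= (s p)%:R :> R & (s p)%:R <= 2 * p%:R `^ (1 - beta) :> R].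
Proof.
have /andP[b0 b1] := beta01.
near=> p.
have p1 : 1 <= p%:R :> R by near: p; exact: near_natr_ge.
have p0 : 0 < p%:R :> R by exact: lt_le_trans p1.
have /andP[h1 h2] : (p%:R `^ (1 - beta) / 2 <= (s p)%:R :> R) && ((s p)%:R <= 2 * p%:R `^ (1 - beta)).
  by near: p; exact: near_ratio_powR.
split => //.
- rewrite -(ltr_nat R); apply: lt_le_trans h1.
  by rewrite divr_gt0// powR_gt0.
- rewrite -(ler_nat R); apply: (le_trans h2); rewrite -[leRHS]powRr1 ?(ltW p0)//.
  by near: p; apply: near_powR_le; lra.
Unshelve. all: by end_near. Qed.

Lemma near_blocks : \forall p \near \oo, p%:R `^ beta / 2 <= ((p %/ s p) * 2)%:R :> R.
Proof.
near=> p.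
have p1 : 1 <= p%:R :> R by near: p; exact: near_natr_ge.
have p0 : 0 < p%:R :> R by exact: lt_le_trans p1.
have [s0 sp _ s2] : [/\ (0 < s p)%N, (s p <= p)%N,
  p%:R `^ (1 - beta) / 2 <= (s p)%:R :> R & (s p)%:R <= 2 * p%:R `^ (1 - beta) :> R].
  by near: p; exact: near_s.
(* Rounding p / s down loses a factor of at most 2, which the two signs restore. *)
have h : (p <= p %/ s p * 2 * s p)%N.
  have m0 : (0 < p %/ s p)%N by rewrite divn_gt0.
  rewrite {1}(divn_eq p (s p)); rewrite muln2 -addnn mulnDl leq_add2l.
  by apply: (leq_trans (ltnW (ltn_pmod p s0))); rewrite leq_pmull.
have sr0 : 0 < (s p)%:R :> R by rewrite ltr0n.
have {h}: p%:R <= ((p %/ s p) * 2)%:R * (s p)%:R :> R by rewrite -natrM ler_nat.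
rewrite -ler_pdivrMr//; apply: le_trans.
rewrite ler_pdivlMr// mulrAC ler_pdivrMr//.
apply: (@le_trans _ _ (p%:R `^ beta * (2 * p%:R `^ (1 - beta)))).
  by rewrite ler_wpM2l// powR_ge0.
by rewrite mulrCA powR_mul// subrKC powRr1 ?(ltW p0)// mulrC.
Unshelve. all: by end_near. Qed.

Context (kappa C D : R).
Hypothesis kappa0 : 0 < kappa.
Hypothesis D0 : 0 <= D.
Hypothesis hrho : \forall p \near \oo, 0 <= rho p /\ rho p ^+ 2 <= p%:R `^ D.

(** Exponent of the ratio B = p^d: as s <= p and rho^2 <= p^D, the square of s rho^2 is at most p^(2
    D + 2). *)
Let d := (Num.truncn (2 * D + 3)).+1.

Lemma near_scales (g : R) : 0 < g <= 1 -> \forall p \near \oo,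
  [/\ (1 < p ^ d)%N, (p ^ d <= n p)%N,
   ((s p)%:R * rho p ^+ 2) ^+ 2 <= (p ^ d)%:R :> R &
   C * p%:R `^ (a - kappa) <= g * (ln (ln (n p)%:R) - ln (2 * ln (p ^ d)%:R))].
Proof.
move=> /andP[g0 g1].
(* The first bound leaves a power of p to absorb [C] and 1/g. The second keeps a - de positive, so
   that ln (2 ln B), at most a multiple of ln p, takes at most half of p^(a - de). *)
pose de := Num.min (kappa / 2) (a / 2).
have de0 : 0 < de by rewrite lt_min; apply/andP; split; [move: kappa0; lra|move: a0; lra].
have dek : de <= kappa / 2 by rewrite ge_min lexx.
have dea : de <= a / 2 by rewrite ge_min lexx orbT.
have ade : 0 < a - de by lra.
near=> p.
have p2 : 2 <= p%:R :> R by near: p; exact: near_natr_ge.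
have p0 : 0 < p%:R :> R by exact: lt_le_trans p2.
have p1 : 1 <= p%:R :> R by apply: le_trans p2; lra.
have pn1 : (1 < p)%N by rewrite -(ler_nat R).
have lp : 1 <= ln p%:R :> R by near: p; exact: near_ln_ge.
have [n1 n2 _] : [/\ (1 < n p)%N, p%:R `^ (a - de) <= ln (ln (n p)%:R) &
     ln (ln (n p)%:R) <= p%:R `^ (a + de) :> R].
  by near: p; exact: near_loglog.
have [s0 sp _ _] : [/\ (0 < s p)%N, (s p <= p)%N,
  p%:R `^ (1 - beta) / 2 <= (s p)%:R :> R & (s p)%:R <= 2 * p%:R `^ (1 - beta) :> R].
  by near: p; exact: near_s.
have [r0 rD] : 0 <= rho p /\ rho p ^+ 2 <= p%:R `^ D by near: p.
have lnB : ln (p ^ d)%:R = d%:R * ln p%:R :> R by rewrite natrX lnXn// mulr_natl.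
have hB : (4 * d%:R) * ln p%:R <= p%:R `^ (a - de) by near: p; exact: near_ln_le_powR.
have lnn0 : 0 < ln (n p)%:R :> R by rewrite ln_gt0// ltr1n.
have d1 : 1 <= d%:R :> R by rewrite ler1n.
have dl : 1 <= d%:R * ln p%:R :> R by rewrite -[X in X <= _]mulr1 ler_pM//; lra.
split.
- by rewrite -(expn0 p) ltn_exp2l.
- rewrite -(ler_nat R) -ler_ln ?posrE ?ltr0n ?expn_gt0 ?(ltnW pn1) ?(ltnW n1)//.
  have h : ln (ln (n p)%:R) < ln (n p)%:R :> R by exact: ln_sublinear.
  rewrite lnB; move: hB n2 h dl; rewrite -mulrA; lra.
- apply: (@le_trans _ _ ((p%:R * p%:R `^ D) ^+ 2)).
    have sr : 0 <= (s p)%:R * rho p ^+ 2 by rewrite mulr_ge0 ?sqr_ge0.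
    rewrite !expr2; apply: ler_pM => //; apply: ler_pM; rewrite -?expr2 ?sqr_ge0 ?ler_nat//.
  rewrite -{1}(powRr1 (ltW p0)) powR_mul// -powR_mulrn ?powR_ge0// -powRrM natrX -powR_mulrn ?(ltW p0)//.
  rewrite ler_powR//; apply: (@le_trans _ _ (2 * D + 3)); first lra.
  exact: ltW (truncnS_gt _).
have hC : (2 * C / g) * p%:R `^ (a - kappa) <= p%:R `^ (a - de).
  by near: p; apply: near_powR_le; lra.
rewrite lnB.
have h : ln (2 * (d%:R * ln p%:R)) < 2 * (d%:R * ln p%:R) :> R.
  by apply: ln_sublinear; lra.
have -> : C * p%:R `^ (a - kappa) = g * (C / g * p%:R `^ (a - kappa)) by field; rewrite gt_eqF.
rewrite ler_wpM2l ?(ltW g0)//.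
have e : 2 * C / g * p%:R `^ (a - kappa) = 2 * (C / g * p%:R `^ (a - kappa)) by field; rewrite gt_eqF.
rewrite e in hC; rewrite -mulrA in hB; lra.
Unshelve. all: by end_near. Qed.

Lemma near_risk_ge (g : R) : 0 < g <= 1 ->
  (\forall p \near \oo, exists2 y,
    (1 + (p %/ s p * 2)%:R `^ (- g) * expR (g * (1 + g) * rho p ^+ 2 / 2)) ^+ s p <= expR y &
    y <= C * p%:R `^ (a - kappa)) ->
  \forall p \near \oo, ((12 `^ (- g^-1) / 2)%:E <= risk_2side p (n p) (rho p) (s p))%E.
Proof.
move=> g01 HV; near=> p.
have [s0 sp _ _] : [/\ (0 < s p)%N, (s p <= p)%N,
  p%:R `^ (1 - beta) / 2 <= (s p)%:R :> R & (s p)%:R <= 2 * p%:R `^ (1 - beta) :> R].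
  by near: p; exact: near_s.
have [r0 _] : 0 <= rho p /\ rho p ^+ 2 <= p%:R `^ D by near: p.
have [B1 Bn sB CB] : [/\ (1 < p ^ d)%N, (p ^ d <= n p)%N,
   ((s p)%:R * rho p ^+ 2) ^+ 2 <= (p ^ d)%:R :> R &
   C * p%:R `^ (a - kappa) <= g * (ln (ln (n p)%:R) - ln (2 * ln (p ^ d)%:R))].
  by near: p; exact: near_scales.
have [y Vy yC] : exists2 y,
    (1 + (p %/ s p * 2)%:R `^ (- g) * expR (g * (1 + g) * rho p ^+ 2 / 2)) ^+ s p <= expR y &
    y <= C * p%:R `^ (a - kappa) by near: p.
exact: (risk_ge_geometric s0 sp B1 Bn r0 sB g01 Vy (le_trans yC CB)).
Unshelve. all: by end_near. Qed.

Lemma near_risk_ge2 :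
  (\forall p \near \oo, exists2 y,
    (1 + ((expR (rho p ^+ 2) + expR (- rho p ^+ 2)) / 2 - 1) / (p %/ s p)%:R) ^+ s p <= expR y &
    y <= C * p%:R `^ (a - kappa)) ->
  \forall p \near \oo, ((12^-1 / 2)%:E <= risk_2side p (n p) (rho p) (s p))%E.
Proof.
move=> HV; near=> p.
have [s0 sp _ _] : [/\ (0 < s p)%N, (s p <= p)%N,
  p%:R `^ (1 - beta) / 2 <= (s p)%:R :> R & (s p)%:R <= 2 * p%:R `^ (1 - beta) :> R].
  by near: p; exact: near_s.
have [r0 _] : 0 <= rho p /\ rho p ^+ 2 <= p%:R `^ D by near: p.
have [B1 Bn sB CB] : [/\ (1 < p ^ d)%N, (p ^ d <= n p)%N,
   ((s p)%:R * rho p ^+ 2) ^+ 2 <= (p ^ d)%:R :> R &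
   C * p%:R `^ (a - kappa) <= 1 * (ln (ln (n p)%:R) - ln (2 * ln (p ^ d)%:R))].
  by near: p; apply: near_scales; rewrite ltr01 lexx.
rewrite mul1r in CB.
have [y Vy yC] : exists2 y,
    (1 + ((expR (rho p ^+ 2) + expR (- rho p ^+ 2)) / 2 - 1) / (p %/ s p)%:R) ^+ s p <= expR y &
    y <= C * p%:R `^ (a - kappa) by near: p.
exact: (risk_ge_geometric2 s0 sp B1 Bn r0 sB Vy (le_trans yC CB)).
Unshelve. all: by end_near. Qed.

End LowerAsymptotics.

(** * The boundary energy and its sparse exponent *)

Section RhoStar.
Context {R : realType}.
Implicit Types (a b : R).

Lemma rho_star_sq_ge0 a b (p : nat) : 1 <= p%:R :> R -> 0 <= rho_star_sq a b p.
Proof.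
move=> p1; rewrite /rho_star_sq; case: ifPn => h1; first exact: powR_ge0.
case: ifPn => h2; first by rewrite mulr_ge0 ?ln_ge0//; move: h1; rewrite -ltNge; lra.
case: ifPn => h3; last exact: powR_ge0.
by apply: mulr_ge0; [apply: mulr_ge0; [|exact: sqr_ge0]|exact: ln_ge0].
Qed.

Lemma sqr_rho_star a b (p : nat) : 1 <= p%:R :> R ->
  rho_star a b p ^+ 2 = rho_star_sq a b p.
Proof. by move=> p1; rewrite sqr_sqrtr// rho_star_sq_ge0. Qed.

Lemma rho_star_ge0 a b (p : nat) : 0 <= rho_star a b p.
Proof. exact: sqrtr_ge0. Qed.

(* The witness [g] is the stationary point (b / r - 1) / 2 of the exponent, i.e. the order of
   the moment giving the best lower bound. *)
Lemma sparse_exponent a b : 0 < b -> 1 - 4 * b / 3 < a -> a < 1 - b ->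
  let r := (Num.sqrt (1 - a) - Num.sqrt (1 - a - b)) ^+ 2 in
  exists g, [/\ 0 < g <= 1, 0 < r & 1 - b * (1 + g) + g * (1 + g) * r = a].
Proof.
move=> b0 ha1 ha2 r.
set u := Num.sqrt (1 - a) in r *; set v := Num.sqrt (1 - a - b) in r *.
have u2 : u ^+ 2 = 1 - a by rewrite sqr_sqrtr//; lra.
have v2 : v ^+ 2 = 1 - a - b by rewrite sqr_sqrtr//; lra.
have v0 : 0 < v by rewrite sqrtr_gt0; lra.
have u0 : 0 < u by rewrite sqrtr_gt0; lra.
have bE : b = (u - v) * (u + v) by rewrite -subr_sqr u2 v2; lra.
have uv : v < u by rewrite -(@ltr_pXn2r _ 2%N) ?nnegrE ?(ltW u0) ?(ltW v0)// u2 v2; lra.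
have d0 : 0 < u - v by lra.
have r0 : 0 < r by rewrite exprn_gt0.
have un2v : 2 * v <= u.
  rewrite -(@ler_pXn2r _ 2%N) ?nnegrE ?(ltW u0) ?mulr_ge0 ?(ltW v0)// exprMn u2 v2.
  lra.
(* As b = (u - v) (u + v) and r = (u - v)^2, this is the stationary point. It is at most 1 because 2
   v <= u, a form of 1 - 4 b / 3 <= a, and positive because a < 1 - b. *)
exists (v / (u - v)); split => //.
- rewrite divr_gt0//= ler_pdivrMr// mul1r; lra.
- have -> : a = 1 - u ^+ 2 by rewrite u2; lra.
  rewrite {1}bE /r; field; rewrite gt_eqF//.
Qed.

Lemma exp_block_le (g x : R) (k : nat) : 0 <= x -> (1 + x) ^+ k <= expR (k%:R * x).
Proof.
move=> x0; rewrite expRM_natl; apply: lerXn2r; rewrite ?nnegrE ?expR_ge0 ?addr_ge0//.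
exact: expR_ge1Dx.
Qed.

End RhoStar.

(** * Lower bound, regime by regime *)

Section LowerRegimes.
Context {R : realType} (a beta b1 : R) (n s : nat -> nat).
Hypothesis a0 : 0 < a.
Hypothesis b1beta : b1 < beta.
Hypothesis b10 : 0 < b1.
Hypothesis beta01 : 0 < beta < 1.
Hypothesis hn : (fun p : nat => ln (ln (ln (n p)%:R)) / (a * ln p%:R)) @ \oo --> (1 : R).
Hypothesis hs : (fun p : nat => (s p)%:R / p%:R `^ (1 - beta)) @ \oo --> (1 : R).
Let rho (p : nat) := rho_star a b1 p.

(** With s of order p^(1 - beta) and blocks of order p^beta, the log-moment has exponent 1 - beta (1
    + g) + g (1 + g) r. At [b1] it is at most a, and passing to beta gains (beta - b1) (1 + g), at
    least beta - b1. *)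
Lemma lower_moment_regime (g r : R) : 0 < g <= 1 -> 0 <= r ->
  1 - b1 * (1 + g) + g * (1 + g) * r <= a ->
  (\forall p \near \oo, rho p ^+ 2 = 2 * r * ln p%:R) ->
  \forall p \near \oo, ((12 `^ (- g^-1) / 2)%:E <= risk_2side p (n p) (rho p) (s p))%E.
Proof.
have bb := b1beta; have b1p := b10; have ap := a0; have /andP[bp bq] := beta01.
move=> g01 r0 gr hr; have /andP[g0 g1] := g01.
apply: (near_risk_ge (kappa := beta - b1) (C := 4) (D := 1) a0 beta01 hn hs) => //; first lra.
  near=> p; split; first exact: sqrtr_ge0.
  have -> : rho p ^+ 2 = 2 * r * ln p%:R by near: p.
  by near: p; exact: near_ln_le_powR.
near=> p.
have p1 : 1 <= p%:R :> R by near: p; exact: near_natr_ge.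
have p0 : 0 < p%:R :> R by exact: lt_le_trans p1.
have [s0 sp _ s2] : [/\ (0 < s p)%N, (s p <= p)%N,
  p%:R `^ (1 - beta) / 2 <= (s p)%:R :> R & (s p)%:R <= 2 * p%:R `^ (1 - beta)].
  by near: p; exact: near_s.
have mb : p%:R `^ beta / 2 <= ((p %/ s p) * 2)%:R :> R.
  by near: p; exact: near_blocks.
set m2 : R := ((p %/ s p) * 2)%:R.
set x := m2 `^ (- g) * expR _.
have x0 : 0 <= x by rewrite mulr_ge0 ?powR_ge0 ?expR_ge0.
exists ((s p)%:R * x); first exact: exp_block_le.
have rp : rho p ^+ 2 = 2 * r * ln p%:R by near: p.
have xE : expR (g * (1 + g) * rho p ^+ 2 / 2) = p%:R `^ (g * (1 + g) * r).
  by rewrite powR_expR// rp; congr expR; field.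
have pb0 : 0 < p%:R `^ beta :> R by exact: powR_gt0.
have mg : m2 `^ (- g) <= 2 * p%:R `^ (- (beta * g)).
  rewrite powRN; apply: (@le_trans _ _ (((p%:R `^ beta / 2) `^ g)^-1)).
    rewrite lef_pV2 ?posrE ?powR_gt0 ?divr_gt0//; last first.
      by apply: lt_le_trans mb; rewrite divr_gt0.
    by apply: ge0_ler_powR; rewrite ?nnegrE ?divr_ge0 ?(ltW g0) ?(ltW pb0).
  rewrite powRM ?(ltW pb0)// invfM mulrC -powRrM powRN ler_wpM2r ?invr_ge0 ?powR_ge0//.
  rewrite -powRN -powR_inv1// -powRrM mulN1r opprK -[leRHS]powRr1// ler_powR//; lra.
rewrite /x xE; apply: (@le_trans _ _ (2 * p%:R `^ (1 - beta) * (2 * p%:R `^ (- (beta * g)) * p%:R `^ (g * (1 + g) * r)))).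
  apply: ler_pM => //; first by rewrite mulr_ge0 ?powR_ge0.
  by rewrite ler_wpM2r// powR_ge0.
rewrite (_ : _ * _ = 4 * (p%:R `^ (1 - beta) * (p%:R `^ (- (beta * g)) * p%:R `^ (g * (1 + g) * r)))); last by ring.
rewrite ler_wpM2l// !powR_mul// ler_powR//.
have : (beta - b1) * g >= 0 by rewrite mulr_ge0 ?(ltW g0)//; lra.
lra.
Unshelve. all: by end_near. Qed.

(** With g = 1 the gain (2 m)^(-1) from the hidden position is given away: 1 + e^(rho^2) <= e^(rho^2
    + 1), and only the total energy counts. *)
Lemma lower_dense_sum_regime (kappa C D : R) : 0 < kappa -> 0 <= D ->
  (\forall p \near \oo, rho p ^+ 2 <= p%:R `^ D) ->
  (\forall p \near \oo, (s p)%:R * (rho p ^+ 2 + 1) <= C * p%:R `^ (a - kappa)) ->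
  \forall p \near \oo, ((12 `^ (- 1^-1) / 2)%:E <= risk_2side p (n p) (rho p) (s p))%E.
Proof.
have bb := b1beta; have b1p := b10; have ap := a0; have /andP[bp bq] := beta01.
move=> k0 D0 hD hS.
apply: (near_risk_ge (kappa := kappa) (C := C) (D := D) a0 beta01 hn hs) => //.
- by near=> p; split; [exact: sqrtr_ge0|near: p].
- by rewrite ltr01 lexx.
near=> p.
have [s0 sp _ _] : [/\ (0 < s p)%N, (s p <= p)%N,
  p%:R `^ (1 - beta) / 2 <= (s p)%:R :> R & (s p)%:R <= 2 * p%:R `^ (1 - beta)].
  by near: p; exact: near_s.
exists ((s p)%:R * (rho p ^+ 2 + 1)); last by near: p.
rewrite expRM_natl; apply: lerXn2r; rewrite ?nnegrE ?expR_ge0 ?addr_ge0 ?mulr_ge0 ?powR_ge0 ?expR_ge0//.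
set E := expR (rho p ^+ 2).
have E1 : 1 <= E by rewrite -[leLHS]expR0 ler_expR sqr_ge0.
have -> : expR (1 * (1 + 1) * rho p ^+ 2 / 2) = E by congr expR; field.
have m1 : ((p %/ s p) * 2)%:R `^ (-1) <= 1 :> R.
  rewrite powRN powRr1// invf_le1 ?ler1n ?ltr0n muln_gt0 divn_gt0// sp//.
rewrite expRD -/E; apply: (@le_trans _ _ (E + 1 * E)).
  by apply: lerD => //; rewrite ler_wpM2r ?expR_ge0.
have : 2 <= expR 1 :> R by have := @expR_ge1Dx R 1.
by move=> e2; rewrite mul1r -mulr2n -mulr_natr ler_wpM2l// expR_ge0.
Unshelve. all: by end_near. Qed.

(** Here rho <= 1 and cosh z - 1 <= 2 z^2 at z = rho^2. The exponent of s z^2 / m is (1 - beta) -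
    beta + a - (1 - 2 b1) = a - 2 (beta - b1). *)
Lemma lower_quadratic_regime : a <= 1 - 2 * b1 ->
  \forall p \near \oo, ((12^-1 / 2)%:E <= risk_2side p (n p) (rho p) (s p))%E.
Proof.
have bb := b1beta; have b1p := b10; have ap := a0; have /andP[bp bq] := beta01.
move=> ha.
have rE (p : nat) : 1 <= p%:R :> R -> rho p ^+ 2 = p%:R `^ ((a - (1 - 2 * b1)) / 2).
  by move=> p1; rewrite sqr_rho_star// /rho_star_sq ha.
have rle1 (p : nat) : 1 <= p%:R :> R -> rho p ^+ 2 <= 1.
  by move=> p1; rewrite rE// -[leRHS](powRr0 p%:R) ler_powR//; lra.
apply: (near_risk_ge2 (kappa := beta - b1) (C := 16) (D := 0) a0 beta01 hn hs) => //; first lra.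
  near=> p; split; first exact: sqrtr_ge0.
  rewrite powRr0 rle1//; near: p; exact: near_natr_ge.
near=> p.
have p1 : 1 <= p%:R :> R by near: p; exact: near_natr_ge.
have p0 : 0 < p%:R :> R by exact: lt_le_trans p1.
have [s0 sp _ s2] : [/\ (0 < s p)%N, (s p <= p)%N,
  p%:R `^ (1 - beta) / 2 <= (s p)%:R :> R & (s p)%:R <= 2 * p%:R `^ (1 - beta)].
  by near: p; exact: near_s.
have mb : p%:R `^ beta / 2 <= ((p %/ s p) * 2)%:R :> R.
  by near: p; exact: near_blocks.
set m : R := (p %/ s p)%:R.
have m0 : 0 < m by rewrite ltr0n divn_gt0.
have mb4 : p%:R `^ beta / 4 <= m by move: mb; rewrite natrM -/m; lra.
set z := rho p ^+ 2.
have z0 : 0 <= z by rewrite sqr_ge0.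
have z1 : z <= 1 by exact: rle1.
have q1 := expR_le_quad z1.
have q2 : expR (- z) <= 1 - z + 2 * z ^+ 2 by rewrite -[X in 2 * X]sqrrN; apply: expR_le_quad; lra.
have q3 : 0 <= (expR z + expR (- z)) / 2 - 1.
  have := @expR_ge1Dx R z; have := @expR_ge1Dx R (- z); lra.
exists ((s p)%:R * (2 * z ^+ 2 / m)).
  apply: (@le_trans _ _ (expR ((s p)%:R * (((expR z + expR (- z)) / 2 - 1) / m)))).
    by apply: exp_block_le => //; rewrite divr_ge0// ltW.
  rewrite ler_expR ler_wpM2l// ler_wpM2r ?invr_ge0 ?(ltW m0)//; lra.
have zz : z ^+ 2 = p%:R `^ (a - (1 - 2 * b1)).
  by rewrite /z rE// -powR_mulrn ?powR_ge0// -powRrM divfK.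
have pb0 : 0 < p%:R `^ beta :> R by exact: powR_gt0.
have mi : m^-1 <= 4 * p%:R `^ (- beta).
  rewrite powRN -invf_div lef_pV2 ?posrE//.
  by rewrite divr_gt0.
rewrite zz; apply: (@le_trans _ _ (2 * p%:R `^ (1 - beta) * (2 * p%:R `^ (a - (1 - 2 * b1)) * (4 * p%:R `^ (- beta))))).
  apply: ler_pM => //; first by rewrite !mulr_ge0 ?powR_ge0// invr_ge0 ltW.
  by rewrite ler_wpM2l// mulr_ge0// powR_ge0.
rewrite (_ : _ * _ = 16 * (p%:R `^ (1 - beta) * (p%:R `^ (a - (1 - 2 * b1)) * p%:R `^ (- beta)))); last by ring.
by rewrite ler_wpM2l// !powR_mul// ler_powR//; lra.
Unshelve. all: by end_near. Qed.

Lemma lower_risk : exists2 c : R, 0 < c &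
  \forall p \near \oo, (c%:E <= risk_2side p (n p) (rho p) (s p))%E.
Proof.
have bb := b1beta; have b1p := b10; have ap := a0; have /andP[bp bq] := beta01.
have c0 (g : R) : 0 < 12 `^ (- g^-1) / 2 :> R by rewrite divr_gt0// powR_gt0.
have [h1|h1] := leP a (1 - 2 * b1).
  by exists (12^-1 / 2); [lra|exact: lower_quadratic_regime].
have [h2|h2] := leP a (1 - 4 * b1 / 3).
  exists (12 `^ (- 1^-1) / 2) => //.
  apply: (@lower_moment_regime 1 ((a - (1 - 2 * b1)) / 2)); [by rewrite ltr01 lexx|lra|lra|].
  near=> p; rewrite /rho sqr_rho_star; last by near: p; exact: near_natr_ge.
  by rewrite /rho_star_sq leNgt h1 /= h2; field.
have [h3|h3] := ltP a (1 - b1).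
  have [g [g01 r0 gE]] := sparse_exponent b10 h2 h3.
  exists (12 `^ (- g^-1) / 2) => //.
  apply: (lower_moment_regime g01 (ltW r0)); first by rewrite gE.
  near=> p; rewrite /rho sqr_rho_star; last by near: p; exact: near_natr_ge.
  by rewrite /rho_star_sq leNgt h1 /= leNgt h2 /= (ltW h3).
have hP := @near_s R beta s beta01 hs.
exists (12 `^ (- 1^-1) / 2) => //.
move: h3; rewrite le_eqVlt => /orP[/eqP h3|h3].
  (* At a = 1 - b1 the stationary order of [sparse_exponent] degenerates to 0. The energy per row is
     logarithmic there, so the total, p^(1 - beta) up to a logarithm, is already below p^a. *)
  have rE (p : nat) : 1 <= p%:R :> R -> rho p ^+ 2 = 2 * b1 * ln p%:R.
    move=> p1; rewrite /rho sqr_rho_star// /rho_star_sq leNgt h1 /= leNgt h2 /= -h3 lexx.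
    have -> : 1 - (1 - b1) - b1 = 0 by ring.
    by rewrite sqrtr0 subr0 sqr_sqrtr; lra.
  apply: (@lower_dense_sum_regime ((beta - b1) / 2) 2 1) => //; first lra.
    near=> p; rewrite rE; first by near: p; exact: near_ln_le_powR.
    by near: p; exact: near_natr_ge.
  near=> p.
  have p1 : 1 <= p%:R :> R by near: p; exact: near_natr_ge.
  have p0 : 0 < p%:R :> R by exact: lt_le_trans p1.
  have [s0 sp _ s2] : [/\ (0 < s p)%N, (s p <= p)%N,
    p%:R `^ (1 - beta) / 2 <= (s p)%:R :> R & (s p)%:R <= 2 * p%:R `^ (1 - beta)] by near: p.
  rewrite rE//; apply: (@le_trans _ _ (2 * p%:R `^ (1 - beta) * p%:R `^ ((beta - b1) / 2))).
    apply: ler_pM => //; first by rewrite addr_ge0// !mulr_ge0 ?ln_ge0// ltW.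
    apply: (@le_trans _ _ ((2 * b1 + 1) * ln p%:R)).
      have : 1 <= ln p%:R :> R by near: p; exact: near_ln_ge.
      lra.
    by near: p; apply: near_ln_le_powR; lra.
  by rewrite -mulrA powR_mul// ler_wpM2l// ler_powR// -h3; lra.
have rE (p : nat) : 1 <= p%:R :> R -> rho p ^+ 2 = p%:R `^ (a - (1 - b1)).
  move=> p1; rewrite /rho sqr_rho_star// /rho_star_sq leNgt h1 /= leNgt h2 /= leNgt h3 //.
apply: (@lower_dense_sum_regime (beta - b1) 4 (a - (1 - b1))) => //; [lra|lra| |].
  by near=> p; rewrite rE//; near: p; exact: near_natr_ge.
near=> p.
have p1 : 1 <= p%:R :> R by near: p; exact: near_natr_ge.
have p0 : 0 < p%:R :> R by exact: lt_le_trans p1.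
have [s0 sp _ s2] : [/\ (0 < s p)%N, (s p <= p)%N,
  p%:R `^ (1 - beta) / 2 <= (s p)%:R :> R & (s p)%:R <= 2 * p%:R `^ (1 - beta)] by near: p.
rewrite rE//; apply: (@le_trans _ _ (2 * p%:R `^ (1 - beta) * (2 * p%:R `^ (a - (1 - b1))))).
  apply: ler_pM => //.
  have : 1 <= p%:R `^ (a - (1 - b1)) :> R by rewrite -[leLHS](powRr0 p%:R) ler_powR//; lra.
  lra.
rewrite mulrACA powR_mul// (_ : 2 * 2 = 4 :> R); last by lra.
by rewrite ler_wpM2l// ler_powR//; lra.
Unshelve. all: by end_near. Qed.

End LowerRegimes.

(** * Risk of the scan test at fixed dimensions *)

Section UpperFinite.
Context {R : realType}.

Lemma risk_le_grid (p n s : nat) (g : R -> R) (rho eta om l1 l2 x0 E1 E2 : R) :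
  (1 < n)%N -> 0 < eta -> 0 <= rho ->
  measurable_fun setT g -> (forall x, 0 <= g x <= 1) ->
  0 <= om -> 0 <= l1 -> 0 <= l2 ->
  (forall m, shifted_mean g 0 <= shifted_mean g m) ->
  (forall m, expR (- eta / 2) * rho <= `|m| -> shifted_mean g 0 + om <= shifted_mean g m) ->
  - (l1 * x0) + (expR l1 - 1) * (p%:R * shifted_mean g 0) <= E1 ->
  l2 * x0 + (expR (- l2) - 1) * (p%:R * shifted_mean g 0 + s%:R * om) <= E2 ->
  (risk_2side p n rho s <= ((2 * ln n%:R / eta + 1) * expR E1 + expR E2)%:E)%E.
Proof.
move=> n1 eta0 rho0 mg g01 om0 l10 l20 qmin qom hE1 hE2.
have [ts [tsn tsz cover]] := @cusum_grid R n eta n1 eta0.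
have := @risk_le R p n g mg g01 s rho (expR (- eta / 2)) om l1 l2 ts tsn cover
  (expR_ge0 _) rho0 om0 l10 l20 qmin qom x0.
move=> /le_trans; apply; rewrite lee_fin; apply: lerD; last by rewrite ler_expR.
by apply: ler_pM; rewrite ?expR_ge0// ler_expR.
Qed.

(* The tilt w / (16 (A + w)) balances the linear gain against the quadratic loss. *)
Lemma risk_le_moderate (p n s : nat) (g : R -> R) (rho eta om H : R) :
  (1 < n)%N -> 0 < eta -> 0 <= rho ->
  measurable_fun setT g -> (forall x, 0 <= g x <= 1) -> 0 <= om ->
  (forall m, shifted_mean g 0 <= shifted_mean g m) ->
  (forall m, expR (- eta / 2) * rho <= `|m| -> shifted_mean g 0 + om <= shifted_mean g m) ->
  0 < H -> H <= s%:R * om ->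
  H * (p%:R * shifted_mean g 0) <= (s%:R * om) ^+ 2 ->
  (risk_2side p n rho s <= ((2 * ln n%:R / eta + 1) * expR (- (H / 128)) + expR (- (H / 128)))%:E)%E.
Proof.
move=> n1 eta0 rho0 mg g01 om0 qmin qom H0 Hw HA.
set w := s%:R * om in Hw HA *; set A := p%:R * shifted_mean g 0 in HA *.
have w0 : 0 < w by exact: lt_le_trans Hw.
have A0 : 0 <= A.
  rewrite mulr_ge0// fine_ge0//; apply: integral_ge0 => z _.
  by rewrite lee_fin; case/andP: (g01 (0 + z)).
have Aw : 0 < A + w by exact: ltr_wpDl.
pose l := w / (16 * (A + w)).
have l0 : 0 <= l by apply: divr_ge0; [exact: ltW|apply: mulr_ge0 => //; exact: ltW].
have l1 : l <= 1 / 16.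
  by rewrite ler_pdivrMr ?mulr_gt0//; lra.
have lA : 16 * (l * (A + w)) = w by rewrite /l; field; rewrite gt_eqF.
(* Adding H w <= w^2 and H A <= w^2 gives w^2 / (A + w) >= H / 2. *)
have lw : H / 32 <= l * w.
  rewrite /l mulrAC ler_pdivlMr ?mulr_gt0//.
  have Hww : H * w <= w * w by rewrite ler_wpM2r ?(ltW w0).
  rewrite expr2 in HA; rewrite [X in X <= _](_ : _ = (H * A + H * w) / 2); last by field.
  lra.
have q2 : l ^+ 2 * (A + w) = l * w / 16.
  by rewrite -[in RHS]lA; field.
have q2A : l ^+ 2 * A <= l * w / 16.
  by rewrite -q2 ler_wpM2l ?sqr_ge0// lerDl ltW.
(* The threshold is halfway between the null mean A and the lower bound A + w on the alternative
   mean. *)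
apply: (@risk_le_grid _ _ _ g rho eta om l l (A + w / 2)) => //; rewrite -/w -/A.
- have le1 : expR l <= 1 + l + 2 * l ^+ 2 by apply: expR_le_quad; lra.
  have : (expR l - 1) * A <= (l + 2 * l ^+ 2) * A by rewrite ler_wpM2r//; lra.
  have -> : - (l * (A + w / 2)) = - (l * A) - l * w / 2 by field.
  rewrite [X in _ <= X -> _](_ : _ = l * A + 2 * (l ^+ 2 * A)); last by ring.
  lra.
have le1 : expR (- l) <= 1 + (- l) + 2 * (- l) ^+ 2 by apply: expR_le_quad; lra.
rewrite sqrrN in le1.
have : (expR (- l) - 1) * (A + w) <= (- l + 2 * l ^+ 2) * (A + w) by rewrite ler_wpM2r ?(ltW Aw)//; lra.
have -> : l * (A + w / 2) = l * (A + w) - l * w / 2 by field.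
rewrite [X in _ <= X -> _](_ : _ = - (l * (A + w)) + 2 * (l ^+ 2 * (A + w))); last by ring.
rewrite q2; lra.
Qed.

(** The point is to inhabit the alternative, since a supremum over the empty set is -oo. A signal
    with one-row blocks and change point 1 does it. *)
Lemma risk_2side_ge0 (p n s : nat) (rho : R) : (1 < n)%N -> (s <= p)%N -> 0 <= rho ->
  (0 <= risk_2side p n rho s)%E.
Proof.
move=> n1 sp rho0.
have tb (k : 'I_1) : (0 < (fun=> 1%N) k < n)%N by [].
have sp1 : (s * 1 <= p)%N by rewrite muln1.
pose f : {ffun 'I_s -> 'I_1 * bool} := [ffun=> (ord0, true)].
have th := block_sum_signal_alt tb sp1 rho0 ord0 f.
apply: le_ereal_inf_tmp => _ [psi mpsi <-]; apply: adde_ge0.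
  apply: le_ereal_sup_tmp; eexists; last exact: (@gauss_expect_ge0 R p n 0 (fun x => (psi x)%:R)).
  by exists 0 => // j i i'; rewrite !mxE.
have hps x : 0 <= 1 - (psi x)%:R :> R by case: (psi x); rewrite /= ?subrr ?subr0.
apply: le_ereal_sup_tmp.
exists (gauss_expect (block_sum (row_signal n (fun=> 1%N) rho sp1 (ord0 : 'I_1)) f) (fun x => 1 - (psi x)%:R)).
  by eexists; first exact: th.
exact: gauss_expect_ge0 hps.
Qed.

End UpperFinite.

(** * Vanishing risk, and the regime of small energy *)

Section UpperAsymptotics.
Context {R : realType} (a beta b1 : R) (n s : nat -> nat).
Hypothesis a0 : 0 < a.
Hypothesis b1beta : beta < b1.
Hypothesis b11 : b1 < 1.
Hypothesis beta01 : 0 < beta < 1.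
Hypothesis hn : (fun p : nat => ln (ln (ln (n p)%:R)) / (a * ln p%:R)) @ \oo --> (1 : R).
Hypothesis hs : (fun p : nat => (s p)%:R / p%:R `^ (1 - beta)) @ \oo --> (1 : R).
Let rho (p : nat) := rho_star a b1 p.

Lemma near_expRN_le (c d eps : R) : 0 < c -> 0 < d -> 0 < eps ->
  \forall p \near \oo, expR (1 - c * p%:R `^ d) <= eps.
Proof.
move=> c0 d0 e0; near=> p.
have h : (1 - ln eps) / c * p%:R `^ 0 <= p%:R `^ d by near: p; exact: near_powR_le.
rewrite -[leRHS]lnK ?posrE// ler_expR.
move: h; rewrite powRr0 mulr1 ler_pdivrMr// mulrC; lra.
Unshelve. all: by end_near. Qed.

(** The grid has O(ln n) points with ln n = exp(p^(a + o(1))), so false alarms require an exponent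
    above a, whereas a miss involves no union and any positive [d'] will do. The constant 1 leaves
    room for a bounded null contribution. *)
Lemma near_risk_small (eta c d d' eps : R) : 0 < eta -> 0 < c -> 0 < d -> 0 < d' ->
  (\forall p \near \oo, (risk_2side p (n p) (rho p) (s p) <=
     ((2 * ln (n p)%:R / eta + 1) * expR (1 - c * p%:R `^ (a + d)) +
      expR (1 - c * p%:R `^ d'))%:E)%E) ->
  0 < eps -> \forall p \near \oo, (risk_2side p (n p) (rho p) (s p) <= eps%:E)%E.
Proof.
move=> eta0 c0 d0 d'0 H eps0; have ap := a0.
pose C := 2 / eta + 1.
have C0 : 0 < C by rewrite ltr_wpDl// divr_ge0// ltW.
near=> p.
have h : (risk_2side p (n p) (rho p) (s p) <=
     ((2 * ln (n p)%:R / eta + 1) * expR (1 - c * p%:R `^ (a + d)) +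
      expR (1 - c * p%:R `^ d'))%:E)%E by near: p.
apply: (le_trans h); rewrite lee_fin.
have p1 : 1 <= p%:R :> R by near: p; exact: near_natr_ge.
have p0 : 0 < p%:R :> R by exact: lt_le_trans p1.
have [n1 _ n2] : [/\ (1 < n p)%N, p%:R `^ (a - d / 2) <= ln (ln (n p)%:R) &
     ln (ln (n p)%:R) <= p%:R `^ (a + d / 2) :> R].
  by near: p; apply: near_loglog => //; rewrite divr_gt0.
have ln0 : 0 < ln (n p)%:R :> R by rewrite ln_gt0// ltr1n.
have e1 : expR (1 - c * p%:R `^ d') <= eps / 2.
  by near: p; apply: near_expRN_le => //; rewrite divr_gt0.
have e2 : expR (1 - (c / 2) * p%:R `^ (a + d)) <= eps / 2 / C.
  near: p; apply: near_expRN_le; [by apply: divr_gt0|exact: addr_gt0|].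
  by apply: divr_gt0 => //; exact: divr_gt0.
have lnb : 2 * ln (n p)%:R / eta + 1 <= C * expR (p%:R `^ (a + d / 2)).
  have ee : ln (n p)%:R <= expR (p%:R `^ (a + d / 2)) :> R.
    by rewrite -[leLHS]lnK ?posrE// ler_expR.
  have e1' : 1 <= expR (p%:R `^ (a + d / 2)) by rewrite -[leLHS]expR0 ler_expR powR_ge0.
  rewrite /C [leRHS]mulrDl [1 * _]mul1r; apply: lerD => //.
  by rewrite [X in X <= _]mulrAC ler_wpM2l// divr_ge0// ltW.
have gap : 2 / c * p%:R `^ (a + d / 2) <= p%:R `^ (a + d).
  by near: p; apply: near_powR_le; lra.
have gap' : p%:R `^ (a + d / 2) <= c / 2 * p%:R `^ (a + d).
  rewrite [leLHS](_ : _ = c / 2 * (2 / c * p%:R `^ (a + d / 2))); last by field; rewrite gt_eqF.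
  by rewrite ler_wpM2l// divr_ge0// ltW.
have : (2 * ln (n p)%:R / eta + 1) * expR (1 - c * p%:R `^ (a + d)) <= eps / 2.
  apply: (@le_trans _ _ (C * expR (p%:R `^ (a + d / 2)) * expR (1 - c * p%:R `^ (a + d)))).
    by rewrite ler_wpM2r ?expR_ge0.
  rewrite -mulrA -expRD mulrC -ler_pdivlMr//; apply: le_trans e2.
  by rewrite ler_expR; lra.
lra.
Unshelve. all: by end_near. Qed.

Lemma near_rho_ge0 : forall p, 0 <= rho p. Proof. by move=> p; exact: sqrtr_ge0. Qed.

Lemma near_n_gt1 : \forall p \near \oo, (1 < n p)%N.
Proof.
near=> p.
have [] : [/\ (1 < n p)%N, p%:R `^ (a - 1) <= ln (ln (n p)%:R) &
     ln (ln (n p)%:R) <= p%:R `^ (a + 1) :> R] by near: p; exact: near_loglog.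
by [].
Unshelve. all: by end_near. Qed.

(** The gain w = s rho^2 / 64 has exponent (1 + a) / 2 + b1 - beta at least, so w^2 dominates p^(a +
    b1 - beta) times the null mean, which is at most p. *)
Lemma upper_quadratic_regime (eps : R) : a <= 1 - 2 * b1 -> 0 < eps ->
  \forall p \near \oo, (risk_2side p (n p) (rho p) (s p) <= eps%:E)%E.
Proof.
move=> ha; have bb := b1beta; have bl := b11; have ap := a0; have /andP[bp bq] := beta01.
have d0 : 0 < b1 - beta by lra.
have c0 : 0 < 1 / 128 :> R by lra.
have ad0 : 0 < a + (b1 - beta) by lra.
apply: (near_risk_small ltr01 c0 d0 ad0).
near=> p.
have p1 : 1 <= p%:R :> R by near: p; exact: near_natr_ge.
have p0 : 0 < p%:R :> R by exact: lt_le_trans p1.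
have n1 : (1 < n p)%N by near: p; exact: near_n_gt1.
have [s0 sp s1 _] : [/\ (0 < s p)%N, (s p <= p)%N,
  p%:R `^ (1 - beta) / 2 <= (s p)%:R :> R & (s p)%:R <= 2 * p%:R `^ (1 - beta)].
  by near: p; exact: near_s.
have rE : rho p ^+ 2 = p%:R `^ ((a - (1 - 2 * b1)) / 2).
  by rewrite sqr_rho_star// /rho_star_sq ha.
have r1 : rho p ^+ 2 <= 1.
  by rewrite rE -[leRHS](powRr0 p%:R) ler_powR//; lra.
have s21 : 1 <= Num.sqrt 2 :> R by rewrite -[leLHS]sqrtr1 ler_wsqrtr//; lra.
have s22 : Num.sqrt 2 <= 2 :> R.
  rewrite -[leRHS](@ger0_norm R)// -sqrtr_sqr ler_wsqrtr// expr2; lra.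
have s2p : 0 < Num.sqrt 2 :> R by exact: lt_le_trans s21.
set P1 := p%:R `^ (a + (b1 - beta)).
have P10 : 0 < P1 by exact: powR_gt0.
have q0 : shifted_mean (@bump_score R) 0 = 1 - (Num.sqrt 2)^-1.
  by rewrite bump_score_mean expr0n /= oppr0 mul0r expR0 mul1r.
have w1 : p%:R `^ ((1 + a) / 2 + (b1 - beta)) / 128 <= (s p)%:R * (rho p ^+ 2 / 64).
  have -> : p%:R `^ ((1 + a) / 2 + (b1 - beta)) / 128 = (p%:R `^ (1 - beta) / 2) * (rho p ^+ 2 / 64).
    rewrite rE mulrACA powR_mul// -invfM -natrM; congr (_ `^ _ / _); lra.
  by rewrite ler_wpM2r// divr_ge0// sqr_ge0.
have H := @risk_le_moderate R p (n p) (s p) (@bump_score R) (rho p) 1 (rho p ^+ 2 / 64) P1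
  n1 ltr01 (near_rho_ge0 p) (measurable_bump_score) (@bump_score01 R).
apply: (le_trans (H _ _ _ P10 _ _)).
- by rewrite divr_ge0// sqr_ge0.
- move=> m; rewrite !bump_score_mean lerD2l lerN2 ler_wpM2r ?invr_ge0 ?(ltW s2p)//.
  by rewrite ler_expR !mulNr lerN2 expr0n /= mul0r divr_ge0// sqr_ge0.
(* Origin of 64: a correlation of at least e^(-1/2) >= 1/2 leaves m^2 >= rho^2 / 4, then e^(-m^2 /
   4) <= 1 - rho^2 / 32, and 1 / sqrt 2 >= 1/2. *)
- move=> m hm; rewrite q0 bump_score_mean.
  have m2 : rho p ^+ 2 / 4 <= m ^+ 2.
    rewrite -(real_normK (num_real m)); apply: le_trans (_ : (expR (-1 / 2) * rho p) ^+ 2 <= _).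
      rewrite exprMn mulrC ler_wpM2r ?sqr_ge0// expr2 -expRD.
      have -> : -1 / 2 + -1 / 2 = - 1 :> R by lra.
      rewrite expRN lef_pV2 ?posrE ?expR_gt0//.
      have h : expR (2^-1) <= 2 :> R.
        have := @expR_ge1Dx R (- 2^-1); rewrite expRN => e2.
        by rewrite -[leRHS]invrK -[leLHS]invrK lef_pV2 ?posrE ?invr_gt0 ?expR_gt0//; lra.
      rewrite [X in expR X](_ : 1 = 2^-1 + 2^-1 :> R); last by lra.
      rewrite expRD (_ : 4 = 2 * 2 :> R); last by lra.
      by apply: ler_pM => //; exact: expR_ge0.
    rewrite ler_pXn2r// ?nnegrE// mulr_ge0 ?expR_ge0//; exact: near_rho_ge0.
  set u := rho p ^+ 2 / 16.
  have u0 : 0 <= u by rewrite divr_ge0// sqr_ge0.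
  have e1 : expR (- m ^+ 2 / 4) <= 1 - u / 2.
    apply: (@le_trans _ _ (expR (- u))).
      by rewrite ler_expR mulNr lerN2 /u; lra.
    have := @expR_le_quad R (- u); rewrite sqrrN => /(_ _)H1; apply: (le_trans (H1 _)); first lra.
    have : u * u <= u * (1 / 16) by rewrite ler_wpM2l// /u; lra.
    by rewrite expr2; lra.
  have : expR (- m ^+ 2 / 4) / Num.sqrt 2 <= (1 - u / 2) / Num.sqrt 2.
    by rewrite ler_wpM2r ?invr_ge0 ?(ltW s2p).
  have : u / 2 / 2 <= u / 2 / Num.sqrt 2.
    by apply: ler_wpM2l; [exact: divr_ge0|rewrite lef_pV2 ?posrE].
  rewrite mulrBl mul1r /u; lra.
- apply: le_trans w1; rewrite ler_pdivlMr// mulrC /P1.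
  by near: p; apply: near_powR_le; lra.
- have qle : p%:R * shifted_mean (@bump_score R) 0 <= p%:R.
    by rewrite ler_piMr// q0 gerBl invr_ge0 ltW.
  apply: (@le_trans _ _ (P1 * p%:R)); first by rewrite ler_wpM2l ?(ltW P10).
  apply: (@le_trans _ _ ((p%:R `^ ((1 + a) / 2 + (b1 - beta)) / 128) ^+ 2)).
    rewrite exprMn -[X in _ <= X * _]powR_mulrn ?powR_ge0// -powRrM -[X in P1 * X](powRr1 (ltW p0)) powR_mul//.
    rewrite exprVn ler_pdivlMr ?exprn_gt0// mulrC.
    by near: p; apply: near_powR_le; lra.
  by rewrite !expr2; apply: ler_pM => //; rewrite divr_ge0// powR_ge0.
have e128 : - (P1 / 128) <= 1 - 1 / 128 * P1 by lra.
rewrite lee_fin; apply: lerD; last by rewrite ler_expR.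
rewrite ler_wpM2l ?ler_expR// addr_ge0// divr_ge0// mulr_ge0// ln_ge0// ler1n.
exact: ltnW.
Unshelve. all: by end_near. Qed.

End UpperAsymptotics.

Section ScaledBounds.
Context {R : realFieldType}.

Lemma opp_div_le (x : R) : - (x / 128) <= 1 - 1 / 128 * x.
Proof. lra. Qed.

Lemma ler_mul_div256 (c x y : R) : 0 <= c -> 0 <= x -> x / 2 <= y ->
  c / 256 * x <= c / 64 * y.
Proof.
move=> c0 x0 xy; have := ler_wpM2l c0 xy; have := mulr_ge0 c0 x0.
rewrite mulrA [c / 256 * x]mulrAC [c / 64 * y]mulrAC.
by move: (c * x) (c * y) => u v; lra.
Qed.

Lemma ler_mul_div128 (c x y : R) : 0 <= c -> x / 2 <= y ->
  c / 256 * x <= c / 128 * y.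
Proof.
move=> c0 xy; have := ler_wpM2l c0 xy.
rewrite mulrA [c / 256 * x]mulrAC [c / 128 * y]mulrAC.
by move: (c * x) (c * y) => u v; lra.
Qed.

End ScaledBounds.

(** * Exceedance probabilities at logarithmic energy *)

Section ThresholdAlternative.
Context {R : realType}.

Lemma exceed_mean_null_ln (qq l : R) : 0 <= qq -> 0 < l ->
  shifted_mean (exceed (Num.sqrt qq * Num.sqrt (2 * l))) 0 <= 2 * expR (- qq * l).
Proof.
move=> q0 l0; apply: (le_trans (exceed_mean_null _)).
  by rewrite mulr_ge0 ?sqrtr_ge0.
rewrite ler_wpM2l// ler_expR exprMn !sqr_sqrtr//; last by rewrite mulr_ge0// ltW.
by rewrite le_eqVlt; apply/orP; left; apply/eqP; field.
Qed.

(** The margin [e] is spent in halves: one pays for the correlation lost on a grid of mesh e / sqrt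
    r, the other for the unit interval in [exceed_mean_tail]. *)
Lemma exceed_mean_alt_ln (r qq e l m : R) : 0 < r -> r <= qq -> 0 < e -> 0 < l ->
  2 <= e * Num.sqrt (2 * l) ->
  expR (- (e / Num.sqrt r) / 2) * (Num.sqrt r * Num.sqrt (2 * l)) <= `|m| ->
  normal_peak 1 * expR (- (Num.sqrt qq - Num.sqrt r + e) ^+ 2 * l) <=
  shifted_mean (exceed (Num.sqrt qq * Num.sqrt (2 * l))) m.
Proof.
move=> r0 rq e0 l0 eL.
have l20 : 0 <= 2 * l by rewrite mulr_ge0// ltW.
have sr0 : 0 < Num.sqrt r by rewrite sqrtr_gt0.
have sqr : Num.sqrt r <= Num.sqrt qq by rewrite ler_wsqrtr.
have L0 : 0 < Num.sqrt (2 * l) by rewrite sqrtr_gt0 mulr_gt0.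
have L2 : Num.sqrt (2 * l) ^+ 2 = 2 * l by rewrite sqr_sqrtr.
move: L0 L2 eL sr0 sqr; move: (Num.sqrt (2 * l)) (Num.sqrt r) (Num.sqrt qq) => L u v L0 L2 eL u0 uv hm.
have x0 : 0 <= (v - u + e / 2) * L.
  by apply: mulr_ge0; [apply: addr_ge0; [rewrite subr_ge0|rewrite divr_ge0// ltW]|exact: ltW].
have tb : v * L - expR (- (e / u) / 2) * (u * L) <= (v - u + e / 2) * L.
  have h : 1 - (e / u) / 2 <= expR (- (e / u) / 2).
    by have := @expR_ge1Dx R (- (e / u) / 2); rewrite mulNr.
  have uL : 0 <= u * L by rewrite mulr_ge0 ?ltW.
  have := ler_wpM2r uL h.
  have -> : (1 - e / u / 2) * (u * L) = u * L - e / 2 * L by field; rewrite gt_eqF.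
  have -> : (v - u + e / 2) * L = v * L - u * L + e / 2 * L by ring.
  lra.
apply: (le_trans _ (exceed_mean_tail hm x0 tb)).
rewrite ler_wpM2l ?normal_peak_ge0// ler_expR !mulNr lerN2.
rewrite [leRHS](_ : _ = ((v - u + e) * L) ^+ 2 / 2); last by rewrite exprMn L2; field.
have x1 : (v - u + e / 2) * L + 1 <= (v - u + e) * L.
  rewrite [leRHS](_ : _ = (v - u + e / 2) * L + e * L / 2); last by field.
  by rewrite lerD2l ler_pdivlMr// mul1r.
by rewrite ler_wpM2r// ler_pXn2r// nnegrE; [rewrite addr_ge0|apply: le_trans x1; rewrite addr_ge0].
Qed.

(** Since 4 e^(-qq l) <= t, the null mean is at most t / 2, and t / 2 is left as the gain of an
    active row. *)
Lemma risk_le_threshold (p n s : nat) (rho r qq e l H : R) :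
  let t := normal_peak 1 * expR (- (Num.sqrt qq - Num.sqrt r + e) ^+ 2 * l) in
  (1 < n)%N -> 0 < r -> r <= qq -> 0 < e -> 0 < l -> 2 <= e * Num.sqrt (2 * l) ->
  rho = Num.sqrt r * Num.sqrt (2 * l) ->
  4 * expR (- qq * l) <= t -> 0 < H -> H <= s%:R * (t / 2) ->
  H * (p%:R * (2 * expR (- qq * l))) <= (s%:R * (t / 2)) ^+ 2 ->
  (risk_2side p n rho s <= ((2 * ln n%:R / (e / Num.sqrt r) + 1) * expR (- (H / 128)) + expR (- (H / 128)))%:E)%E.
Proof.
move=> t n1 r0 rq e0 l0 eL rhoE tq H0 Hw Hq.
have t0 : 0 <= t by rewrite mulr_ge0 ?normal_peak_ge0 ?expR_ge0.
have qq0 : 0 <= qq by exact: le_trans (ltW r0) rq.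
have tau0 : 0 <= Num.sqrt qq * Num.sqrt (2 * l) by rewrite mulr_ge0 ?sqrtr_ge0.
have qnull := exceed_mean_null_ln qq0 l0.
apply: (@risk_le_moderate R p n s (exceed (Num.sqrt qq * Num.sqrt (2 * l))) rho (e / Num.sqrt r) (t / 2) H) => //.
- by rewrite divr_gt0// sqrtr_gt0.
- by rewrite rhoE mulr_ge0 ?sqrtr_ge0.
- exact: measurable_exceed.
- exact: exceed01.
- by rewrite divr_ge0.
- exact: exceed_mean_ge.
- move=> m; rewrite rhoE => hm.
  have := exceed_mean_alt_ln r0 rq e0 l0 eL hm; rewrite -/t.
  by move: qnull tq; lra.
- apply: le_trans Hq; rewrite ler_wpM2l ?(ltW H0)// ler_wpM2l//.
Qed.

End ThresholdAlternative.

(** * Upper bound at logarithmic energy *)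

Section ThresholdRegime.
Context {R : realType} (a beta b1 : R) (n s : nat -> nat).
Hypothesis a0 : 0 < a.
Hypothesis b1beta : beta < b1.
Hypothesis b11 : b1 < 1.
Hypothesis beta01 : 0 < beta < 1.
Hypothesis hn : (fun p : nat => ln (ln (ln (n p)%:R)) / (a * ln p%:R)) @ \oo --> (1 : R).
Hypothesis hs : (fun p : nat => (s p)%:R / p%:R `^ (1 - beta)) @ \oo --> (1 : R).
Let rho (p : nat) := rho_star a b1 p.

(** At [b1], the exceedances of active rows have exponent 1 - b1 - (sqrt qq - sqrt r)^2. The
    conditions ask that this reach a, and that its double reach a plus the exponent 1 - qq of the
    null count. Equality is allowed, beta < b1 supplying the room. *)
Lemma upper_threshold_regime (r qq eps : R) : 0 < r -> r <= qq ->
  (Num.sqrt qq - Num.sqrt r) ^+ 2 < qq ->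
  a <= 1 - b1 - (Num.sqrt qq - Num.sqrt r) ^+ 2 ->
  1 - qq + a <= 2 * (1 - b1 - (Num.sqrt qq - Num.sqrt r) ^+ 2) ->
  (\forall p \near \oo, rho p ^+ 2 = 2 * r * ln p%:R) -> 0 < eps ->
  \forall p \near \oo, (risk_2side p (n p) (rho p) (s p) <= eps%:E)%E.
Proof.
move=> r0 rq d0q ha1 ha2 hr; have bb := b1beta; have bl := b11; have ap := a0; have /andP[bp bq] := beta01.
have de0 : 0 < (b1 - beta) / 2 by lra.
have ade0 : 0 < a + (b1 - beta) / 2 by lra.
have c128 : 0 < 1 / 128 :> R by lra.
set d0 := Num.sqrt qq - Num.sqrt r in d0q ha1 ha2.
have d00 : 0 <= d0 by rewrite subr_ge0 ler_wsqrtr.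
have sr0 : 0 < Num.sqrt r by rewrite sqrtr_gt0.
(* Loss of exponent conceded to the margin [e]: the first bound keeps it small against b1 - beta,
   the second keeps the active tail heavier than the null one. *)
pose k := Num.min ((b1 - beta) / 8) ((qq - d0 ^+ 2) / 2).
have k0 : 0 < k by rewrite lt_min; apply/andP; split; lra.
have kb : k <= (b1 - beta) / 8 by rewrite ge_min lexx.
have kq : k <= (qq - d0 ^+ 2) / 2 by rewrite ge_min lexx orbT.
pose e := Num.min 1 (k / (2 * d0 + 1)).
have dd0 : 0 < 2 * d0 + 1 by lra.
have e0 : 0 < e by rewrite lt_min ltr01 divr_gt0.
have e1 : e <= 1 by rewrite ge_min lexx.
have ek : e * (2 * d0 + 1) <= k by rewrite -ler_pdivlMr// ge_min lexx orbT.
pose D := (d0 + e) ^+ 2.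
have Dk : D <= d0 ^+ 2 + k.
  have -> : D = d0 ^+ 2 + e * (2 * d0 + e) by rewrite /D; ring.
  have : e * (2 * d0 + e) <= e * (2 * d0 + 1) by rewrite ler_wpM2l ?(ltW e0)//; lra.
  lra.
pose eta := e / Num.sqrt r.
have eta0 : 0 < eta by rewrite divr_gt0.
pose c0 : R := normal_peak 1.
have c00 : 0 < c0 by rewrite normal_peak_gt0// oner_eq0.
have Dqq : D < qq by lra.
have x1 : a + (b1 - beta) / 2 < 1 - beta - D by lra.
have x2 : a + (b1 - beta) / 2 + (1 - qq) < (1 - beta - D) * 2 by lra.
apply: (near_risk_small a0 hn eta0 c128 de0 ade0).
near=> p.
have p1 : 1 <= p%:R :> R by near: p; exact: near_natr_ge.
have p0 : 0 < p%:R :> R by exact: lt_le_trans p1.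
have n1 : (1 < n p)%N by near: p; exact: (near_n_gt1 a0 hn).
have [s0 sp s1 _] : [/\ (0 < s p)%N, (s p <= p)%N,
  p%:R `^ (1 - beta) / 2 <= (s p)%:R :> R & (s p)%:R <= 2 * p%:R `^ (1 - beta)].
  by near: p; exact: near_s.
have rE : rho p ^+ 2 = 2 * r * ln p%:R by near: p.
have l1 : 2 / e ^+ 2 <= ln p%:R by near: p; exact: near_ln_ge.
have lq : c0^-1 * 4 * p%:R `^ (- qq) <= p%:R `^ (- D).
  by near: p; apply: near_powR_le; rewrite ltrN2.
have B1 : 4 / c0 * p%:R `^ (a + (b1 - beta) / 2) <= p%:R `^ (1 - beta - D).
  by near: p; exact: near_powR_le.
have B2 : 32 / c0 ^+ 2 * p%:R `^ (a + (b1 - beta) / 2 + (1 - qq)) <= p%:R `^ ((1 - beta - D) * 2).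
  by near: p; exact: near_powR_le.
pose l : R := ln p%:R.
have l0 : 0 < l.
  by apply: lt_le_trans l1; rewrite divr_gt0// exprn_gt0.
have l20 : 0 <= 2 * l by rewrite mulr_ge0// ltW.
have rhoE : rho p = Num.sqrt r * Num.sqrt (2 * l).
  rewrite -sqrtrM ?(ltW r0)// -[LHS]ger0_norm ?(near_rho_ge0 a b1)// -sqrtr_sqr rE.
  by congr Num.sqrt; rewrite /l; ring.
have eL : 2 <= e * Num.sqrt (2 * l).
  rewrite -(@ler_pXn2r _ 2%N) ?nnegrE ?mulr_ge0 ?sqrtr_ge0 ?(ltW e0)// exprMn sqr_sqrtr//.
  rewrite expr2 mulrCA ler_wpM2l// mulrC -ler_pdivrMr ?exprn_gt0//.
set t := normal_peak 1 * expR (- (Num.sqrt qq - Num.sqrt r + e) ^+ 2 * l).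
have tE : t = c0 * p%:R `^ (- D) by rewrite /t powR_expR.
have P10 : 0 < p%:R `^ (a + (b1 - beta) / 2) :> R by exact: powR_gt0.
have eq : expR (- qq * l) = p%:R `^ (- qq) by rewrite powR_expR.
have w1 : c0 / 4 * p%:R `^ (1 - beta - D) <= (s p)%:R * (t / 2).
  rewrite -(powR_mul _ _ p0) tE [leLHS](_ : _ = p%:R `^ (1 - beta) / 2 * (c0 * p%:R `^ (- D) / 2)); last by field.
  by rewrite ler_wpM2r// divr_ge0// mulr_ge0 ?powR_ge0// ltW.
have c40 : 0 <= c0 / 4 by rewrite divr_ge0// ltW.
have tq : 4 * expR (- qq * l) <= t.
  rewrite eq tE; have := ler_wpM2l (ltW c00) lq.
  by rewrite !mulrA divff ?gt_eqF// mul1r.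
have Hw : p%:R `^ (a + (b1 - beta) / 2) <= (s p)%:R * (t / 2).
  apply: le_trans w1; apply: le_trans (ler_wpM2l c40 B1).
  by rewrite le_eqVlt; apply/orP; left; apply/eqP; field; rewrite gt_eqF.
have Hq : p%:R `^ (a + (b1 - beta) / 2) * (p%:R * (2 * expR (- qq * l))) <= ((s p)%:R * (t / 2)) ^+ 2.
  apply: (@le_trans _ _ ((c0 / 4 * p%:R `^ (1 - beta - D)) ^+ 2)); last first.
    by rewrite !expr2; apply: ler_pM => //; rewrite mulr_ge0 ?powR_ge0.
  rewrite exprMn -(powR_mulrn 2 (powR_ge0 _ _)) -powRrM.
  apply: le_trans (ler_wpM2l (sqr_ge0 (c0 / 4)) B2).
  rewrite eq -!(powR_mul _ _ p0) powRr1 ?(ltW p0)//.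
  by rewrite le_eqVlt; apply/orP; left; apply/eqP; field; rewrite gt_eqF.
apply: (le_trans (risk_le_threshold n1 r0 rq e0 l0 eL rhoE tq P10 Hw Hq)).
rewrite lee_fin.
apply: lerD; last by rewrite ler_expR opp_div_le.
rewrite ler_wpM2l ?ler_expR ?opp_div_le// addr_ge0// divr_ge0 ?(ltW eta0)// mulr_ge0// ln_ge0// ler1n.
exact: ltnW.
Unshelve. all: by end_near. Qed.

End ThresholdRegime.

(** * Polynomially large energy, and the upper bound in all regimes *)

Section UpperLarge.
Context {R : realType}.
(** The bound of [exceed_mean_tail] at [x = 0]: a row whose mean reaches the threshold exceeds it
    with at least this probability. *)
Let c1 : R := normal_peak 1 * expR (- (0 + 1) ^+ 2 / 2).

Lemma expRN_ge_half : 1 / 2 <= expR (- (1 / 2)) :> R.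
Proof. by have := @expR_ge1Dx R (- (1 / 2)); lra. Qed.

(** The p^a of the union bound may exceed s, so a bounded tilt would not suffice. Null exceedances
    are so rare that the tilt rho^2 / 16 costs only a constant and yields the exponent rho^2 s;
    misses are controlled by the constant tilt 1/16. *)
Lemma risk_le_large (p n s : nat) (rho : R) : (1 < n)%N -> 0 <= rho ->
  2 * expR (- (rho ^+ 2 / 8)) <= c1 / 2 ->
  p%:R * (2 * expR (- (rho ^+ 2 / 16))) <= 1 ->
  (risk_2side p n rho s <= ((2 * ln n%:R / 1 + 1) * expR (1 - c1 / 64 * (rho ^+ 2 * s%:R)) +
     expR (1 - c1 / 128 * s%:R))%:E)%E.
Proof.
move=> n1 rho0 hq hp.
have tau0 : 0 <= rho / 2 by rewrite divr_ge0.
have c10 : 0 <= c1 by rewrite mulr_ge0 ?normal_peak_ge0 ?expR_ge0.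
have qnull : shifted_mean (exceed (rho / 2)) 0 <= 2 * expR (- (rho ^+ 2 / 8)).
  apply: (le_trans (exceed_mean_null tau0)); rewrite ler_wpM2l// ler_expR.
  by rewrite le_eqVlt; apply/orP; left; apply/eqP; field.
set q0 := shifted_mean (exceed (rho / 2)) 0 in qnull.
have q00 : 0 <= q0.
  by rewrite fine_ge0//; apply: integral_ge0 => z _; rewrite lee_fin; case/andP: (exceed01 (rho / 2) (0 + z)).
have A0 : 0 <= p%:R * q0 by rewrite mulr_ge0.
have eA : expR (rho ^+ 2 / 16) * (p%:R * q0) <= 1.
  apply: le_trans hp; rewrite mulrCA ler_wpM2l//.
  apply: (@le_trans _ _ (expR (rho ^+ 2 / 16) * (2 * expR (- (rho ^+ 2 / 8))))).
    by rewrite ler_wpM2l ?expR_ge0.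
  rewrite mulrCA -expRD ler_wpM2l// ler_expR.
  by rewrite le_eqVlt; apply/orP; left; apply/eqP; field.
have A1 : p%:R * q0 <= 1.
  apply: le_trans eA; rewrite ler_peMl//.
  by rewrite -[leLHS]expR0 ler_expR divr_ge0 ?sqr_ge0.
apply: (@risk_le_grid R p n s (exceed (rho / 2)) rho 1 (c1 / 2) (rho ^+ 2 / 16) (1 / 16)
  (p%:R * q0 + s%:R * (c1 / 2) / 2)) => //.
- exact: measurable_exceed.
- exact: exceed01.
- by rewrite divr_ge0.
- by rewrite divr_ge0// sqr_ge0.
- exact: exceed_mean_ge.
- move=> m hm; have hm2 : rho / 2 <= `|m|.
    apply: le_trans hm; rewrite mulrC ler_wpM2r// mulNr.
    by have := expRN_ge_half; rewrite mul1r.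
  have x0 : rho / 2 - rho / 2 <= 0 by rewrite subrr.
  have := exceed_mean_tail hm2 (lexx 0) x0; rewrite -/c1 -/q0.
  move: qnull hq; lra.
- rewrite -/q0 mulrBl mul1r mulrDr.
  have : 0 <= rho ^+ 2 / 16 * (p%:R * q0) by rewrite mulr_ge0// divr_ge0// sqr_ge0.
  have -> : rho ^+ 2 / 16 * (s%:R * (c1 / 2) / 2) = c1 / 64 * (rho ^+ 2 * s%:R) by field.
  move: eA A0; lra.
rewrite -/q0.
have le1 : expR (- (1 / 16)) <= 1 + (- (1 / 16)) + 2 * (- (1 / 16)) ^+ 2 :> R.
  by apply: expR_le_quad; lra.
have w0 : 0 <= s%:R * (c1 / 2) by rewrite mulr_ge0// divr_ge0.
have Aw : 0 <= p%:R * q0 + s%:R * (c1 / 2) by exact: addr_ge0.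
have le2 : expR (- (1 / 16)) - 1 <= - (1 / 16) + 2 * (- (1 / 16)) ^+ 2 :> R.
  by rewrite lerBlDl addrA.
have := ler_wpM2r Aw le2.
rewrite (_ : c1 / 128 * s%:R = s%:R * (c1 / 2) / 64); last by field.
move: w0 A1 A0; move: (p%:R * q0) (s%:R * (c1 / 2)) => A w.
rewrite expr2; move: (_ * (A + w)) => X; lra.
Qed.

Context (a beta b1 : R) (n s : nat -> nat).
Hypothesis a0 : 0 < a.
Hypothesis b1beta : beta < b1.
Hypothesis b10 : 0 < b1.
Hypothesis b11 : b1 < 1.
Hypothesis beta01 : 0 < beta < 1.
Hypothesis hn : (fun p : nat => ln (ln (ln (n p)%:R)) / (a * ln p%:R)) @ \oo --> (1 : R).
Hypothesis hs : (fun p : nat => (s p)%:R / p%:R `^ (1 - beta)) @ \oo --> (1 : R).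
Let rho (p : nat) := rho_star a b1 p.

Lemma upper_large_regime (eps : R) : 1 - b1 < a ->
  (\forall p \near \oo, rho p ^+ 2 = p%:R `^ (a - (1 - b1))) -> 0 < eps ->
  \forall p \near \oo, (risk_2side p (n p) (rho p) (s p) <= eps%:E)%E.
Proof.
move=> ha hr; have bb := b1beta; have ap := a0; have /andP[bp bq] := beta01.
have d0 : 0 < b1 - beta by lra.
have d'0 : 0 < 1 - beta by lra.
have k0 : 0 < a - (1 - b1) by lra.
have c10 : 0 < c1 by rewrite mulr_gt0 ?normal_peak_gt0 ?oner_eq0// expR_gt0.
have c0 : 0 < c1 / 256 by rewrite divr_gt0.
have c4 : 0 < c1 / 4 by rewrite divr_gt0.
apply: (near_risk_small a0 hn (@ltr01 R) c0 d0 d'0).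
near=> p.
have p1 : 1 <= p%:R :> R by near: p; exact: near_natr_ge.
have p0 : 0 < p%:R :> R by exact: lt_le_trans p1.
have n1 : (1 < n p)%N by near: p; exact: (near_n_gt1 a0 hn).
have [s0 sp s1 _] : [/\ (0 < s p)%N, (s p <= p)%N,
  p%:R `^ (1 - beta) / 2 <= (s p)%:R :> R & (s p)%:R <= 2 * p%:R `^ (1 - beta)].
  by near: p; exact: near_s.
have rE : rho p ^+ 2 = p%:R `^ (a - (1 - b1)) by near: p.
have h1 : 1 <= ln p%:R :> R by near: p; exact: near_ln_ge.
have h2 : 32 * ln p%:R <= p%:R `^ (a - (1 - b1)) by near: p; exact: near_ln_le_powR.
have h3 : - ln (c1 / 4) * 8 * p%:R `^ 0 <= p%:R `^ (a - (1 - b1)) by near: p; exact: near_powR_le.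
have hq : 2 * expR (- (rho p ^+ 2 / 8)) <= c1 / 2.
  have : expR (- (rho p ^+ 2 / 8)) <= c1 / 4.
    rewrite -[leRHS]lnK ?posrE// ler_expR rE lerNl ler_pdivlMr//.
    by move: h3; rewrite powRr0 mulr1.
  by move: (expR _) => x; lra.
have hp : p%:R * (2 * expR (- (rho p ^+ 2 / 16))) <= 1.
  have e2 : 2 <= expR 1 :> R by have := @expR_ge1Dx R 1; lra.
  apply: (@le_trans _ _ (expR (ln p%:R) * (expR 1 * expR (- (rho p ^+ 2 / 16))))).
    by rewrite lnK ?posrE// ler_wpM2l// ler_wpM2r ?expR_ge0.
  rewrite -!expRD -[leRHS]expR0 ler_expR rE; move: h1 h2.
  by move: (p%:R `^ _) (ln p%:R) => x y; lra.
apply: (le_trans (risk_le_large _ n1 (near_rho_ge0 a b1 p) hq hp)).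
rewrite lee_fin; apply: lerD.
  rewrite ler_wpM2l ?addr_ge0 ?divr_ge0 ?mulr_ge0 ?ln_ge0 ?ler1n ?(ltnW n1)//.
  rewrite ler_expR lerD2l lerN2.
  have : p%:R `^ (a + (b1 - beta)) / 2 <= rho p ^+ 2 * (s p)%:R.
    have -> : a + (b1 - beta) = (a - (1 - b1)) + (1 - beta) by ring.
    by rewrite rE -(powR_mul _ _ p0) -mulrA ler_wpM2l ?powR_ge0.
  by apply: ler_mul_div256; rewrite ?(ltW c10)// powR_ge0.
by rewrite ler_expR lerD2l lerN2; apply: ler_mul_div128 => //; exact: ltW.
Unshelve. all: by end_near. Qed.

Lemma upper_risk (eps : R) : 0 < eps ->
  \forall p \near \oo, (risk_2side p (n p) (rho p) (s p) <= eps%:E)%E.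
Proof.
move=> eps0; have bb := b1beta; have b1p := b10; have bl := b11; have ap := a0.
have [h1|h1] := leP a (1 - 2 * b1).
  exact: (upper_quadratic_regime a0 b1beta b11 beta01 hn hs).
have [h2|h2] := leP a (1 - 4 * b1 / 3).
  (* At level 4 r the quadratic condition of [upper_threshold_regime] is an equality, and the linear
     one is exactly a <= 1 - 4 b1 / 3. *)
  set r := (a - (1 - 2 * b1)) / 2.
  have r0 : 0 < r by rewrite /r; lra.
  have s4 : Num.sqrt (4 * r) - Num.sqrt r = Num.sqrt r.
    rewrite sqrtrM// (_ : 4 = 2 ^+ 2 :> R) ?sqrtr_sqr ?ger0_norm//; first ring.
    by rewrite expr2; lra.
  have s2 : Num.sqrt r ^+ 2 = r by rewrite sqr_sqrtr// ltW.
  apply: (@upper_threshold_regime _ a beta b1 n s a0 b1beta b11 beta01 hn hs r (4 * r)) => //; rewrite ?s4 ?s2; try (rewrite /r; lra).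
  near=> p; rewrite sqr_rho_star; last by near: p; exact: near_natr_ge.
  by rewrite /rho_star_sq leNgt h1 /= h2 /r; field.
have [h3|h3] := leP a (1 - b1).
  set u := Num.sqrt (1 - a); set v := Num.sqrt (1 - a - b1).
  have u2 : u ^+ 2 = 1 - a by rewrite sqr_sqrtr//; lra.
  have v2 : v ^+ 2 = 1 - a - b1 by rewrite sqr_sqrtr//; lra.
  have v0 : 0 <= v by exact: sqrtr_ge0.
  have u0 : 0 <= u by exact: sqrtr_ge0.
  have uv : v < u by rewrite -(@ltr_pXn2r _ 2%N) ?nnegrE// u2 v2; lra.
  have sE : Num.sqrt ((u - v) ^+ 2) = u - v by rewrite sqrtr_sqr ger0_norm// subr_ge0 ltW.
  have dE : Num.sqrt (1 - a) - Num.sqrt ((u - v) ^+ 2) = v by rewrite sE -/u; lra.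
  (* At level 1 - a the square roots differ by v, and both conditions are equalities. *)
  apply: (@upper_threshold_regime _ a beta b1 n s a0 b1beta b11 beta01 hn hs ((u - v) ^+ 2) (1 - a)) => //; rewrite ?dE ?v2; try lra.
  - by rewrite exprn_gt0// subr_gt0.
  - by rewrite -u2 ler_pXn2r// ?nnegrE ?subr_ge0 ?(ltW uv)// gerBl.
  near=> p; rewrite sqr_rho_star; last by near: p; exact: near_natr_ge.
  by rewrite /rho_star_sq leNgt h1 /= leNgt h2 /= h3.
apply: upper_large_regime => //.
near=> p; rewrite /rho sqr_rho_star; last by near: p; exact: near_natr_ge.
by rewrite /rho_star_sq leNgt h1 /= leNgt h2 /= leNgt h3.
Unshelve. all: by end_near. Qed.

End UpperLarge.

Theorem theorem2 (R : realType) (a beta1 beta : R) (n s : nat -> nat) :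
  0 < a -> 0 < beta1 < 1 -> 0 < beta < 1 ->
  (fun p : nat => ln (ln (ln (n p)%:R)) / (a * ln p%:R)) @ \oo --> (1 : R) ->
  (fun p : nat => (s p)%:R / p%:R `^ (1 - beta)) @ \oo --> (1 : R) ->
  (beta1 < beta ->
     ~ ((fun p : nat => risk_2side p (n p) (rho_star a beta1 p) (s p))
          @ \oo --> 0%E)) /\
  (beta < beta1 ->
     (fun p : nat => risk_2side p (n p) (rho_star a beta1 p) (s p))
       @ \oo --> 0%E).
Proof.
move=> a0 /andP[b10 b11] beta01 hn hs; split => [lt_b1|lt_b1].
  have [c c0 hc] := lower_risk a0 lt_b1 b10 beta01 hn hs.
  move=> /fine_cvgP[fin /cvgrPdist_le /(_ (c / 2))].
  rewrite divr_gt0// => /(_ isT) h; near \oo => p.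
  have hp : (c%:E <= risk_2side p (n p) (rho_star a beta1 p) (s p))%E by near: p.
  have fp : risk_2side p (n p) (rho_star a beta1 p) (s p) \is a fin_num by near: p.
  have : `|0 - fine (risk_2side p (n p) (rho_star a beta1 p) (s p))| <= c / 2 by near: p.
  move: hp; rewrite -(fineK fp) lee_fin sub0r normrN /= => hp.
  by rewrite ger0_norm ?(le_trans (ltW c0) hp)//; lra.
(* Together with the upper bound this gives the finiteness that convergence in the extended reals
   includes. *)
have ge0 : \forall p \near \oo, (0 <= risk_2side p (n p) (rho_star a beta1 p) (s p))%E.
  near=> p; apply: risk_2side_ge0.
  - by near: p; exact: (near_n_gt1 a0 hn).
  - have [] : [/\ (0 < s p)%N, (s p <= p)%N,
      p%:R `^ (1 - beta) / 2 <= (s p)%:R :> R & (s p)%:R <= 2 * p%:R `^ (1 - beta)].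
      by near: p; exact: near_s.
    by [].
  - exact: rho_star_ge0.
have up := upper_risk a0 lt_b1 b10 b11 beta01 hn hs.
apply/fine_cvgP; split.
  near=> p; rewrite ge0_fin_numE; last by near: p.
  by apply: (@le_lt_trans _ _ 1%E); [near: p; exact: up|exact: ltry].
apply/cvgrPdist_le => e e0; near=> p.
have h0 : (0 <= risk_2side p (n p) (rho_star a beta1 p) (s p))%E by near: p.
have he : (risk_2side p (n p) (rho_star a beta1 p) (s p) <= e%:E)%E by near: p; exact: up.
rewrite sub0r normrN /= ger0_norm ?fine_ge0//.
rewrite -lee_fin fineK// ge0_fin_numE//.
by apply: le_lt_trans he _; exact: ltry.
Unshelve. all: by end_near. Qed.
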